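(* There exist a probability space $(\Omega,\mu)$, a markovian semigroup $T_t=\exp(-tA)$ on $(\Omega,\mu)$, and a weight $w$ on $\Omega$ with $Q^A_2(w)<\infty$ such that $A$ does not have a Hörmander $\mathcal H^s$ calculus on $L^2(\Omega,w\,d\mu)$ for any $s>0$; that is, for no $s>0$ and no $C>0$ does the estimate $$\|m(A)\|_{L^2(\Omega,w\,d\mu)\to L^2(\Omega,w\,d\mu)}\le C\bigl(\|m\|_{\mathcal H^s}+|m(0)|\bigr)$$ hold for all $m\in\mathcal H^s$. In fact, for no $s>0$ and no $C>0$ does this estimate even hold for all the functions $m(\lambda)=\exp(-\lambda z)$ with $z\in\Sigma_{\pi/2}=\{z\in\mathbb C:\operatorname{Re}z>0\}$.
   Context: A $c_0$-semigroup $(T_t)_{t\ge0}$ on $L^2(\Omega,\mu)$ is markovian if each $T_t$ is self-adjoint, extends to a contraction on $L^p(\Omega)$ for all $p\in[1,\infty]$, satisfies $T_tf\ge0$ whenever $f\ge0$, and $T_t(1)=1$; $A$ is its negative generator. A weight is a measurable $w:\Omega\to(0,\infty)$; $T_t(w):=\lim_nT_t(w1_{w\le n})$, and $Q^A_2(w)=\sup_{t\ge0}\operatorname{ess\,sup}_{x\in\Omega}T_t(w)(x)T_t(w^{-1})(x)$. For $s>0$, $\mathcal H^s=\{m\in L^1_{\mathrm{loc}}(0,\infty):\|m\|_{\mathcal H^s}=\sup_{t>0}\|\eta\, m(t\,\cdot)\|_{W^\infty_s(\mathbb R)}<\infty\}$, where $\eta\in C_c^\infty(0,\infty)$ is a fixed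 non-zero function (different choices give equivalent norms) and $W^\infty_s(\mathbb R)$ is the usual Sobolev (Bessel potential) space of order $s$ over $L^\infty(\mathbb R)$. A value $m(0)\in\mathbb C$ is prescribed along with $m$ (for the exponentials $m(0)=1$), and $m(A)$ is defined by the self-adjoint functional calculus on $L^2(\Omega,\mu)$; the estimate is understood as: $m(A)$ restricted to $L^2(\Omega,\mu)\cap L^2(\Omega,w\,d\mu)$ extends to a bounded operator on $L^2(\Omega,w\,d\mu)$ with the stated bound. *)

(* Defs.v *)
From mathcomp Require Import all_boot all_order all_algebra.
From mathcomp Require Import complex.
From mathcomp Require Import all_classical all_reals all_analysis.
From mathcomp Require Import ess_sup_inf hoelder.

Set Implicit Arguments.
Unset Strict Implicit.
Unset Printing Implicit Defensive.

Import Order.TTheory GRing.Theory Num.Theory.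
Import numFieldNormedType.Exports.
Import ComplexField.

Local Open Scope classical_set_scope.
Local Open Scope ring_scope.

Local Notation Re := complex.Re.
Local Notation Im := complex.Im.

Definition cmod (R : realType) (z : R[i]) : R := Normc.normc z.

Definition cexp (R : realType) (z : R[i]) : R[i] :=
  Complex (expR (Re z) * cos (Im z)) (expR (Re z) * sin (Im z)).

Section ComplexValued.
Context d (X : measurableType d) (R : realType).
Implicit Types (mu : {measure set X -> \bar R}) (D : set X) (f g : X -> R[i]).

Definition cmeasurable D f : Prop :=
  measurable_fun D (fun x => Re (f x)) /\ measurable_fun D (fun x => Im (f x)).

Definition cintegrable mu D f : Prop :=
  mu.-integrable D (fun x => (Re (f x))%:E) /\
  mu.-integrable D (fun x => (Im (f x))%:E).

Definition cintegral mu D f : R[i] :=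
  Complex (\int[mu]_(x in D) Re (f x)) (\int[mu]_(x in D) Im (f x)).

Definition aeeq mu f g : Prop := \forall x \ae mu, f x = g x.

Definition inner mu f g : R[i] := cintegral mu setT (fun x => f x * conjc (g x)).

Definition cLnorm mu (p : \bar R) f : \bar R :=
  Lnorm mu p (fun x => (cmod (f x))%:E).

(* The norm of L^2(w dmu). *)
Definition wLnorm2 mu (w : X -> R) f : \bar R :=
  ((\int[mu]_x (cmod (f x) ^+ 2 * w x)%:E) `^ 2^-1)%E.

(* A function space is given by its norm [N] with values in [0, +oo]; its
   elements are represented by functions, equality being equality mu-a.e. *)
Definition in_space (N : (X -> R[i]) -> \bar R) f : Prop :=
  cmeasurable setT f /\ (N f < +oo)%E.

Definition inL2 mu f : Prop := in_space (cLnorm mu 2%:E) f.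

Record bounded_operator mu (N : (X -> R[i]) -> \bar R) (K : \bar R)
    (S : (X -> R[i]) -> X -> R[i]) : Prop := {
  bo_maps : forall f, in_space N f -> in_space N (S f) ;
  bo_ae : forall f g, in_space N f -> in_space N g ->
    aeeq mu f g -> aeeq mu (S f) (S g) ;
  bo_linear : forall (a : R[i]) f g, in_space N f -> in_space N g ->
    aeeq mu (S (fun x => a * f x + g x)) (fun x => a * S f x + S g x) ;
  bo_bound : forall f, in_space N f -> (N (S f) <= K * N f)%E }.

Definition bounded_on_L2 mu (S : (X -> R[i]) -> X -> R[i]) : Prop :=
  exists K : R, bounded_operator mu (cLnorm mu 2%:E) K%:E S.

Definition selfadjoint_on_L2 mu (S : (X -> R[i]) -> X -> R[i]) : Prop :=
  forall f g, inL2 mu f -> inL2 mu g -> inner mu (S f) g = inner mu f (S g).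

(* [S], restricted to the intersection of L^2(mu) with the space of [N],
   extends to an operator on the space of [N] with norm at most [K]. *)
Definition extends_boundedly mu (N : (X -> R[i]) -> \bar R) (K : \bar R)
    (S : (X -> R[i]) -> X -> R[i]) : Prop :=
  exists S', bounded_operator mu N K S' /\
    forall f, inL2 mu f -> in_space N f -> aeeq mu (S' f) (S f).

End ComplexValued.

Section Semigroup.
Context d (X : measurableType d) (R : realType).
Variable mu : {measure set X -> \bar R}.
Implicit Types (T : R -> (X -> R[i]) -> X -> R[i]) (w : X -> R) (f g : X -> R[i]).

Record c0_semigroup T : Prop := {
  sg_bounded : forall t, 0 <= t -> bounded_on_L2 mu (T t) ;
  sg_0 : forall f, inL2 mu f -> aeeq mu (T 0 f) f ;
  sg_add : forall s t f, 0 <= s -> 0 <= t -> inL2 mu f ->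
    aeeq mu (T (s + t) f) (T s (T t f)) ;
  sg_cts : forall f, inL2 mu f ->
    cLnorm mu 2%:E (fun x => T t f x - f x) @[t --> 0^'+] --> 0%E }.

(* On [R[i]], [0 <= z] means that [z] is real and nonnegative. *)
Record markovian T : Prop := {
  mk_c0 : c0_semigroup T ;
  mk_selfadjoint : forall t, 0 <= t -> selfadjoint_on_L2 mu (T t) ;
  mk_contractive : forall t (p : \bar R), 0 <= t -> (1 <= p)%E ->
    extends_boundedly mu (cLnorm mu p) 1%E (T t) ;
  mk_positive : forall t f, 0 <= t -> inL2 mu f ->
    (\forall x \ae mu, 0 <= f x) -> \forall x \ae mu, 0 <= T t f x ;
  mk_one : forall t, 0 <= t -> aeeq mu (T t (cst 1)) (cst 1) }.

(* The graph of the negative generator [A], where [T t = exp(- t A)]. *)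
Definition neg_generator T f g : Prop :=
  [/\ inL2 mu f, inL2 mu g &
    cLnorm mu 2%:E (fun x => (t^-1)%:C%C * (f x - T t f x) - g x)
      @[t --> 0^'+] --> 0%E].

Definition weight w : Prop :=
  measurable_fun setT w /\ forall x, 0 < w x.

Definition sg_weight T (t : R) w (x : X) : \bar R :=
  limn (fun n : nat =>
    (Re (T t (fun y => if (w y <= n%:R)%R then (w y)%:C%C else 0%R) x))%:E).

Definition Q2 T w : \bar R :=
  ereal_sup [set ess_sup mu
      (fun x => (sg_weight T t w x * sg_weight T t (fun y => (w y)^-1%R) x)%E)
    | t in [set t : R | (0 <= t)%R]].

End Semigroup.

Section FunctionalCalculus.
Context d (X : measurableType d) (R : realType).
Variable mu : {measure set X -> \bar R}.
Implicit Types (A : (X -> R[i]) -> (X -> R[i]) -> Prop)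
  (E : set (measurableTypeR R) -> (X -> R[i]) -> X -> R[i])
  (f g : X -> R[i]) (m : R -> R[i]) (S : (X -> R[i]) -> X -> R[i]).

Record projection_measure E : Prop := {
  pm_bounded : forall B, measurable B -> bounded_on_L2 mu (E B) ;
  pm_selfadjoint : forall B, measurable B -> selfadjoint_on_L2 mu (E B) ;
  pm_idempotent : forall B f, measurable B -> inL2 mu f ->
    aeeq mu (E B (E B f)) (E B f) ;
  pm_setT : forall f, inL2 mu f -> aeeq mu (E setT f) f ;
  pm_sigma_additive : forall (F : nat -> set (measurableTypeR R)) f,
    (forall n, measurable (F n)) -> trivIset setT F -> inL2 mu f ->
    cLnorm mu 2%:E
        (fun x => E (\bigcup_n F n) f x - \sum_(k < n) E (F k) f x)
      @[n --> \oo] --> 0%E }.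

(* [nu] is the measure [B |-> <E(B) f, f>]. *)
Definition scalar_spectral_measure E f
    (nu : {measure set (measurableTypeR R) -> \bar R}) : Prop :=
  forall B, measurable B -> nu B = (Re (inner mu (E B f) f))%:E.

(* [A] is the integral of [lambda] with respect to [E]; an operator with graph
   [A] on a complex Hilbert space is determined by its domain and its
   quadratic form. *)
Definition spectral_resolution A E : Prop :=
  projection_measure E /\
  forall f, inL2 mu f -> exists nu, [/\ scalar_spectral_measure E f nu,
    (exists g, A f g) <-> (\int[nu]_l (l ^+ 2)%:E < +oo)%E &
    forall g, A f g -> inner mu g f = (\int[nu]_l l)%:C%C].

(* [S] is the bounded operator [m(A)], for [A] self-adjoint and nonnegative. *)
Definition functional_calculus A m S : Prop :=
  exists E, [/\ spectral_resolution A E, bounded_on_L2 mu S &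
    forall f, inL2 mu f -> exists nu, [/\ scalar_spectral_measure E f nu,
      cintegrable nu `[0, +oo[ m &
      inner mu (S f) f = cintegral nu `[0, +oo[ m]].

End FunctionalCalculus.

Section Hormander.
Context (R : realType).
Implicit Types (s t x : R) (f h eta m : R -> R[i]).
Local Notation leb := (@lebesgue_measure R).

Definition euler_Gamma s : R :=
  \int[leb]_(t in `]0, +oo[) (t `^ (s - 1) * expR (- t)).

(* The convolution kernel of (1 - d^2/dx^2)^(-s/2), written as
   Gamma(s/2)^-1 times the integral of t^(s/2 - 1) exp(-t) k_t over t > 0,
   where k_t(x) = (4 pi t)^(-1/2) exp(-x^2 / 4t) is the heat kernel. *)
Definition bessel_kernel s x : R :=
  (euler_Gamma (s / 2))^-1 *
  \int[leb]_(t in `]0, +oo[)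
    (t `^ (s / 2 - 1) * expR (- t) *
     ((4 * pi * t) `^ (- 2^-1) * expR (- (x ^+ 2 / (4 * t))))).

Definition bessel_potential s h x : R[i] :=
  cintegral leb setT (fun y => (bessel_kernel s (x - y))%:C%C * h y).

(* The norm of W^oo_s(R), equal to +oo outside of this space. *)
Definition sobolev_norm s f : \bar R :=
  ereal_inf [set cLnorm leb +oo%E h | h in
    [set h | in_space (cLnorm leb +oo%E) h /\
             aeeq leb f (bessel_potential s h)]].

Definition smooth_cutoff eta : Prop :=
  [/\ (forall n x, derivable (derive1n n (fun y => Re (eta y))) x 1 /\
                   derivable (derive1n n (fun y => Im (eta y))) x 1),
      (exists a b : R, 0 < a /\ forall x, eta x != 0 -> a <= x <= b) &
      exists x, eta x != 0].

Definition hormander_norm eta s m : \bar R :=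
  ereal_sup [set sobolev_norm s (fun x => eta x * m (t * x))%R
    | t in [set t | (0 < t)%R]].

Definition hormander_class eta s m : Prop :=
  [/\ locally_integrable (`]0, +oo[ : set R) (fun x => Re (m x)),
      locally_integrable (`]0, +oo[ : set R) (fun x => Im (m x)) &
      (hormander_norm eta s m < +oo)%E].

Definition expfun (z : R[i]) : R -> R[i] := fun l => cexp (- (l%:C%C * z)).

End Hormander.

Section Calculus.
Context d (X : measurableType d) (R : realType).
Variable mu : {measure set X -> \bar R}.
Implicit Types (A : (X -> R[i]) -> (X -> R[i]) -> Prop) (w : X -> R)
  (eta m : R -> R[i]) (s C : R).

Definition hormander_estimate eta A w s C m : Prop :=
  forall S, functional_calculus mu A m S ->
    extends_boundedly mu (wLnorm2 mu w)
      (C%:E * (hormander_norm eta s m + (cmod (m 0))%:E))%E S.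

(* For s > 0 an element of the Hoermander class is a class modulo null sets
   having a continuous representative on ]0, +oo[, and [m(A)] refers to that
   representative. *)
Definition hormander_calculus eta A w s : Prop :=
  exists2 C : R, 0 < C & forall m, hormander_class eta s m ->
    {in `]0, +oo[, continuous (fun x => Re (m x))} ->
    {in `]0, +oo[, continuous (fun x => Im (m x))} ->
    hormander_estimate eta A w s C m.

End Calculus.

(* Main.v *)
(* The space is a disjoint union of Hamming cubes {-1,1}^D, D = 2 n^2, of total
   masses 2^-(n+1), and A multiplies a Walsh function of level k by k/D. The
   weight is prod_i (1 + delta x_i) with delta = 1/(2n); as D delta^2 = 1/2, its
   characteristic is at most sup_n (1 - delta^2)^-D <= 2.

   For z = D (delta + i pi) the operator exp(-zA) multiplies level k by
   (-rho)^k, rho = exp(-delta): it is a noise operator followed by the antipodal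
   map. Applied to the indicator of the vertex of smallest weight it puts mass
   ((1 + rho)/2)^D on the vertex of largest weight, and since
   ((1 + rho)/2)^2 >= 1 - delta, its squared weighted norm is at least
   (1 + delta)^D >= 2^n.

   On the other hand |z| / Re z = O(n), and the Hoermander norm of exp(-z .) is
   polynomial in |z| / Re z. Indeed, for a smooth cutoff theta supported in
   [a, b] with a > 0, and e(x) = exp(-tau x),
     theta e = (1 - d^2)^-1 ((theta - theta'' + 2 tau theta' - tau^2 theta) e),
   so that by iteration theta e is a Bessel potential of order 2k of a function
   of size O((1 + |tau|)^(2k) exp(-a Re tau)), and (1 + t|z|)^(2k) exp(-a t Re z)
   is bounded uniformly in t by a multiple of (1 + |z| / Re z)^(2k). The Bessel
   potentials form a semigroup, by the semigroup property of the heat kernel and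
   the beta integral, and the kernel of order 2 is exp(-|x|)/2. *)

Require Import Defs.
From HB Require Import structures.
From mathcomp Require Import all_boot all_order all_algebra.
From mathcomp Require Import complex.
From mathcomp Require Import all_classical all_reals all_analysis.
From mathcomp Require Import measurable_realfun ess_sup_inf hoelder.
From mathcomp Require Import ring lra.

Set Implicit Arguments.
Unset Strict Implicit.
Unset Printing Implicit Defensive.

Import Order.TTheory GRing.Theory Num.Theory.
Import numFieldNormedType.Exports.
Import ComplexField.

Local Open Scope classical_set_scope.
Local Open Scope ring_scope.

Local Notation Re := complex.Re.
Local Notation Im := complex.Im.

(** A single finite cube satisfies the estimate with some constant, so only the growth in n counts;
    the disjoint union places all cubes in one probability space. Operators act cube by cube, so
    identities reduce to finite sums, and every point is an atom, so almost everywhere means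
    everywhere. Two demands force D ~ n^2 and delta ~ 1/n. The characteristic stays bounded only if
    D delta^2 does. The ratio of extreme weights grows like exp(2 D delta), of which the damping ((1
    + rho)/2)^(2 D) takes back half; with D delta^2 constant the rest is exponential in 1/delta.
    Turning z far enough to reach the antipodal map costs only |Im z| / Re z = pi / delta, hence a
    power of 1/delta for each s. An exponential against a power of any degree excludes all s at
    once. The estimate is quantified over the operators that represent m(A), so refuting it requires
    exhibiting one: the spectral measure is built explicitly from the Walsh transform. On the upper
    side, differentiation gives only even orders 2k; an arbitrary s is reached by taking 2k > s and
    splitting the potential into orders s and 2k - s. *)

Definition cube_dim (n : nat) : nat := ((n * n).*2)%N.
Notation vertex n := {ffun 'I_(cube_dim n) -> bool}.
Definition cubes : Type := {n : nat & vertex n}.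
Definition at_vertex n (v : vertex n) : cubes := Tagged (fun n => vertex n) v.

HB.instance Definition _ := Choice.on cubes.
HB.instance Definition _ :=
  isPointed.Build cubes (at_vertex ([ffun => false] : vertex 0)).
HB.instance Definition _ := @isMeasurable.Build default_measure_display
  cubes discrete_measurable discrete_measurable0
  discrete_measurableC discrete_measurableU.

Lemma measurable_fun_cubes d' (Y : sigmaRingType d') (D : set cubes)
    (f : cubes -> Y) : measurable_fun D f.
Proof. by []. Qed.

(** * Measures made of countably many point masses *)

Section PointMasses.
Context (R : realType).

(** [msum] runs over natural numbers, so the vertices are listed; the default is never read below
    the number of vertices. *)
Definition nth_vertex n (i : nat) : vertex n :=
  nth [ffun => false] (enum (vertex n)) i.

(** Generic in the masses: the same construction gives the probability measure and, for each f, the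
    distribution of the energy of f over the Walsh frequencies. *)
Definition point_masses (a : cubes -> R) (a0 : forall x, 0 <= a x) :
    {measure set cubes -> \bar R} :=
  mseries (fun n => msum (fun i =>
    mscale (NngNum (a0 (at_vertex (nth_vertex n i))))
      (dirac (at_vertex (nth_vertex n i)))) #|vertex n|) 0.

(** The only access to [point_masses], whose definition is sealed right after. *)
Lemma ge0_integral_point_masses (a : cubes -> R) (a0 : forall x, 0 <= a x)
    (f : cubes -> \bar R) : (forall x, (0 <= f x)%E) ->
  (\int[point_masses a0]_x f x =
   \sum_(n <oo) \sum_(v : vertex n)
     (a (at_vertex v))%:E * f (at_vertex v))%E.
Proof.
move=> f0; rewrite ge0_integral_measure_series//.
apply: eq_eseriesr => n _; rewrite ge0_integral_measure_sum//.
rewrite -[RHS]big_enum/= (big_nth [ffun => false]) -cardE big_mkord.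
apply: eq_bigr => i _; rewrite ge0_integral_mscale//= integral_dirac//.
by rewrite diracE in_setT mul1e.
Qed.
End PointMasses.
#[global] Opaque point_masses.

(** * Real and imaginary parts, modulus and conjugation *)

Section ComplexNumbers.
Context (R : realType).
Implicit Types (x y z : R[i]) (a : R).

Lemma Re_mulc x y : Re (x * y) = Re x * Re y - Im x * Im y.
Proof. by case: x y => [a b] [c d]. Qed.

Lemma Im_mulc x y : Im (x * y) = Re x * Im y + Im x * Re y.
Proof. by case: x y => [a b] [c d]. Qed.

Lemma Re_rM a z : Re (a%:C%C * z) = a * Re z.
Proof. by rewrite Re_mulc /= mul0r subr0. Qed.

Lemma Im_rM a z : Im (a%:C%C * z) = a * Im z.
Proof. by rewrite Im_mulc /= mul0r addr0. Qed.

Lemma Re_sum I (r : seq I) (P : pred I) (F : I -> R[i]) :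
  Re (\sum_(i <- r | P i) F i) = \sum_(i <- r | P i) Re (F i).
Proof. by apply: (big_morph (@complex.Re R)) => [[a b] [c d]|]. Qed.

Lemma Im_sum I (r : seq I) (P : pred I) (F : I -> R[i]) :
  Im (\sum_(i <- r | P i) F i) = \sum_(i <- r | P i) Im (F i).
Proof. by apply: (big_morph (@complex.Im R)) => [[a b] [c d]|]. Qed.

Lemma sqr_cmod z : cmod z ^+ 2 = Re z ^+ 2 + Im z ^+ 2.
Proof.
by case: z => a b; rewrite /cmod /Normc.normc/= sqr_sqrtr// addr_ge0// sqr_ge0.
Qed.

Lemma cmod_ge0 z : 0 <= cmod z.
Proof. by case: z => a b; exact: sqrtr_ge0. Qed.

Lemma cmodM x y : cmod (x * y) = cmod x * cmod y.
Proof. exact: Normc.normcM. Qed.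

Lemma cmod_real a : cmod a%:C%C = `|a|.
Proof. by rewrite /cmod /Normc.normc/= expr0n addr0 sqrtr_sqr. Qed.

Lemma cmodD x y : cmod (x + y) <= cmod x + cmod y.
Proof. exact: le_normcD. Qed.

Lemma cmodN x : cmod (- x) = cmod x.
Proof. exact: normcN. Qed.

Lemma cmod_sum I (r : seq I) (P : pred I) (F : I -> R[i]) :
  cmod (\sum_(i <- r | P i) F i) <= \sum_(i <- r | P i) cmod (F i).
Proof.
elim/big_ind2 : _ => [|x x' y y' h k|//].
  by rewrite /cmod Normc.normc0.
exact: le_trans (cmodD _ _) (lerD _ _).
Qed.

Lemma cmod_eq0 z : cmod z = 0 -> z = 0.
Proof. exact: Normc.eq0_normc. Qed.

Lemma normr_Re z : `|Re z| <= cmod z.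
Proof.
rewrite -(@ler_pXn2r _ 2%N)// ?nnegrE ?normr_ge0 ?cmod_ge0//.
by rewrite sqr_cmod -normrX ger0_norm ?sqr_ge0// lerDl sqr_ge0.
Qed.

Lemma normr_Im z : `|Im z| <= cmod z.
Proof.
rewrite -(@ler_pXn2r _ 2%N)// ?nnegrE ?normr_ge0 ?cmod_ge0//.
by rewrite sqr_cmod -normrX ger0_norm ?sqr_ge0// lerDr sqr_ge0.
Qed.

Lemma mul_conjc z : z * conjc z = (cmod z ^+ 2)%:C%C.
Proof.
apply/eqP; rewrite eq_complex sqr_cmod; case: z => a b /=.
by apply/andP; split; apply/eqP; ring.
Qed.

Lemma cmod_conjc z : cmod (conjc z) = cmod z.
Proof. by case: z => a b; rewrite /cmod /Normc.normc/= sqrrN. Qed.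

Lemma cmod_mul_le x y : cmod x * cmod y <= cmod x ^+ 2 + cmod y ^+ 2.
Proof. have := cmod_ge0 x; have := cmod_ge0 y; nra. Qed.

End ComplexNumbers.

Section PointMassIntegral.
Context (R : realType).
Context (a b : cubes -> R) (a0 : forall x, 0 <= a x) (b0 : forall x, 0 <= b x).

Lemma fin_numB_eq (p q r s : \bar R) : p \is a fin_num -> q \is a fin_num ->
  r \is a fin_num -> s \is a fin_num -> (p + s = r + q -> p - q = r - s)%E.
Proof.
move: p q r s => [p||] [q||] [r||] [s||]// _ _ _ _.
by rewrite -!EFinD => -[e]; congr EFin; lra.
Qed.

(** No signed series is rearranged: splitting u and v into positive and negative parts, the claim
    becomes the equality of a u+ + b v- and b v+ + a u-, two series of nonnegative terms that agree
    cube by cube. *)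
Lemma eq_Rintegral_point_masses (u v : cubes -> R) :
  (point_masses a0).-integrable setT (EFin \o u) ->
  (point_masses b0).-integrable setT (EFin \o v) ->
  (forall n, \sum_(x : vertex n) a (at_vertex x) * u (at_vertex x) =
             \sum_(x : vertex n) b (at_vertex x) * v (at_vertex x)) ->
  \int[point_masses a0]_x u x = \int[point_masses b0]_x v x.
Proof.
move=> iu iv uv; rewrite /Rintegral; congr fine.
rewrite (integralE _ _ (EFin \o u)) (integralE _ _ (EFin \o v)).
have up : (\int[point_masses a0]_x ((EFin \o u)^\+%E) x)%E \is a fin_num.
  by apply: integrable_pos_fin_num => //; exact: measurableT.
have un : (\int[point_masses a0]_x ((EFin \o u)^\-%E) x)%E \is a fin_num.
  by apply: integrable_neg_fin_num => //; exact: measurableT.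
have vp : (\int[point_masses b0]_x ((EFin \o v)^\+%E) x)%E \is a fin_num.
  by apply: integrable_pos_fin_num => //; exact: measurableT.
have vn : (\int[point_masses b0]_x ((EFin \o v)^\-%E) x)%E \is a fin_num.
  by apply: integrable_neg_fin_num => //; exact: measurableT.
suff : (\int[point_masses a0]_x ((EFin \o u)^\+%E) x +
    \int[point_masses b0]_x ((EFin \o v)^\-%E) x =
    \int[point_masses b0]_x ((EFin \o v)^\+%E) x +
    \int[point_masses a0]_x ((EFin \o u)^\-%E) x)%E.
  by move=> e; rewrite (fin_numB_eq up un vp vn e).
rewrite !ge0_integral_point_masses// -!nneseriesD//; last 4 first.
- by move=> n _ _; apply: sume_ge0 => x _; rewrite mule_ge0 ?lee_fin.
- by move=> n _ _; apply: sume_ge0 => x _; rewrite mule_ge0 ?lee_fin.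
- by move=> n _ _; apply: sume_ge0 => x _; rewrite mule_ge0 ?lee_fin.
- by move=> n _ _; apply: sume_ge0 => x _; rewrite mule_ge0 ?lee_fin.
apply: eq_eseriesr => n _.
have pE c (w : cubes -> R) : (\sum_(x : vertex n) (c (at_vertex x))%:E *
   ((EFin \o w)^\+%E) (at_vertex x) =
   (\sum_(x : vertex n) c (at_vertex x) * Num.max (w (at_vertex x)) 0)%:E)%E.
  by rewrite -sumEFin; apply: eq_bigr => x _; rewrite funeposE/= -EFin_max EFinM.
have nE c (w : cubes -> R) : (\sum_(x : vertex n) (c (at_vertex x))%:E *
   ((EFin \o w)^\-%E) (at_vertex x) =
   (\sum_(x : vertex n) c (at_vertex x) * Num.max (- w (at_vertex x)) 0)%:E)%E.
  by rewrite -sumEFin; apply: eq_bigr => x _; rewrite funenegE/= -EFin_max EFinM.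
rewrite !pE !nE -!EFinD; congr EFin.
have E c (w : cubes -> R) : \sum_(x : vertex n) c (at_vertex x) * Num.max (w (at_vertex x)) 0 =
  \sum_(x : vertex n) c (at_vertex x) * w (at_vertex x) +
  \sum_(x : vertex n) c (at_vertex x) * Num.max (- w (at_vertex x)) 0.
  rewrite -big_split/=; apply: eq_bigr => x _; rewrite -mulrDr; congr (_ * _).
  by case: (leP (w (at_vertex x)) 0); case: (leP (- w (at_vertex x)) 0); lra.
by rewrite (E a u) (E b v) uv; ring.
Qed.

End PointMassIntegral.

(** * Walsh analysis on the cubes *)

Section WalshTransform.
Context (R : realType).
Implicit Types (f g : cubes -> R[i]) (phi psi : cubes -> R).

Definition bsign (b : bool) : R := (-1) ^+ b.

Lemma conjc_rM (a : R) (z : R[i]) : conjc (a%:C%C * z) = a%:C%C * conjc z.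
Proof. by rewrite rmorphM /= oppr0. Qed.

Lemma conjc_sum I (r : seq I) (P : pred I) (F : I -> R[i]) :
  conjc (\sum_(i <- r | P i) F i) = \sum_(i <- r | P i) conjc (F i).
Proof. by apply: (big_morph (@conjc R)); [exact: rmorphD | exact: rmorph0]. Qed.

(** Sets of coordinates are encoded as vertices too, so the transform maps functions on [cubes] to
    functions on [cubes] and can be an involution. *)
Definition walsh n (S x : vertex n) : R := \prod_i bsign (S i && x i).

Lemma walshC n (S x : vertex n) : walsh S x = walsh x S.
Proof. by apply: eq_bigr => i _; rewrite andbC. Qed.

(** Distributivity: expanding the product picks one of two terms per coordinate, and S records where
    the second is picked. At rho = 1 this yields orthogonality, for general rho the noise kernel. *)
Lemma sum_walsh n (rho : R) (x y : vertex n) :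
  \sum_(S : vertex n) rho ^+ (\sum_i S i)%N * (walsh S x * walsh S y) =
  \prod_i (1 + rho * (bsign (x i) * bsign (y i))).
Proof.
have -> : \prod_i (1 + rho * (bsign (x i) * bsign (y i))) =
    \prod_i \sum_(b : bool) rho ^+ b * (bsign (b && x i) * bsign (b && y i)).
  apply: eq_bigr => i _; rewrite big_bool/= addrC expr1 !expr0 !mul1r.
  by rewrite /bsign ?expr0 ?mulr1 ?mul1r.
rewrite bigA_distr_bigA; apply: eq_bigr => S _.
by rewrite expr_sum -!big_split.
Qed.

Lemma sum_walsh_orth n (x y : vertex n) :
  \sum_(S : vertex n) walsh S x * walsh S y = 2 ^+ cube_dim n * (x == y)%:R.
Proof.
transitivity (\sum_(S : vertex n)
    1 ^+ (\sum_i S i)%N * (walsh S x * walsh S y)).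
  by apply: eq_bigr => S _; rewrite expr1n mul1r.
rewrite sum_walsh; have [->|xy] := eqVneq x y.
  rewrite mulr1 (eq_bigr (fun=> 2)) ?prodr_const ?card_ord// => i _.
  by rewrite mul1r /bsign -expr2 sqrr_sign.
have [i xyi] : exists i, x i != y i.
  apply/existsP; rewrite -negb_forall; apply: contra xy => /forallP xy.
  by apply/eqP/ffunP => i; apply/eqP.
rewrite mulr0 (bigD1 i)//=; move: xyi; rewrite /bsign.
by case: (x i) (y i) => -[]//= _; rewrite ?expr0 ?expr1 ?mul1r ?mulN1r ?mulr1 subrr mul0r.
Qed.

(** This is 2^(-D/2), which makes the transform unitary; as D = 2 n^2 is even, no square root is
    needed. *)
Definition half_power n : R := 2^-1 ^+ (n * n).

Lemma half_power_sqr n : half_power n * half_power n * 2 ^+ cube_dim n = 1.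
Proof.
by rewrite /half_power -exprD addnn -exprMn mulVf// expr1n.
Qed.

Definition walsh_transform f : cubes -> R[i] := fun x =>
  \sum_(y : vertex (tag x))
    (half_power (tag x) * walsh (tagged x) y)%:C%C * f (at_vertex y).

Lemma walsh_transformK : involutive walsh_transform.
Proof.
move=> f; apply/funext => -[n v]; rewrite {1}/walsh_transform /=.
transitivity (\sum_(z : vertex n) (v == z)%:R * f (at_vertex z)); last first.
  rewrite (bigD1 v)//= eqxx mul1r big1 ?addr0// => z zv.
  by rewrite eq_sym (negbTE zv) mul0r.
under eq_bigr do rewrite /walsh_transform/= mulr_sumr.
rewrite exchange_big/=; apply: eq_bigr => z _.
under eq_bigr do rewrite mulrA -rmorphM/=.
rewrite -mulr_suml -rmorph_sum/=; congr (_ * _).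
rewrite -[RHS](rmorph_nat (real_complex R)); congr (_%:C)%C.
transitivity (half_power n * half_power n *
    \sum_(y : vertex n) walsh y v * walsh y z).
  by rewrite mulr_sumr; apply: eq_bigr => y _; rewrite (walshC v); ring.
by rewrite sum_walsh_orth mulrA half_power_sqr mul1r.
Qed.

Lemma walsh_transformD (a : R[i]) f g :
  walsh_transform (fun x => a * f x + g x) =
  (fun x => a * walsh_transform f x + walsh_transform g x).
Proof.
apply/funext => x; rewrite /walsh_transform mulr_sumr -big_split/=.
by apply: eq_bigr => y _; ring.
Qed.

Lemma walsh_transform_adjoint n f g :
  \sum_(x : vertex n) walsh_transform f (at_vertex x) * conjc (g (at_vertex x)) =
  \sum_(x : vertex n) f (at_vertex x) * conjc (walsh_transform g (at_vertex x)).
Proof.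
rewrite /walsh_transform/=.
under eq_bigr do rewrite mulr_suml.
rewrite exchange_big/=; apply: eq_bigr => y _.
rewrite conjc_sum mulr_sumr; apply: eq_bigr => x _.
by rewrite conjc_rM walshC; ring.
Qed.

Definition cmultiplier (phi : cubes -> R[i]) f : cubes -> R[i] :=
  walsh_transform (fun x => phi x * walsh_transform f x).

Definition multiplier phi := cmultiplier (fun x => (phi x)%:C%C).

Lemma walsh_transform_cmultiplier (phi : cubes -> R[i]) f :
  walsh_transform (cmultiplier phi f) = (fun x => phi x * walsh_transform f x).
Proof. exact: walsh_transformK. Qed.

Lemma eq_cmultiplier (phi psi : cubes -> R[i]) f x :
  (forall v : vertex (tag x), phi (at_vertex v) = psi (at_vertex v)) ->
  cmultiplier phi f x = cmultiplier psi f x.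
Proof. by move=> e; apply: eq_bigr => v _; rewrite e. Qed.

Lemma multiplier_comp phi psi f :
  multiplier phi (multiplier psi f) = multiplier (fun x => phi x * psi x) f.
Proof.
rewrite /multiplier /cmultiplier walsh_transformK; congr walsh_transform.
by apply/funext => x; rewrite rmorphM mulrA.
Qed.

Lemma cmultiplier_linear (phi : cubes -> R[i]) (a : R[i]) f g :
  cmultiplier phi (fun x => a * f x + g x) =
  (fun x => a * cmultiplier phi f x + cmultiplier phi g x).
Proof.
rewrite /cmultiplier -walsh_transformD; congr walsh_transform.
by apply/funext => x; rewrite walsh_transformD; ring.
Qed.

Lemma multiplierD (a : R) phi psi f :
  multiplier (fun x => a * phi x + psi x) f =
  (fun x => a%:C%C * multiplier phi f x + multiplier psi f x).
Proof.
rewrite /multiplier /cmultiplier -walsh_transformD; congr walsh_transform.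
by apply/funext => x; rewrite rmorphD rmorphM/=; ring.
Qed.

Lemma multiplier1 f : multiplier (fun=> 1) f = f.
Proof.
rewrite -[RHS]walsh_transformK; congr walsh_transform.
by apply/funext => x; rewrite mul1r.
Qed.

Lemma multiplier_sum n (phi : nat -> cubes -> R) f :
  multiplier (fun x => \sum_(k < n) phi k x) f =
  (fun x => \sum_(k < n) multiplier (phi k) f x).
Proof.
elim: n => [|n ih].
  apply/funext => x; rewrite big_ord0 /multiplier/cmultiplier/walsh_transform big1// => y _.
  by rewrite big_ord0 mul0r mulr0.
apply/funext => x; rewrite big_ord_recr/= -[in RHS](congr1 (@^~ x) ih).
have := multiplierD 1 (phi n) (fun x => \sum_(k < n) phi k x) f.
move=> /(congr1 (@^~ x)); rewrite mul1r addrC => <-.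
by congr (multiplier _ f x); apply/funext => y; rewrite big_ord_recr/= mul1r addrC.
Qed.

Definition weight_level (x : cubes) : nat := (\sum_i tagged x i)%N.

(** Dividing by the dimension puts the spectrum in [0, 1], so the generator is bounded with domain
    all of L^2. In dimension 0 the convention 0 / 0 = 0 gives rate 0. *)
Definition rate (x : cubes) : R := (weight_level x)%:R / (cube_dim (tag x))%:R.

Lemma rate_ge0 x : 0 <= rate x.
Proof. by rewrite divr_ge0. Qed.

Lemma rate_le1 x : rate x <= 1.
Proof.
rewrite /rate; have [->|d0] := eqVneq (cube_dim (tag x)) 0%N.
  by rewrite invr0 mulr0.
rewrite ler_pdivrMr ?ltr0n ?lt0n// mul1r ler_nat /weight_level.
apply: (@leq_trans (\sum_(i < cube_dim (tag x)) 1)%N).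
  by apply: leq_sum => i _; case: (tagged x i).
by rewrite sum1_card card_ord.
Qed.

(* Each coordinate contributes an independent flip, whence the product form. *)
Definition flip_kernel n (rho : R) (x y : vertex n) : R :=
  2^-1 ^+ cube_dim n * \prod_i (1 + rho * (bsign (x i) * bsign (y i))).

(** [rho] may vary with the cube, since at time t the semigroup has rho = exp(-t / D). Exchanging
    the two Walsh sums leaves the sum over frequencies evaluated by [sum_walsh]. *)
Lemma multiplier_powE (rho : nat -> R) f x :
  multiplier (fun x => rho (tag x) ^+ weight_level x) f x =
  \sum_(y : vertex (tag x))
    (flip_kernel (rho (tag x)) (tagged x) y)%:C%C * f (at_vertex y).
Proof.
case: x => n v; rewrite /multiplier /cmultiplier {1}/walsh_transform/=.
under eq_bigr do rewrite /walsh_transform/= !mulr_sumr.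
rewrite exchange_big/=; apply: eq_bigr => z _.
under eq_bigr do rewrite !mulrA -!rmorphM/=.
rewrite -mulr_suml -rmorph_sum/=; congr ((_%:C)%C * _).
rewrite /flip_kernel -sum_walsh mulr_sumr; apply: eq_bigr => y _.
rewrite /weight_level/= (walshC v) exprVn.
have /(canRL (mulfK _)) h := half_power_sqr n.
have -> : (2 ^+ cube_dim n)^-1 = half_power n * half_power n.
  by rewrite h ?expf_neq0// mul1r.
by ring.
Qed.

End WalshTransform.

(** * The probability measure, Plancherel's identity and bounded multipliers *)

Section CubeMeasure.
Context (R : realType).
Implicit Types (f g h k : cubes -> R[i]) (phi psi : cubes -> R).

Definition block_mass (n : nat) : R := 2^-1 ^+ n.+1 * 2^-1 ^+ cube_dim n.

Lemma block_mass_gt0 n : 0 < block_mass n.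
Proof. by rewrite mulr_gt0// exprn_gt0. Qed.

Definition mass (x : cubes) : R := block_mass (tag x).

Lemma mass_ge0 x : 0 <= mass x.
Proof. exact/ltW/block_mass_gt0. Qed.

Definition cube_measure := point_masses mass_ge0.
Local Notation mu := cube_measure.

Lemma ge0_integral_cube_measure (f : cubes -> \bar R) :
  (forall x, (0 <= f x)%E) ->
  (\int[mu]_x f x =
   \sum_(n <oo) (block_mass n)%:E * \sum_(v : vertex n) f (at_vertex v))%E.
Proof.
move=> f0; rewrite ge0_integral_point_masses//; apply: eq_eseriesr => n _.
by rewrite ge0_sume_distrr.
Qed.

Lemma card_vertex n : #|{: vertex n}| = (2 ^ cube_dim n)%N.
Proof. by rewrite card_ffun card_bool card_ord. Qed.

Lemma cube_measure_setT : mu setT = 1%E.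
Proof.
rewrite -[LHS]mul1e -integral_cst// ge0_integral_cube_measure//.
transitivity (\sum_(n <oo) (2^-1 ^+ n.+1 : R)%:E)%E.
  apply: eq_eseriesr => n _.
  rewrite sumEFin sumr_const card_vertex -EFinM; congr EFin.
  rewrite /block_mass -mulrA [X in _ * X](_ : _ = 1) ?mulr1//.
  by rewrite exprVn natrX mulVf// expf_neq0.
apply/cvg_lim => //.
have := @cvg_geometric_eseries_half R 1 0.
rewrite expr0 divr1; apply: cvg_trans; apply: near_eq_cvg; apply: nearW => m.
rewrite /eseries/=; apply: eq_bigr => k _.
by rewrite addn1 natrX div1r exprVn.
Qed.

(** One atom never exceeds the whole integral. As all atoms have positive mass, null sets are empty;
    the final lower bound also keeps a single vertex. *)
Lemma mem_mass_le (f : cubes -> \bar R) x : (forall y, (0 <= f y)%E) ->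
  ((mass x)%:E * f x <= \int[mu]_y f y)%E.
Proof.
move=> f0; rewrite ge0_integral_cube_measure//; case: x => n v.
apply: (@le_trans _ _
  (\sum_(0 <= k < n.+1) (block_mass k)%:E * \sum_(v : vertex k) f (at_vertex v)))%E.
  rewrite big_nat_recr//=; apply: (@le_trans _ _
    ((block_mass n)%:E * \sum_(v : vertex n) f (at_vertex v)))%E.
    apply: lee_wpmul2l; first by rewrite lee_fin ltW ?block_mass_gt0.
    by rewrite (bigD1 v)//= leeDl// sume_ge0.
  rewrite leeDr// sume_ge0// => k _; rewrite mule_ge0 ?sume_ge0//.
  by rewrite lee_fin ltW ?block_mass_gt0.
apply: (nneseries_lim_ge n.+1) => k _ _; rewrite mule_ge0 ?sume_ge0//.
by rewrite lee_fin ltW ?block_mass_gt0.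
Qed.

Lemma ae_cube_measure (P : cubes -> Prop) :
  (\forall x \ae mu, P x) -> forall x, P x.
Proof.
move=> [N [_ N0 PN]] x; apply: contrapT => nPx.
have Nx : N x by apply: PN.
have := @mem_mass_le (fun y => (\1_N y)%:E) x.
rewrite integral_indic// setIT [X in (_ <= X)%E]N0 indicE mem_set// mule1.
move=> h; have : ((mass x)%:E <= (0 : \bar R))%E.
  by apply: h => y; rewrite lee_fin.
by rewrite lee_fin leNgt block_mass_gt0.
Qed.

Lemma aeeq_cube_measure f g : f = g -> aeeq mu f g.
Proof. by move=> ->; apply: aeW. Qed.

Lemma aeeqE f g : aeeq mu f g -> f = g.
Proof. by move=> /ae_cube_measure fg; apply/funext. Qed.

Definition sqnorm f : \bar R := (\int[mu]_x (cmod (f x) ^+ 2)%:E)%E.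

Lemma sqnorm_ge0 f : (0 <= sqnorm f)%E.
Proof. by apply: integral_ge0 => x _; rewrite lee_fin sqr_ge0. Qed.

Lemma cLnorm2E f : cLnorm mu 2%:E f = (sqnorm f `^ 2^-1)%E.
Proof.
rewrite /cLnorm unlock /sqnorm; congr (_ `^ _)%E; apply: eq_integral => x _.
by rewrite /= powR_mulrn ?normr_ge0// ger0_norm// cmod_ge0.
Qed.

Lemma sqrte_lty (x : \bar R) : (0 <= x)%E -> (x `^ 2^-1 < +oo)%E = (x < +oo)%E.
Proof.
case: x => [r||]//= _; first by rewrite !ltry.
by rewrite invr_eq0 pnatr_eq0.
Qed.

Lemma inL2P f : inL2 mu f <-> (sqnorm f < +oo)%E.
Proof.
rewrite /inL2 /in_space cLnorm2E sqrte_lty ?sqnorm_ge0//.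
by split => [[]//|h]; split.
Qed.

Lemma sqnorm_le f g : (forall x, cmod (f x) <= cmod (g x)) ->
  (sqnorm f <= sqnorm g)%E.
Proof.
move=> fg; apply: ge0_le_integral => //.
- by move=> x _; rewrite lee_fin sqr_ge0.
by move=> x _; rewrite lee_fin lerXn2r ?nnegrE ?cmod_ge0.
Qed.

Lemma sqnormZ (a : R[i]) f :
  sqnorm (fun x => a * f x) = ((cmod a ^+ 2)%:E * sqnorm f)%E.
Proof.
rewrite /sqnorm -ge0_integralZl//; last 2 first.
- by move=> x _; rewrite lee_fin sqr_ge0.
- by rewrite lee_fin sqr_ge0.
by apply: eq_integral => x _; rewrite cmodM exprMn.
Qed.

(** Plancherel: on each cube the transform is symmetric and involutive. The squares are written as z
    times its conjugate, so that the adjoint formula applies. *)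
Lemma sqnorm_walsh f : sqnorm (walsh_transform f) = sqnorm f.
Proof.
rewrite /sqnorm !ge0_integral_cube_measure; last 2 first.
- by move=> x; rewrite lee_fin sqr_ge0.
- by move=> x; rewrite lee_fin sqr_ge0.
apply: eq_eseriesr => n _; rewrite !sumEFin; congr (_ * _%:E)%E.
apply: (@complexI R); rewrite !rmorph_sum/=.
under eq_bigr do rewrite -mul_conjc.
rewrite walsh_transform_adjoint walsh_transformK.
by under [RHS]eq_bigr do rewrite -mul_conjc.
Qed.

Lemma sqnorm_cmultiplier (M : R) (phi : cubes -> R[i]) f :
  (forall x, cmod (phi x) <= M) ->
  (sqnorm (cmultiplier phi f) <= (M ^+ 2)%:E * sqnorm f)%E.
Proof.
move=> phiM; rewrite sqnorm_walsh -[in leRHS]sqnorm_walsh.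
have M0 : 0 <= M by exact: le_trans (cmod_ge0 _) (phiM point).
have := sqnormZ M%:C%C (walsh_transform f).
rewrite cmod_real real_normK ?num_real// => <-.
apply: sqnorm_le => x; rewrite !cmodM cmod_real.
by rewrite ler_wpM2r ?cmod_ge0// (ger0_norm M0).
Qed.

Lemma inL2_walsh f : inL2 mu f -> inL2 mu (walsh_transform f).
Proof. by rewrite !inL2P sqnorm_walsh. Qed.

Lemma inL2_cmultiplier (M : R) (phi : cubes -> R[i]) f :
  (forall x, cmod (phi x) <= M) -> inL2 mu f -> inL2 mu (cmultiplier phi f).
Proof.
rewrite !inL2P => h fo; apply: (le_lt_trans (sqnorm_cmultiplier f h)).
by rewrite lte_mul_pinfty// lee_fin sqr_ge0.
Qed.

Lemma inL2_multiplier (M : R) phi f : (forall x, `|phi x| <= M) ->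
  inL2 mu f -> inL2 mu (multiplier phi f).
Proof.
move=> phiM; apply: (@inL2_cmultiplier M) => x; rewrite cmod_real; exact: phiM.
Qed.

Lemma cmultiplier_bounded (M : R) (phi : cubes -> R[i]) :
  (forall x, cmod (phi x) <= M) ->
  bounded_operator mu (cLnorm mu 2%:E) M%:E (cmultiplier phi).
Proof.
move=> phiM.
have M0 : 0 <= M by exact: le_trans (cmod_ge0 _) (phiM point).
split.
- by move=> f; exact: inL2_cmultiplier phiM.
- by move=> f g _ _ /aeeqE ->; exact: aeeq_cube_measure.
- by move=> a f g _ _; apply: aeeq_cube_measure; rewrite cmultiplier_linear.
- move=> f /inL2P fo; rewrite !cLnorm2E.
  apply: (@le_trans _ _ (((M ^+ 2)%:E * sqnorm f) `^ 2^-1))%E.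
    apply: gt0_ler_poweR => //; last exact: sqnorm_cmultiplier phiM.
    + by rewrite in_itv/= sqnorm_ge0 leey.
    + by rewrite in_itv/= leey andbT mule_ge0 ?sqnorm_ge0// lee_fin sqr_ge0.
  rewrite poweRM ?sqnorm_ge0 ?lee_fin ?sqr_ge0//.
  by rewrite poweR_EFin -powR_mulrn// -powRrM mulfV// powRr1.
Qed.

Lemma multiplier_bounded (M : R) phi : (forall x, `|phi x| <= M) ->
  bounded_operator mu (cLnorm mu 2%:E) M%:E (multiplier phi).
Proof.
move=> phiM; apply: cmultiplier_bounded => x; rewrite cmod_real; exact: phiM.
Qed.

Lemma integrable_mul_conj f g : inL2 mu f -> inL2 mu g ->
  cintegrable mu setT (fun x => f x * conjc (g x)).
Proof.
move=> /inL2P fo /inL2P go.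
have H (u : cubes -> R) :
    (forall x, `|u x| <= cmod (f x) * cmod (g x)) ->
    mu.-integrable setT (EFin \o u).
  move=> hu; apply/integrableP; split => //.
  apply: (@le_lt_trans _ _ (sqnorm f + sqnorm g)%E); last by rewrite lte_add_pinfty.
  rewrite /sqnorm -ge0_integralD//; last 2 first.
  - by move=> x _; rewrite lee_fin sqr_ge0.
  - by move=> x _; rewrite lee_fin sqr_ge0.
  apply: ge0_le_integral => // x _.
  by rewrite -EFinD lee_fin (le_trans (hu x))// cmod_mul_le.
split; apply: H => x; rewrite -(cmod_conjc (g x)) -cmodM.
  exact: normr_Re.
exact: normr_Im.
Qed.

(** Reduces identities between inner products to finite sums over one cube at a time; membership in
    L^2 supplies the integrability. *)
Lemma eq_inner f g h k : inL2 mu f -> inL2 mu g -> inL2 mu h -> inL2 mu k ->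
  (forall n, \sum_(x : vertex n) f (at_vertex x) * conjc (g (at_vertex x)) =
             \sum_(x : vertex n) h (at_vertex x) * conjc (k (at_vertex x))) ->
  inner mu f g = inner mu h k.
Proof.
move=> f2 g2 h2 k2 e; rewrite /inner /cintegral.
have [fgr fgi] := integrable_mul_conj f2 g2.
have [hkr hki] := integrable_mul_conj h2 k2.
congr Complex; apply: eq_Rintegral_point_masses => // n.
- have H (u v : cubes -> R[i]) : \sum_(x : vertex n) mass (at_vertex x) *
      Re (u (at_vertex x) * conjc (v (at_vertex x))) =
      block_mass n *
      Re (\sum_(x : vertex n) u (at_vertex x) * conjc (v (at_vertex x))).
    by rewrite Re_sum mulr_sumr.
  by rewrite !H e.
- have H (u v : cubes -> R[i]) : \sum_(x : vertex n) mass (at_vertex x) *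
      Im (u (at_vertex x) * conjc (v (at_vertex x))) =
      block_mass n *
      Im (\sum_(x : vertex n) u (at_vertex x) * conjc (v (at_vertex x))).
    by rewrite Im_sum mulr_sumr.
  by rewrite !H e.
Qed.

Lemma inner_walsh f g : inL2 mu f -> inL2 mu g ->
  inner mu (walsh_transform f) g = inner mu f (walsh_transform g).
Proof.
move=> f2 g2; apply: eq_inner => //; try exact: inL2_walsh.
by move=> n; exact: walsh_transform_adjoint.
Qed.

Lemma multiplier_selfadjoint (M : R) phi : (forall x, `|phi x| <= M) ->
  selfadjoint_on_L2 mu (multiplier phi).
Proof.
move=> phiM f g f2 g2.
have fM : inL2 mu (fun x => (phi x)%:C%C * walsh_transform f x).
  by rewrite -walsh_transform_cmultiplier; exact/inL2_walsh/(inL2_multiplier phiM).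
have gM : inL2 mu (fun x => (phi x)%:C%C * walsh_transform g x).
  by rewrite -walsh_transform_cmultiplier; exact/inL2_walsh/(inL2_multiplier phiM).
rewrite (inner_walsh fM g2) -(inner_walsh f2 gM).
apply: eq_inner => //; try exact: inL2_walsh.
by move=> n; apply: eq_bigr => x _; rewrite conjc_rM; ring.
Qed.

(** On the Walsh side the operator is multiplication by [phi], so its quadratic form integrates
    [phi] against |[walsh_transform f]|^2. All spectral measures below come from this formula. *)
Lemma inner_cmultiplier (M : R) (phi : cubes -> R[i]) f :
  (forall x, cmod (phi x) <= M) -> inL2 mu f ->
  inner mu (cmultiplier phi f) f =
  Complex (\int[mu]_x (Re (phi x) * cmod (walsh_transform f x) ^+ 2))
          (\int[mu]_x (Im (phi x) * cmod (walsh_transform f x) ^+ 2)).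
Proof.
move=> phiM f2.
have fM : inL2 mu (fun x => phi x * walsh_transform f x).
  by rewrite -walsh_transform_cmultiplier; exact/inL2_walsh/(inL2_cmultiplier phiM).
rewrite (inner_walsh fM f2) /inner /cintegral.
have E x : phi x * walsh_transform f x * conjc (walsh_transform f x) =
    (cmod (walsh_transform f x) ^+ 2)%:C%C * phi x.
  by rewrite -mulrA mul_conjc mulrC.
congr Complex.
  by apply: eq_Rintegral => x _; rewrite E Re_rM mulrC.
by apply: eq_Rintegral => x _; rewrite E Im_rM mulrC.
Qed.

Lemma inner_multiplier (M : R) phi f : (forall x, `|phi x| <= M) ->
  inL2 mu f ->
  inner mu (multiplier phi f) f =
  (\int[mu]_x (phi x * cmod (walsh_transform f x) ^+ 2))%:C%C.
Proof.
move=> phiM f2.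
rewrite (@inner_cmultiplier M) => // [|x]; last by rewrite cmod_real.
rewrite /real_complex_def; congr Complex.
by under eq_Rintegral do rewrite /= mul0r; rewrite /Rintegral integral0.
Qed.

End CubeMeasure.

(** Packed on the same underlying measure, so that the facts about [cube_measure] apply by
    conversion. *)
Definition cube_probability (R : realType) : probability cubes R :=
  HB.pack_for (probability cubes R) (cube_measure R : set cubes -> \bar R)
   (Measure.class (cube_measure R))
   (Measure_isProbability.Build _ _ _ (cube_measure R) (cube_measure_setT R)).

(** From exp(u) >= 1 + u and 1 / (1 + u) <= 1 - u + u^2. The quadratic error gives the difference
    quotient of the semigroup a linear rate of convergence. *)
Lemma expRN_le2 (R : realType) (u : R) : 0 <= u -> expR (- u) <= 1 - u + u ^+ 2.
Proof.
move=> u0; rewrite expRN; apply: (@le_trans _ _ (1 + u)^-1).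
  by rewrite lef_pV2 ?posrE ?expR_gt0 ?expR_ge1Dx//; lra.
rewrite -[leLHS]mul1r ler_pdivrMr; last lra.
have : 0 <= u ^+ 3 by rewrite exprn_ge0.
by nra.
Qed.

(** * The semigroup and its spectral resolution *)

Section SpectralTheory.
Context (R : realType).
Local Notation mu := (cube_measure R).
Implicit Types (f g : cubes -> R[i]) (phi psi : cubes -> R).

Definition cube_semigroup (t : R) : (cubes -> R[i]) -> cubes -> R[i] :=
  multiplier (fun x => expR (- (t * rate R x))).

(** With rates at most 1, strong continuity and convergence of the difference quotient both have an
    error symbol of size at most t; this is their common squeeze. *)
Lemma cvg_cLnorm2_0 (F : R -> cubes -> R[i]) f : inL2 mu f ->
  (forall t, 0 < t -> exists2 phi, F t = multiplier phi f &
     forall x, `|phi x| <= t) ->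
  cLnorm mu 2%:E (F t) @[t --> 0^'+] --> 0%E.
Proof.
move=> f2 hF.
have cf : cLnorm mu 2%:E f \is a fin_num.
  by rewrite ge0_fin_numE ?Lnorm_ge0//; case: f2.
apply: (@squeeze_cvge _ _ _ _ (fun=> 0%E) _
  (fun t => (t * fine (cLnorm mu 2%:E f))%:E)).
- near=> t; rewrite Lnorm_ge0/=.
  have t0 : 0 < t by near: t; exact: nbhs_right_gt.
  have [phi -> phit] := hF _ t0.
  rewrite EFinM fineK//; exact: (bo_bound (multiplier_bounded phit)).
- exact: cvg_cst.
apply: cvg_EFin; first exact: nearW.
rewrite -[X in _ --> X](mul0r (fine (cLnorm mu 2%:E f))).
apply: cvgM; last exact: cvg_cst.
exact: cvg_at_right_filter.
Unshelve. all: by end_near. Qed.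

Lemma multiplierB phi psi f :
  (fun x => multiplier phi f x - multiplier psi f x) =
  multiplier (fun x => phi x - psi x) f.
Proof.
have := multiplierD (-1) psi phi f.
rewrite (_ : (fun x => -1 * psi x + phi x) = (fun x => phi x - psi x)); last first.
  by apply/funext => x; ring.
move=> ->; apply/funext => x; rewrite rmorphN1/=; ring.
Qed.

Lemma expR_rate_le1 (t : R) x : 0 <= t -> `|expR (- (t * rate R x))| <= 1.
Proof.
move=> t0; rewrite ger0_norm ?expR_ge0// -[leRHS]expR0 ler_expR.
by rewrite oppr_le0 mulr_ge0 ?rate_ge0.
Qed.

Lemma cube_semigroup_bounded t : 0 <= t ->
  bounded_operator mu (cLnorm mu 2%:E) 1%E (cube_semigroup t).
Proof. by move=> t0; apply: multiplier_bounded => x; exact: expR_rate_le1. Qed.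

Lemma cube_semigroup_c0 : c0_semigroup mu cube_semigroup.
Proof.
split.
- by move=> t t0; exists 1; exact: cube_semigroup_bounded.
- move=> f _; apply: aeeq_cube_measure; rewrite /cube_semigroup -[RHS]multiplier1.
  by congr multiplier; apply/funext => x; rewrite mul0r oppr0 expR0.
- move=> s t f _ _ _; apply: aeeq_cube_measure.
  rewrite /cube_semigroup multiplier_comp; congr multiplier.
  by apply/funext => x; rewrite -expRD; congr expR; ring.
- move=> f f2; apply: (cvg_cLnorm2_0 f2) => t t0.
  exists (fun x => expR (- (t * rate R x)) - 1).
    rewrite /cube_semigroup -multiplierB; apply/funext => x.
    by rewrite multiplier1.
  move=> x; have h0 := rate_ge0 R x; have h1 := rate_le1 R x.
  have tr : t * rate R x <= t by rewrite ler_piMr// ltW.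
  have := expR_rate_le1 x (ltW t0); rewrite ger0_norm ?expR_ge0// => e1.
  have e2 := expR_ge1Dx (- (t * rate R x)).
  by rewrite ler0_norm; lra.
Qed.

Lemma cube_generator f g :
  neg_generator mu cube_semigroup f g <-> inL2 mu f /\ g = multiplier (rate R) f.
Proof.
have key : inL2 mu f ->
   cLnorm mu 2%:E (fun x => (t^-1)%:C%C * (f x - cube_semigroup t f x)
     - multiplier (rate R) f x) @[t --> 0^'+] --> 0%E.
  move=> f2; apply: (cvg_cLnorm2_0 f2) => t t0.
  exists (fun x => t^-1 * (1 - expR (- (t * rate R x))) - rate R x).
    rewrite -multiplierB; apply/funext => x; congr (_ - _).
    have := multiplierD t^-1 (fun x => 1 - expR (- (t * rate R x))) (fun=> 0) f.
    move=> /(congr1 (@^~ x))/=.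
    rewrite (_ : (fun x => _ + 0) =
      (fun x => t^-1 * (1 - expR (- (t * rate R x))))); last first.
      by apply/funext => y; rewrite addr0.
    move=> ->; rewrite -multiplierB multiplier1.
    have := multiplierB (fun=> 0) (fun=> 0) f => /(congr1 (@^~ x))/=.
    rewrite subrr (_ : (fun=> 0 - 0) = (fun=> 0)); last first.
      by apply/funext => y; rewrite subrr.
    by move=> <-; rewrite addr0.
  move=> x; have h0 := rate_ge0 R x; have h1 := rate_le1 R x.
  set u := t * rate R x.
  have u0 : 0 <= u by rewrite mulr_ge0// ltW.
  (* As [rate R x] is u / t, the error is (1 - u - exp(-u)) / t, of size at most u^2 / t <= t. *)
  have -> : t^-1 * (1 - expR (- u)) - rate R x = t^-1 * (1 - u - expR (- u)).
    by rewrite /u; field; rewrite gt_eqF.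
  have e1 := expR_ge1Dx (- u); have e2 := expRN_le2 u0.
  rewrite normrM ger0_norm ?invr_ge0 ?(ltW t0)// mulrC ler_pdivrMr//.
  rewrite ler0_norm; last lra.
  have : u ^+ 2 <= t * t.
    by rewrite expr2; apply: ler_pM => //; rewrite /u ler_piMr// ltW.
  by lra.
split=> [[f2 g2 fg]|[f2 ->]]; last first.
  split => //; last exact: key.
  apply: (@inL2_multiplier R 1) => // x.
  by rewrite ger0_norm ?rate_ge0 ?rate_le1.
split=> //.
have hf := key f2.
suff : forall x, g x = multiplier (rate R) f x by move=> h; apply/funext.
(* The difference quotients converge to g and to the multiplier, so the triangle inequality bounds
   the norm of D by a sum tending to 0. Then D vanishes at every point, each being an atom. *)
set D := fun x => g x - multiplier (rate R) f x.
have D0 : cLnorm mu 2%:E D = 0%E.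
  apply/eqP; rewrite eq_le Lnorm_ge0 andbT.
  have tri (t : R) : (cLnorm mu 2%:E D <=
      cLnorm mu 2%:E (fun x => (t^-1)%:C%C * (f x - cube_semigroup t f x)
        - multiplier (rate R) f x)%R +
      cLnorm mu 2%:E (fun x => (t^-1)%:C%C * (f x - cube_semigroup t f x)
        - g x)%R)%E.
    set a := fun x => _ - multiplier _ _ _; set b := fun x => _ - g x.
    rewrite /cLnorm.
    apply: (@le_trans _ _ (Lnorm mu 2%:E (EFin \o ((fun x => cmod (a x)) \+ (fun x => cmod (b x)))))).
      rewrite !unlock; apply: gt0_ler_poweR => //.
      + by rewrite in_itv/= leey integral_ge0// => x _; exact: poweR_ge0.
      + by rewrite in_itv/= leey integral_ge0// => x _; exact: poweR_ge0.
      apply: ge0_le_integral => //.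
      + by move=> x _; exact: poweR_ge0.
      move=> x _ /=; rewrite lee_fin ge0_ler_powR// ?nnegrE ?normr_ge0//.
      rewrite !ger0_norm ?addr_ge0 ?cmod_ge0//.
      have -> : D x = a x - b x by rewrite /D /a /b; ring.
      by rewrite -(cmodN (b x)) cmodD.
    by apply: minkowski_EFin => //; rewrite ler1n.
  have FF : Filter (0 : R)^'+ by exact: _.
  have := @cvgeD _ _ FF _ _ _ 0%E 0%E isT hf fg; rewrite addr0 => hlim.
  apply: (cvge_ge _ hlim); exact: nearW.
move=> x; apply/eqP; rewrite -subr_eq0 -/(D x); apply/eqP.
apply: cmod_eq0.
have : sqnorm D = 0%E.
  move: D0; rewrite cLnorm2E => /eqP.
  by rewrite poweR_eq0 ?sqnorm_ge0// => /andP[/eqP].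
rewrite /sqnorm => S0.
have := @mem_mass_le R (fun x => (cmod (D x) ^+ 2)%:E) x.
rewrite S0 -EFinM lee_fin => h.
have {}h : mass R x * cmod (D x) ^+ 2 <= 0.
  by apply: h => y; rewrite lee_fin sqr_ge0.
apply/eqP; rewrite -[_ == _](@sqrf_eq0 R) eq_le sqr_ge0 andbT.
by move: h; rewrite pmulr_rle0// block_mass_gt0.
Qed.

End SpectralTheory.

(** * Spectral measure and functional calculus of the generator *)

Section SpectralMeasure.
Context (R : realType).
Local Notation mu := (cube_measure R).
Implicit Types (f g : cubes -> R[i]) (phi psi : cubes -> R).

Lemma energy_mass_ge0 f x : 0 <= mass R x * cmod (walsh_transform f x) ^+ 2.
Proof. by rewrite mulr_ge0 ?mass_ge0 ?sqr_ge0. Qed.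

(** The points of [cubes] also index the Walsh functions, so the distribution of
    |[walsh_transform f]|^2 over frequencies is again a measure on [cubes]; its total mass is the
    squared norm of f. *)
Definition energy f := point_masses (energy_mass_ge0 f).

Lemma ge0_integral_energy f (u : cubes -> \bar R) : (forall x, (0 <= u x)%E) ->
  (\int[energy f]_x u x =
   \int[mu]_x (u x * (cmod (walsh_transform f x) ^+ 2)%:E))%E.
Proof.
move=> u0; rewrite !ge0_integral_point_masses//; last first.
  by move=> x; rewrite mule_ge0// lee_fin sqr_ge0.
apply: eq_eseriesr => n _; apply: eq_bigr => v _.
by rewrite EFinM -muleA [in RHS](muleC (u _)).
Qed.

Lemma energy_setT f : energy f setT = sqnorm f.
Proof.
transitivity (\int[energy f]_x 1)%E.
  by rewrite (integral_cst (energy f) measurableT) mul1e.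
rewrite ge0_integral_energy// -[RHS]sqnorm_walsh.
by apply: eq_integral => x _; rewrite mul1e.
Qed.

Lemma integrable_energy (M : R) f (u : cubes -> R) : inL2 mu f ->
  (forall x, `|u x| <= M) -> (energy f).-integrable setT (EFin \o u).
Proof.
move=> /inL2P f2 uM; apply/integrableP; split.
  exact: measurable_fun_cubes.
apply: (@le_lt_trans _ _ (\int[energy f]_x M%:E))%E.
  by apply: ge0_le_integral => // x _; rewrite lee_fin.
rewrite integral_cst// energy_setT; case: (sqnorm f) f2 (sqnorm_ge0 f) => //= r _ _.
by rewrite -EFinM ltry.
Qed.

Lemma Rintegral_energy (M : R) f (u : cubes -> R) : inL2 mu f ->
  (forall x, `|u x| <= M) ->
  \int[energy f]_x u x = \int[mu]_x (u x * cmod (walsh_transform f x) ^+ 2).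
Proof.
move=> f2 uM; apply: eq_Rintegral_point_masses.
- exact: integrable_energy uM.
- apply/integrableP; split; first exact: measurable_fun_cubes.
  have /integrableP[_] := integrable_energy f2 uM.
  rewrite ge0_integral_energy//; apply: le_lt_trans.
  apply: ge0_le_integral => // x _; rewrite /= -EFinM lee_fin normrM.
  by rewrite (ger0_norm (sqr_ge0 _)).
- by move=> n; apply: eq_bigr => v _; rewrite -mulrA (mulrC (u _)).
Qed.

Lemma measurable_rate : measurable_fun setT (rate R : cubes -> measurableTypeR R).
Proof. by []. Qed.

(** Transporting the energy from frequencies to eigenvalues gives the measure B |-> <E(B) f, f>. *)
Definition spectral_law f : {measure set (measurableTypeR R) -> \bar R} :=
  measure_function_pushforward__canonical__measure_function_Measure
    (energy f) measurable_rate.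

Lemma spectral_lawE f B : spectral_law f B = energy f (rate R @^-1` B).
Proof. by []. Qed.

Definition spectral_projection (B : set (measurableTypeR R)) :=
  multiplier (fun x => (rate R x \in B)%:R : R).

Lemma normr_bool_le1 (b : bool) : `|b%:R : R| <= 1.
Proof. by case: b; rewrite ?normr1 ?normr0. Qed.

Lemma spectral_law_integral f B :
  spectral_law f B = (\int[energy f]_x ((rate R x \in B)%:R)%:E)%E.
Proof.
by rewrite spectral_lawE -[X in energy f X]setIT -integral_indic.
Qed.

Lemma spectral_law_fin f B : inL2 mu f -> measurable B ->
  spectral_law f B = (\int[mu]_x ((rate R x \in B)%:R *
     cmod (walsh_transform f x) ^+ 2))%:E.
Proof.
move=> f2 mB.
rewrite -(Rintegral_energy f2 (fun x => normr_bool_le1 _)) /Rintegral fineK.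
  exact: spectral_law_integral.
apply: integrable_fin_num => //.
exact: (integrable_energy f2 (fun x => normr_bool_le1 _)).
Qed.

Lemma spectral_law_scalar f : inL2 mu f ->
  scalar_spectral_measure mu spectral_projection f (spectral_law f).
Proof.
move=> f2 B mB; rewrite spectral_law_fin//.
by rewrite (inner_multiplier (fun x => normr_bool_le1 _) f2).
Qed.

(** The symbol of a projection is 0 or 1, hence equal to its square, so the squared norm is the
    quadratic form. Countable additivity thereby reduces to continuity of one finite measure. *)
Lemma sqnorm_spectral_projection f B : inL2 mu f -> measurable B ->
  sqnorm (spectral_projection B f) = spectral_law f B.
Proof.
move=> f2 mB; rewrite -sqnorm_walsh walsh_transform_cmultiplier.
rewrite spectral_law_integral ge0_integral_energy; last first.
  by move=> x; rewrite lee_fin.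
apply: eq_integral => x _; rewrite cmodM cmod_real ger0_norm// exprMn -EFinM.
by congr (_ * _)%:E; case: (_ \in _); rewrite ?expr1n ?expr0n.
Qed.

(** D has to contain the spectrum: it will be the whole line for the resolution of A and [0, +oo[
    for the functional calculus. *)
Lemma Rintegral_spectral_law (M : R) f D (u : R -> R) : inL2 mu f ->
  measurable (D : set (measurableTypeR R)) -> (forall x, D (rate R x)) ->
  measurable_fun setT u ->
  (forall x, `|u (rate R x)| <= M) ->
  (spectral_law f).-integrable D (EFin \o u) /\
  \int[spectral_law f]_(l in D) u l =
    \int[mu]_x (u (rate R x) * cmod (walsh_transform f x) ^+ 2).
Proof.
move=> f2 mD Dr mu_ uM.
have DT : rate R @^-1` D = setT by apply/seteqP; split => [//|x _]; exact: Dr.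
have i1 : (energy f).-integrable (rate R @^-1` D) ((EFin \o u) \o rate R).
  by rewrite DT; exact: (integrable_energy f2 uM).
have /measurable_EFinP mEu := mu_.
split; first exact: (integrable_pushforward measurable_rate mEu i1 mD).
rewrite -(Rintegral_energy f2 uM) /Rintegral; apply: (congr1 fine).
by rewrite [LHS](integral_pushforward measurable_rate mEu i1 mD) DT.
Qed.

Lemma spectral_projection_measure : projection_measure mu spectral_projection.
Proof.
split.
- by move=> B _; exists 1; apply: multiplier_bounded => x; exact: normr_bool_le1.
- by move=> B _; apply: (@multiplier_selfadjoint R 1) => x; exact: normr_bool_le1.
- move=> B f _ _; apply: aeeq_cube_measure.
  rewrite /spectral_projection multiplier_comp; congr multiplier.
  by apply/funext => x; case: (_ \in _); rewrite ?mulr1 ?mulr0.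
- move=> f _; apply: aeeq_cube_measure; rewrite -[RHS]multiplier1.
  by congr multiplier; apply/funext => x; rewrite in_setT.
- move=> F f mF tF f2.
  (* G n is what the first n sets leave out. The G n decrease to the empty set, so their spectral
     law, the squared norm of the error, tends to 0. *)
  pose G n := \bigcup_k F k `\` \bigcup_(k < n) F k.
  have mG n : measurable (G n).
    by apply: measurableD; [exact: bigcupT_measurable | exact: bigcup_measurable].
  have E n : (fun x => spectral_projection (\bigcup_k F k) f x -
      \sum_(k < n) spectral_projection (F k) f x) = spectral_projection (G n) f.
    transitivity (fun x => spectral_projection (\bigcup_k F k) f x -
        multiplier (fun y => \sum_(k < n) (rate R y \in F k)%:R) f x).
      by rewrite (@multiplier_sum R n (fun k x => (rate R x \in F k)%:R)).
    rewrite multiplierB; congr multiplier.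
    apply/funext => x; move: (rate R x) => r.
    have [rF|rF] := boolP (r \in \bigcup_k F k); last first.
      have rn k : r \in F k = false.
        apply/negbTE; apply: contra rF; rewrite !inE => rk; by exists k.
      rewrite big1 ?subr0 => [|k _]; last by rewrite rn.
      rewrite (_ : r \in G n = false)//; apply/negbTE; apply: contra rF.
      by rewrite !inE => -[].
    move: (rF); rewrite inE => -[k _ Fkr].
    have Fj j : (r \in F j) = (j == k).
      apply/idP/eqP => [|->]; rewrite inE// => Fjr.
      by apply: (tF j k) => //; exists r.
    have [kn|kn] := ltnP k n.
      rewrite (bigD1 (Ordinal kn))//= Fj eqxx big1 => [|j jk]; last first.
        rewrite Fj; case: eqP => // jk'; case/eqP: jk; exact/val_inj.
      rewrite addr0 subrr (_ : r \in G n = false)//.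
      by apply/negbTE/negP => /set_mem -[_]; apply; exists k.
    rewrite big1 => [|j _]; last first.
      by rewrite Fj; case: eqP => // jk; move: kn; rewrite -jk leqNgt ltn_ord.
    rewrite subr0 (_ : r \in G n = true)//; apply/mem_set; split.
      by exists k.
    move=> [j /= jn /mem_set]; rewrite Fj => /eqP jk.
    by move: jn; rewrite jk ltnNge kn.
  under eq_fun do rewrite E cLnorm2E sqnorm_spectral_projection//.
  have fin n : spectral_law f (G n) \is a fin_num.
    by rewrite spectral_law_fin.
  have h : spectral_law f \o G @ \oo --> spectral_law f (\bigcap_n G n).
    apply: nonincreasing_cvg_mu => //.
    + by rewrite ltey_eq fin.
    + exact: bigcapT_measurable.
    + move=> m n mn; apply/subsetPset => r [Fr nFr]; split => // -[k /= km Fk].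
      by apply: nFr; exists k => //=; exact: leq_trans km mn.
  have G0 : \bigcap_n G n = set0.
    apply/seteqP; split => // r /= Gr.
    have [[k _ Fk] _] := Gr 0%N I.
    by have [_] := Gr k.+1 I; apply; exists k => /=.
  rewrite G0 measure0 in h.
  move/fine_cvgP : h => [_ h].
  rewrite (_ : (fun n => (spectral_law f (G n) `^ 2^-1)%E) =
    (fun n => (fine (spectral_law f (G n)) `^ 2^-1)%:E)); last first.
    by apply/funext => n; rewrite -[in LHS](fineK (fin n)).
  apply: cvg_EFin; first exact: nearW.
  rewrite (_ : _ \o _ = Num.sqrt \o (fine \o (spectral_law f \o G))); last first.
    by apply/funext => n /=; rewrite powR12_sqrt//; apply/fine_ge0/measure_ge0.
  rewrite -[X in _ --> X](sqrtr0 R).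
  exact: (cvg_comp _ _ h (@sqrt_continuous R 0)).
Qed.

Lemma cube_spectral_resolution :
  spectral_resolution mu (neg_generator mu (@cube_semigroup R))
    spectral_projection.
Proof.
split; first exact: spectral_projection_measure.
move=> f f2; exists (spectral_law f); split.
- exact: spectral_law_scalar.
(* Both sides hold for every f in L^2: A is bounded, and the law is finite and carried by [0, 1]. *)
- split=> _; last by exists (multiplier (rate R) f); apply/cube_generator.
  have r2 x : `|rate R x ^+ 2| <= 1.
    by rewrite normrX exprn_ile1// ger0_norm ?rate_ge0 ?rate_le1.
  have m2 : measurable_fun [set: R] (fun l : R => l ^+ 2).
    exact: measurable_funX (@measurable_id _ _ _).
  have [/integrableP[_ h] _] :=
    Rintegral_spectral_law f2 measurableT (fun=> I) m2 r2.
  apply: le_lt_trans h; rewrite le_eqVlt; apply/orP; left; apply/eqP.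
  by apply: eq_integral => l _; rewrite gee0_abs// lee_fin sqr_ge0.
- move=> g /cube_generator[_ ->].
  have r1 x : `|rate R x| <= 1 by rewrite ger0_norm ?rate_ge0 ?rate_le1.
  rewrite (inner_multiplier r1 f2).
  by have [_ ->] := @Rintegral_spectral_law 1 f setT id f2 measurableT (fun=> I)
    (@measurable_id _ _ _) r1.
Qed.

(** [hormander_estimate] concerns whichever operators represent m(A); this supplies the one to which
    it will be applied. *)
Lemma cube_functional_calculus (M : R) (m : R -> R[i]) :
  cmeasurable setT m -> (forall x, cmod (m (rate R x)) <= M) ->
  functional_calculus mu (neg_generator mu (@cube_semigroup R)) m
    (cmultiplier (m \o rate R)).
Proof.
move=> [mr mi] mM; exists spectral_projection; split.
- exact: cube_spectral_resolution.
- by exists M; exact: cmultiplier_bounded.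
move=> f f2; exists (spectral_law f).
have mD : measurable (`[0, +oo[%classic : set (measurableTypeR R)).
  exact: measurable_itv.
have Dr x : `[0, +oo[%classic (rate R x) by rewrite /= in_itv/= rate_ge0.
have [i1 e1] := Rintegral_spectral_law f2 mD Dr mr
  (fun x => le_trans (normr_Re _) (mM x)).
have [i2 e2] := Rintegral_spectral_law f2 mD Dr mi
  (fun x => le_trans (normr_Im _) (mM x)).
split => //; first exact: spectral_law_scalar.
by rewrite (inner_cmultiplier mM f2) /cintegral e1 e2.
Qed.

End SpectralMeasure.

(** * The semigroup as a product of independent coordinate flips; the markovian properties *)

Section Markovian.
Context (R : realType).
Local Notation mu := (cube_measure R).
Implicit Types (f g : cubes -> R[i]).

(** A Walsh function of level k decays by exp(-t k / D), the k-th power of this number, which is the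
    correlation of one coordinate with itself after time t. *)
Definition flip_rate (t : R) (n : nat) : R := expR (- (t / (cube_dim n)%:R)).

Lemma flip_rate_ge0 t n : 0 <= flip_rate t n.
Proof. exact: expR_ge0. Qed.

Lemma flip_rate_le1 t n : 0 <= t -> flip_rate t n <= 1.
Proof.
by move=> t0; rewrite -[leRHS]expR0 ler_expR oppr_le0 divr_ge0.
Qed.

Lemma cube_semigroupE t f x : cube_semigroup t f x =
  \sum_(y : vertex (tag x))
    (flip_kernel (flip_rate t (tag x)) (tagged x) y)%:C%C * f (at_vertex y).
Proof.
rewrite -(multiplier_powE (flip_rate t)); congr (multiplier _ f x).
apply/funext => z; rewrite /flip_rate -expRM_natl /rate; congr expR.
by rewrite -mulr_natl; ring.
Qed.

Lemma bsign_cases b : bsign R b = 1 \/ bsign R b = -1.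
Proof. by case: b; rewrite /bsign ?expr0 ?expr1; [right|left]. Qed.

Lemma flip_kernel_ge0 n (rho : R) (x y : vertex n) : 0 <= rho <= 1 ->
  0 <= flip_kernel rho x y.
Proof.
move=> /andP[r0 r1]; apply: mulr_ge0; first by rewrite exprn_ge0.
apply: prodr_ge0 => i _.
by case: (bsign_cases (x i)) (bsign_cases (y i)) => -> [] ->; lra.
Qed.

Lemma flip_kernelC n (rho : R) (x y : vertex n) :
  flip_kernel rho x y = flip_kernel rho y x.
Proof.
by congr (_ * _); apply: eq_bigr => i _; rewrite (mulrC (bsign R (x i))).
Qed.

(** The kernel factors over the coordinates, and averaging (1 + rho x b) (1 + delta b) over the two
    signs b gives 1 + rho delta x. The semigroup thus maps a product weight to one whose tilt is
    multiplied by rho. *)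
Lemma sum_flip_kernel_prod n (rho delta : R) (x : vertex n) :
  \sum_(y : vertex n) flip_kernel rho x y * \prod_i (1 + delta * bsign R (y i)) =
  \prod_i (1 + rho * delta * bsign R (x i)).
Proof.
have -> : \prod_i (1 + rho * delta * bsign R (x i)) =
  \prod_i \sum_(b : bool)
    2^-1 * (1 + rho * (bsign R (x i) * bsign R b)) * (1 + delta * bsign R b).
  apply: eq_bigr => i _; rewrite big_bool/= /bsign expr0 expr1.
  by field.
rewrite bigA_distr_bigA/=; apply: eq_bigr => y _.
by rewrite /flip_kernel !big_split/= prodr_const card_ord.
Qed.

Lemma sum_flip_kernel n (rho : R) (x : vertex n) :
  \sum_(y : vertex n) flip_kernel rho x y = 1.
Proof.
have <- : \prod_i (1 + rho * 0 * bsign R (x i)) = 1.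
  by rewrite big1// => i _; rewrite mulr0 mul0r addr0.
rewrite -sum_flip_kernel_prod; apply: eq_bigr => y _.
by rewrite [\prod_i (1 + _)]big1 ?mulr1// => i _; rewrite mul0r addr0.
Qed.

(** Jensen from Young: with a the mean and q' the conjugate exponent, q_i a^(p-1) <= q_i^p / p + a^p
    / q', and averaging turns the left side into a^p. *)
Lemma powR_jensen (I : finType) (K q : I -> R) (p : R) : 1 <= p ->
  (forall i, 0 <= K i) -> \sum_i K i = 1 -> (forall i, 0 <= q i) ->
  (\sum_i K i * q i) `^ p <= \sum_i K i * q i `^ p.
Proof.
move=> p1 K0 K1 q0; set a := \sum_i K i * q i.
have a0 : 0 <= a by apply: sumr_ge0 => i _; exact: mulr_ge0.
have p0 : 0 < p by lra.
have [->|pn1] := eqVneq p 1.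
  rewrite powRr1//; apply: ler_sum => i _; by rewrite powRr1.
have [->|an0] := eqVneq a 0.
  rewrite powR0 ?gt_eqF//; apply: sumr_ge0 => i _.
  by rewrite mulr_ge0// powR_ge0.
have {pn1} pp : 0 < p - 1 by rewrite lt_neqAle eq_sym subr_eq0 pn1/= subr_ge0.
pose q' := p / (p - 1).
have q'0 : 0 < q' by rewrite divr_gt0.
have pq : p^-1 + q'^-1 = 1.
  by rewrite /q' invf_div; field; rewrite gt_eqF.
have young i : q i * a `^ (p - 1) <= q i `^ p / p + a `^ p / q'.
  have := conjugate_powR (q0 i) (powR_ge0 a (p - 1)) p0 q'0 pq.
  by rewrite -powRrM /q' [(p - 1) * _]mulrC divfK ?gt_eqF.
have : \sum_i K i * (q i * a `^ (p - 1)) <=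
    \sum_i K i * (q i `^ p / p + a `^ p / q').
  by apply: ler_sum => i _; exact: ler_wpM2l.
have -> : \sum_i K i * (q i * a `^ (p - 1)) = a `^ p.
  under eq_bigr do rewrite mulrA.
  rewrite -mulr_suml -/a -{1}(powRr1 a0) -powRD; last by rewrite an0 implybT.
  by congr (_ `^ _); ring.
have -> : \sum_i K i * (q i `^ p / p + a `^ p / q') =
   (\sum_i K i * q i `^ p) / p + a `^ p / q'.
  under eq_bigr do rewrite mulrDr mulrA.
  by rewrite big_split/= -!mulr_suml K1 mul1r.
have -> : q'^-1 = 1 - p^-1 by rewrite -pq; ring.
rewrite mulrBr mulr1 addrCA lerDl subr_ge0 ler_pM2r ?invr_gt0//.
Qed.

Lemma cmod_cube_semigroup_le t f x : 0 <= t -> cmod (cube_semigroup t f x) <=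
  \sum_(y : vertex (tag x))
    flip_kernel (flip_rate t (tag x)) (tagged x) y * cmod (f (at_vertex y)).
Proof.
move=> t0; rewrite cube_semigroupE; apply: (le_trans (cmod_sum _ _ _)).
apply: ler_sum => y _; rewrite cmodM cmod_real ger0_norm//.
by apply: flip_kernel_ge0; rewrite flip_rate_ge0 flip_rate_le1.
Qed.

(** Jensen at each vertex, then exchange of the sums: the kernel is symmetric, so its columns also
    sum to 1. *)
Lemma cube_semigroup_Lp (p : R) t f : 1 <= p -> 0 <= t ->
  (cLnorm mu p%:E (cube_semigroup t f) <= cLnorm mu p%:E f)%E.
Proof.
move=> p1 t0; have p0 : 0 < p by lra.
rewrite /cLnorm !unlock; apply: gt0_ler_poweR.
- by rewrite invr_ge0 ltW.
- by rewrite in_itv/= leey integral_ge0// => x _; exact: poweR_ge0.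
- by rewrite in_itv/= leey integral_ge0// => x _; exact: poweR_ge0.
have K0 n := flip_rate_ge0 t n; have K1 n := flip_rate_le1 n t0.
rewrite !ge0_integral_cube_measure; try by move=> x; exact: poweR_ge0.
apply: lee_nneseries => [n _ _|n _].
  rewrite mule_ge0 ?lee_fin ?(ltW (block_mass_gt0 _ _))// sume_ge0// => x _.
  exact: poweR_ge0.
rewrite lee_wpmul2l ?lee_fin ?(ltW (block_mass_gt0 _ _))//.
rewrite /= !sumEFin lee_fin.
apply: (@le_trans _ _ (\sum_(x : vertex n) \sum_(y : vertex n)
    flip_kernel (flip_rate t n) x y * cmod (f (at_vertex y)) `^ p)).
  apply: ler_sum => x _; rewrite ger0_norm ?cmod_ge0//.
  apply: le_trans; last first.
    apply: powR_jensen => //.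
    + by move=> y; apply: flip_kernel_ge0; rewrite K0 K1.
    + exact: sum_flip_kernel.
    + by move=> y; exact: cmod_ge0.
  apply: ge0_ler_powR; rewrite ?nnegrE ?cmod_ge0// ?(ltW p0)//.
    apply: sumr_ge0 => y _; rewrite mulr_ge0 ?cmod_ge0//.
    by apply: flip_kernel_ge0; rewrite K0 K1.
  exact: cmod_cube_semigroup_le (at_vertex x) t0.
rewrite exchange_big/=; apply: ler_sum => y _.
rewrite -mulr_suml (ger0_norm (cmod_ge0 _)).
under eq_bigr do rewrite flip_kernelC.
by rewrite sum_flip_kernel mul1r.
Qed.

Lemma ess_sup_cube_measure (f : cubes -> \bar R) (M : \bar R) :
  (ess_sup mu f <= M)%E <-> forall x, (f x <= M)%E.
Proof.
split=> [/ess_supP h|h]; last by apply/ess_supP; exact: aeW.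
exact: ae_cube_measure h.
Qed.

Lemma cube_semigroup_Loo t f : 0 <= t ->
  (cLnorm mu +oo%E (cube_semigroup t f) <= cLnorm mu +oo%E f)%E.
Proof.
move=> t0; rewrite /cLnorm !unlock cube_measure_setT lte01.
apply/ess_sup_cube_measure => x /=.
have K0 n := flip_rate_ge0 t n; have K1 n := flip_rate_le1 n t0.
set M := ess_sup _ _.
have hM : forall y, ((`|cmod (f y)|)%:E <= M)%E.
  exact: (ess_sup_cube_measure (fun y => (`|cmod (f y)|)%:E) M).1 (lexx _).
case: M hM => [M| |] hM; last 2 first.
- by rewrite leey.
- by have := hM point.
rewrite lee_fin ger0_norm ?cmod_ge0//.
apply: (le_trans (cmod_cube_semigroup_le f x t0)).
apply: (@le_trans _ _ (\sum_(y : vertex (tag x))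
    flip_kernel (flip_rate t (tag x)) (tagged x) y * M)).
  apply: ler_sum => y _; apply: ler_wpM2l.
    by apply: flip_kernel_ge0; rewrite K0 K1.
  by have := hM (at_vertex y); rewrite lee_fin ger0_norm ?cmod_ge0.
by rewrite -mulr_suml sum_flip_kernel mul1r.
Qed.

Lemma cube_semigroup_markovian : markovian mu (@cube_semigroup R).
Proof.
split.
- exact: cube_semigroup_c0.
- move=> t t0; apply: (@multiplier_selfadjoint R 1) => x.
  exact: expR_rate_le1.
(* The kernel formula makes sense for every function on [cubes], so the operator is its own
   extension to each L^p. *)
- move=> t p t0 p1; exists (cube_semigroup t); split; last first.
    by move=> f _ _; exact: aeeq_cube_measure.
  have bound f : (cLnorm mu p (cube_semigroup t f) <= cLnorm mu p f)%E.
    case: p p1 => [p| |]//; first by rewrite lee_fin => p1; exact: cube_semigroup_Lp.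
    by move=> _; exact: cube_semigroup_Loo.
  split.
  + by move=> f [_ fp]; split; [split | exact: le_lt_trans (bound f) fp].
  + by move=> f g _ _ /aeeqE ->; exact: aeeq_cube_measure.
  + by move=> a f g _ _; apply: aeeq_cube_measure; rewrite [LHS]cmultiplier_linear.
  + by move=> f _; rewrite mul1e.
- move=> t f t0 _ /ae_cube_measure f0; apply: aeW => x.
  rewrite cube_semigroupE; apply: sumr_ge0 => y _; apply: mulr_ge0 => //.
  by rewrite ler0c; apply: flip_kernel_ge0; rewrite flip_rate_ge0 flip_rate_le1.
- move=> t t0; apply: aeeq_cube_measure; apply/funext => x.
  rewrite cube_semigroupE; under eq_bigr do rewrite mulr1.
  by rewrite -rmorph_sum/= sum_flip_kernel.
Qed.

End Markovian.

(** * The weight *)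

Section ProductWeight.
Context (R : realType).
Local Notation mu := (cube_measure R).
Implicit Types (f g : cubes -> R[i]).

(** At n = 0 the convention 1 / 0 = 0 gives tilt 0 in dimension 0, and the bounds below hold for all
    n. *)
Definition tilt (n : nat) : R := (n.*2)%:R^-1.

Lemma tilt_ge0 n : 0 <= tilt n.
Proof. by rewrite invr_ge0. Qed.

Lemma tilt_le2 n : tilt n <= 2^-1.
Proof.
case: n => [|n]; first by rewrite /tilt invr0.
by rewrite lef_pV2 ?posrE// ler_nat doubleS.
Qed.

Definition tilt_weight (x : cubes) : R :=
  \prod_i (1 + tilt (tag x) * bsign R (tagged x i)).

Lemma tilt_weight_gt0 x : 0 < tilt_weight x.
Proof.
apply: prodr_gt0 => i _; have := tilt_ge0 (tag x); have := tilt_le2 (tag x).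
by case: (bsign_cases R (tagged x i)) => ->; lra.
Qed.

Lemma tilt_weight_weight : weight tilt_weight.
Proof. by split => // x; exact: tilt_weight_gt0. Qed.

(** At a given point only the finitely many values of w on its cube enter; once n exceeds them the
    truncation is inactive and the sequence is constant. *)
Lemma sg_weightE t (w : cubes -> R) x :
  sg_weight (@cube_semigroup R) t w x =
  (\sum_(y : vertex (tag x))
    flip_kernel (flip_rate t (tag x)) (tagged x) y * w (at_vertex y))%:E.
Proof.
pose M := \sum_(y : vertex (tag x)) `|w (at_vertex y)|.
apply/cvg_lim => //; apply: cvg_near_cst.
near=> N.
have MN : M <= N%:R by near: N; exact: nbhs_infty_ger.
congr EFin; rewrite cube_semigroupE Re_sum; apply: eq_bigr => y _.
rewrite Re_rM ifT//; apply: le_trans MN; apply: (le_trans (ler_norm _)).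
by rewrite /M (bigD1 y)//= lerDl sumr_ge0.
Unshelve. all: by end_near. Qed.

(** As x_i^2 = 1, the inverse of 1 + delta x_i is (1 - delta x_i) / (1 - delta^2). The inverse
    weight is therefore a multiple of the product weight of opposite tilt, on which the semigroup
    acts by the same formula. *)
Lemma tilt_weightV x :
  (tilt_weight x)^-1 = (1 - tilt (tag x) ^+ 2) ^- cube_dim (tag x) *
    \prod_i (1 + (- tilt (tag x)) * bsign R (tagged x i)).
Proof.
have -> : (1 - tilt (tag x) ^+ 2) ^- cube_dim (tag x) =
    \prod_(i < cube_dim (tag x)) (1 - tilt (tag x) ^+ 2)^-1.
  by rewrite prodr_const card_ord exprVn.
rewrite -big_split/= /tilt_weight -prodfV.
apply: eq_bigr => i _.
have := tilt_ge0 (tag x); have := tilt_le2 (tag x) => t1 t0.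
case: (bsign_cases R (tagged x i)) => ->; field.
  by apply/andP; split; apply/eqP; nra.
by apply/andP; split; apply/eqP; nra.
Qed.

Lemma bernoulli (x : R) n : 0 <= 1 + x -> 1 + n%:R * x <= (1 + x) ^+ n.
Proof.
move=> x0; elim: n => [|n ih]; first by rewrite mul0r addr0 expr0.
rewrite exprS; apply: le_trans (ler_wpM2l x0 ih).
rewrite -natr1; have : 0 <= n%:R * x ^+ 2 by rewrite mulr_ge0 ?sqr_ge0.
by nra.
Qed.

Lemma tilt_dim n : (cube_dim n)%:R * tilt n ^+ 2 <= 2^-1.
Proof.
case: n => [|n]; first by rewrite /cube_dim/= mul0r invr_ge0.
rewrite le_eqVlt; apply/orP; left; apply/eqP.
rewrite /tilt /cube_dim -!muln2 !natrM.
have : n.+1%:R != 0 :> R by rewrite pnatr_eq0.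
by move: (n.+1%:R : R) => y y0; field.
Qed.

(** Bernoulli: (1 - delta^2)^D >= 1 - D delta^2 >= 1/2. *)
Lemma tilt_Q2_le2 n : (1 - tilt n ^+ 2) ^- cube_dim n <= 2.
Proof.
have t0 := tilt_ge0 n; have t1 := tilt_le2 n.
have h : 2^-1 <= (1 - tilt n ^+ 2) ^+ cube_dim n.
  apply: le_trans (bernoulli _ _); last by nra.
  by rewrite mulrN; have := tilt_dim n; lra.
rewrite -[leRHS]invrK lef_pV2// posrE ?invr_gt0//.
by apply: lt_le_trans h; rewrite invr_gt0.
Qed.

Lemma tilt_weight_Q2 : (Q2 mu (@cube_semigroup R) tilt_weight < +oo)%E.
Proof.
apply: (@le_lt_trans _ _ 2%:E); last exact: ltry.
apply: ge_ereal_sup => _ [t /= t0] <-; apply/ess_sup_cube_measure => x.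
rewrite !sg_weightE -EFinM lee_fin.
have -> : \sum_(y : vertex (tag x)) flip_kernel (flip_rate t (tag x)) (tagged x) y *
     tilt_weight (at_vertex y) =
   \prod_i (1 + flip_rate t (tag x) * tilt (tag x) * bsign R (tagged x i)).
  by rewrite -sum_flip_kernel_prod; apply: eq_bigr.
have -> : \sum_(y : vertex (tag x)) flip_kernel (flip_rate t (tag x)) (tagged x) y *
     (tilt_weight (at_vertex y))^-1 =
   (1 - tilt (tag x) ^+ 2) ^- cube_dim (tag x) *
   \prod_i (1 + flip_rate t (tag x) * - tilt (tag x) * bsign R (tagged x i)).
  rewrite -sum_flip_kernel_prod mulr_sumr; apply: eq_bigr => y _.
  by rewrite tilt_weightV/= mulrCA.
rewrite mulrCA -big_split/=; apply: le_trans (tilt_Q2_le2 (tag x)).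
have T0 := tilt_ge0 (tag x); have T1 := tilt_le2 (tag x).
rewrite -[leRHS]mulr1; apply: ler_wpM2l.
  by rewrite invr_ge0 exprn_ge0//; nra.
have r0 := flip_rate_ge0 t (tag x); have r1 := flip_rate_le1 (tag x) t0.
apply: (@le_trans _ _ (\prod_(i < cube_dim (tag x)) 1)); last by rewrite big1_eq.
apply: ler_prod => i _.
(* The two averages are products with tilts a and -a, so each coordinate contributes (1 + a x_i) (1
   - a x_i) = 1 - a^2 <= 1, whatever t. *)
set a := flip_rate t (tag x) * tilt (tag x).
have a0 : 0 <= a by exact: mulr_ge0.
have a1 : a <= 2^-1 by rewrite /a; nra.
by rewrite mulrN -/a; case: (bsign_cases R (tagged x i)) => ->; nra.
Qed.

Definition vertex_indicator n (v : vertex n) : cubes -> R[i] :=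
  fun x => (x == at_vertex v)%:R.

Lemma cmod_bool (b : bool) : cmod (b%:R : R[i]) = b%:R.
Proof. by rewrite -(rmorph_nat (real_complex R)) cmod_real normr_nat. Qed.

Lemma inL2_vertex_indicator n (v : vertex n) : inL2 mu (vertex_indicator v).
Proof.
apply/inL2P; apply: (@le_lt_trans _ _ (\int[mu]_x 1)%E).
  apply: ge0_le_integral => //; first by move=> x _; rewrite lee_fin sqr_ge0.
  move=> x _; rewrite lee_fin cmod_bool exprn_ile1//.
  by case: (_ == _).
by rewrite integral_cst// cube_measure_setT mule1 ltry.
Qed.

Lemma integral_vertex_indicator n (v : vertex n) (u : cubes -> R) :
  (forall x, 0 <= u x) ->
  (\int[mu]_x (cmod (vertex_indicator v x) ^+ 2 * u x)%:E)%E =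
  (block_mass R n * u (at_vertex v))%:E.
Proof.
move=> u0.
have e x : 0 <= cmod (vertex_indicator v x) ^+ 2 * u x.
  by rewrite mulr_ge0 ?sqr_ge0.
rewrite ge0_integral_cube_measure//.
rewrite (@nneseriesD1 _ _ n)//=; last first.
  move=> k _; apply: mule_ge0; last by apply: sume_ge0 => x _; rewrite lee_fin.
  by rewrite lee_fin ltW ?block_mass_gt0.
rewrite (bigD1 v)//= big1 ?adde0; last first.
  move=> x xv; rewrite cmod_bool /vertex_indicator.
  case: eqP => [/eqP|_]; last by rewrite expr0n mul0r.
  by rewrite eq_Tagged/= (negbTE xv).
rewrite cmod_bool /vertex_indicator eqxx expr1n mul1r eseries0 ?adde0 ?EFinM//.
move=> k _ kn; rewrite big1 ?mule0// => x _.
rewrite cmod_bool; case: eqP => [/(congr1 tag)/= kn'|_]; last by rewrite expr0n mul0r.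
by case/eqP: kn.
Qed.

(** On the n-th cube only the values of [phi] at the points k / D enter. The ratio will be negative
    when this is applied, so the kernel is then no longer that of a semigroup. *)
Lemma block_cmultiplier_power (phi : R -> R[i]) n (rho : R) f (v : vertex n) :
  (forall k : nat, phi (k%:R / (cube_dim n)%:R) = (rho ^+ k)%:C%C) ->
  cmultiplier (phi \o rate R) f (at_vertex v) =
  \sum_(y : vertex n) (flip_kernel rho v y)%:C%C * f (at_vertex y).
Proof.
move=> h; rewrite -(multiplier_powE (fun=> rho) f (at_vertex v)).
by apply: eq_cmultiplier => y /=; rewrite /rate h.
Qed.

Definition all_true n : vertex n := [ffun => true].
Definition all_false n : vertex n := [ffun => false].

(* The image of the point mass at one vertex is large at the antipodal vertex,
   where the weight is larger by a factor exponential in the dimension. *)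
Lemma antipodal_lower_bound (m : R -> R[i]) n (rho K : R) :
  0 <= rho -> 0 <= K ->
  (forall k : nat, m (k%:R / (cube_dim n)%:R) = ((- rho) ^+ k)%:C%C) ->
  extends_boundedly mu (wLnorm2 mu tilt_weight) K%:E (cmultiplier (m \o rate R)) ->
  (((1 + rho) / 2) ^+ 2 * (1 + tilt n)) ^+ cube_dim n <=
    K ^+ 2 * (1 - tilt n) ^+ cube_dim n.
Proof.
move=> rho0 K0 mE [S' [bS eS]].
have w0 x : 0 <= tilt_weight x by exact/ltW/tilt_weight_gt0.
(* [true] stands for the sign -1: [all_true] has the smallest weight and [all_false] the largest. *)
set v := all_true n; set f := vertex_indicator v.
set S := cmultiplier (m \o rate R) in eS.
have fint := integral_vertex_indicator v w0.
have fw : in_space (wLnorm2 mu tilt_weight) f.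
  by split => //; rewrite /wLnorm2 fint poweR_EFin ltry.
have f2 := inL2_vertex_indicator v.
have := bo_bound bS fw; rewrite (aeeqE (eS f f2 fw)) => hK.
(* The two vertices differ in every coordinate, so with ratio -rho each factor of the kernel is (1 +
   rho) / 2. *)
have Sv : S f (at_vertex (all_false n)) = (((1 + rho) / 2) ^+ cube_dim n)%:C%C.
  rewrite /S (block_cmultiplier_power f _ mE) (bigD1 v)//= big1 ?addr0; last first.
    move=> y yv; rewrite /f /vertex_indicator.
    by rewrite eq_Tagged/= (negbTE yv) mulr0.
  rewrite /f /vertex_indicator eqxx mulr1 /flip_kernel; congr (_%:C)%C.
  rewrite exprMn exprVn mulrC; congr (_ / _).
  rewrite (eq_bigr (fun=> 1 + rho)) ?prodr_const ?card_ord// => i _.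
  by rewrite !ffunE /bsign expr0 expr1; ring.
have lb : ((block_mass R n * (((1 + rho) / 2) ^+ cube_dim n) ^+ 2 *
     (1 + tilt n) ^+ cube_dim n)%:E <=
    \int[mu]_x (cmod (S f x) ^+ 2 * tilt_weight x)%:E)%E.
  have := @mem_mass_le R (fun x => (cmod (S f x) ^+ 2 * tilt_weight x)%:E)
    (at_vertex (all_false n)).
  rewrite Sv cmod_real ger0_norm ?exprn_ge0 ?divr_ge0 ?addr_ge0//.
  rewrite -EFinM mulrA.
  have -> : tilt_weight (at_vertex (all_false n)) = (1 + tilt n) ^+ cube_dim n.
    rewrite /tilt_weight (eq_bigr (fun=> 1 + tilt n)) ?prodr_const ?card_ord//.
    by move=> i _; rewrite ffunE /bsign expr0 mulr1.
  by apply => x; rewrite lee_fin mulr_ge0 ?sqr_ge0.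
have wv : tilt_weight (at_vertex v) = (1 - tilt n) ^+ cube_dim n.
  rewrite /tilt_weight (eq_bigr (fun=> 1 - tilt n)) ?prodr_const ?card_ord//.
  by move=> i _; rewrite ffunE /bsign expr1 mulrN1.
(* The norm bound is squared next; an infinite left side is excluded because the weighted norm of
   the indicator is finite. *)
have M0 := block_mass_gt0 R n.
have ub : (\int[mu]_x (cmod (S f x) ^+ 2 * tilt_weight x)%:E <=
    (K ^+ 2 * (block_mass R n * (1 - tilt n) ^+ cube_dim n))%:E)%E.
  move: hK; rewrite /wLnorm2 fint wv.
  have I0 : (0 <= \int[mu]_x (cmod (S f x) ^+ 2 * tilt_weight x)%:E)%E.
    by apply: integral_ge0 => x _; rewrite lee_fin mulr_ge0 ?sqr_ge0.
  set I := (\int[mu]_x _)%E in I0 *; move: I I0 => [I| |]//; last first.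
    move=> _; rewrite poweRyr ?invr_eq0// poweR_EFin -EFinM leye_eq => /eqP//.
  rewrite !lee_fin => I0; rewrite !powR12_sqrt//; last first.
    by rewrite mulr_ge0 ?(ltW M0)// -wv.
  move=> h; rewrite -(sqr_sqrtr I0) -[X in _ * X](@sqr_sqrtr R); last first.
    by rewrite mulr_ge0 ?(ltW M0)// -wv.
  by rewrite -exprMn lerXn2r ?nnegrE ?sqrtr_ge0// mulr_ge0 ?sqrtr_ge0.
have := le_trans lb ub; rewrite lee_fin -mulrA [leRHS]mulrCA ler_pM2l//.
by rewrite -exprM mulnC exprM -exprMn.
Qed.

End ProductWeight.

(** * Bessel potentials *)

Section HeatKernel.
Context (R : realType).
Local Notation leb := (@lebesgue_measure R).
Implicit Types (a b c r t x y z : R).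

(** Vanishing for t <= 0 turns integrals over the half-line into integrals over the line, where
    scaling and Tonelli are stated. *)
Definition cut_power a t : R := (0 < t)%R%:R * t `^ (a - 1).

(* Inverses are written with [powR] so that [measurable_powR] applies. *)
Definition heat t x : R :=
  (4 * pi * t) `^ (- 2^-1) * expR (- (x ^+ 2 * (4 * t) `^ (-1))).

Lemma cut_power_ge0 a t : 0 <= cut_power a t.
Proof. by rewrite mulr_ge0 ?powR_ge0. Qed.

Lemma heat_ge0 t x : 0 <= heat t x.
Proof. by rewrite mulr_ge0 ?powR_ge0 ?expR_ge0. Qed.

Lemma heatE t x : 0 < t ->
  heat t x = (Num.sqrt (4 * pi * t))^-1 * expR (- (x ^+ 2 / (4 * t))).
Proof.
move=> t0; have pt : 0 <= 4 * pi * t by rewrite !mulr_ge0 ?pi_ge0 ?(ltW t0).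
by rewrite /heat powRN powR12_sqrt// powR_inv1// mulr_ge0 ?(ltW t0).
Qed.

(** A Gaussian of variance 2 t: its total mass and measurability are taken from the normal law. *)
Lemma heat_normal t x y : 0 < t ->
  heat t (x - y) = normal_pdf x (Num.sqrt (2 * t)) y.
Proof.
move=> t0; have s0 : Num.sqrt (2 * t) != 0 by rewrite gt_eqF// sqrtr_gt0; lra.
rewrite heatE// normal_pdfE// /normal_peak /normal_fun sqr_sqrtr; last lra.
congr (_^-1 * expR _).
  by congr Num.sqrt; rewrite -mulr_natl; ring.
by rewrite -mulr_natl; field; rewrite gt_eqF.
Qed.

Lemma integral_heat t x : 0 < t -> (\int[leb]_y (heat t (x - y))%:E = 1)%E.
Proof.
move=> t0; under eq_integral do rewrite heat_normal//.
exact: integral_normal_pdf.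
Qed.

(** Completing the square in y: the product equals [heat (t + r) (x - z)] times a heat kernel of
    time v = t r / (t + r) centred at the weighted mean m, and the latter integrates to 1. *)
Lemma heat_conv t r x z : 0 < t -> 0 < r ->
  (\int[leb]_y (heat t (x - y) * heat r (y - z))%:E = (heat (t + r) (x - z))%:E)%E.
Proof.
move=> t0 r0; set v := t * r / (t + r); set m := (r * x + t * z) / (t + r).
have tr0 : 0 < t + r by rewrite addr_gt0.
have v0 : 0 < v by rewrite divr_gt0// mulr_gt0.
have e y : heat t (x - y) * heat r (y - z) = heat (t + r) (x - z) * heat v (m - y).
  rewrite !heatE// mulrACA [RHS]mulrACA -!expRD -!invfM -!sqrtrM ?mulr_ge0 ?pi_ge0 ?(ltW t0) ?(ltW tr0)//.
  congr (_^-1 * expR _).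
    by congr Num.sqrt; rewrite /v; field; rewrite gt_eqF.
  rewrite /v /m; field; do ?(apply/andP; split); rewrite ?gt_eqF//.
under eq_integral do rewrite e EFinM.
rewrite ge0_integralZl//.
- by rewrite integral_heat// mule1.
- apply/measurable_EFinP; under eq_fun do rewrite heat_normal//.
  exact: measurable_normal_pdf.
- by move=> y _; rewrite lee_fin heat_ge0.
- by rewrite lee_fin heat_ge0.
Qed.

(** Uniqueness of Lebesgue measure: c times its image under y |-> c y agrees with it on
    intervals. *)
Lemma ge0_integral_scale c (F : R -> \bar R) : 0 < c ->
  measurable_fun [set: R] F -> (forall x, (0 <= F x)%E) ->
  (\int[leb]_x F x = c%:E * \int[leb]_x F (c * x)%R)%E.
Proof.
move=> c0 mF F0.
have ms : measurable_fun [set: R] (fun x : R => c * x : measurableTypeR R).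
  exact: measurable_funM.
pose m := mscale (NngNum (ltW c0))
  (measure_function_pushforward__canonical__measure_function_Measure leb ms).
have E A : measurable A -> leb A = m A.
  apply: lebesgue_measure_unique => _ [[u v]] _ <-.
  rewrite /m /= /mscale/= /pushforward.
  rewrite (_ : _ @^-1` _ = `]u / c, v / c]%classic); last first.
    apply/seteqP; split=> y/=; rewrite !in_itv/= ltr_pdivrMr// ler_pdivlMr//;
      by rewrite !(mulrC c).
  rewrite /= !lebesgue_measure_itv/= !lte_fin ltr_pM2r ?invr_gt0//.
  case: ifPn => _; last by rewrite mule0.
  by rewrite -!EFinB -EFinM; congr EFin; field; rewrite gt_eqF.
rewrite (@eq_measure_integral _ _ _ _ m leb) => [|A mA _]; last exact: E.
rewrite ge0_integral_mscale//=; congr (_ * _)%E.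
by rewrite ge0_integral_pushforward.
Qed.

End HeatKernel.

(** * The Gamma integral: finiteness and positivity *)

Section GammaFunction.
Context (R : realType).
Local Notation leb := (@lebesgue_measure R).
Implicit Types (a b c r t x y z : R).

Lemma measurable_pos : measurable_fun [set: R] (fun t : R => (0 < t)%R%:R : R).
Proof.
rewrite (_ : (fun _ => _) = \1_(`]0, +oo[)%classic); first exact: measurable_indic.
by apply/funext => t; rewrite indicE mem_setE in_itv/= andbT.
Qed.

Lemma measurable_cut_power a : measurable_fun [set: R] (cut_power a).
Proof.
apply: measurable_funM; first exact: measurable_pos.
exact: measurable_powR.
Qed.

Lemma integral_half_line (f : R -> R) :
  (\int[leb]_(t in `]0%R, +oo[) (f t)%:E = \int[leb]_t ((0 < t)%R%:R * f t)%:E)%E.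
Proof.
rewrite integral_mkcond; apply: eq_integral => t _.
rewrite patchE mem_setE in_itv/= andbT; case: ifP => _; rewrite ?mul1r ?mul0r//.
Qed.

Definition gamma_density a t : R := cut_power a t * expR (- t).

Lemma gamma_density_ge0 a t : 0 <= gamma_density a t.
Proof. by rewrite mulr_ge0 ?cut_power_ge0 ?expR_ge0. Qed.

Lemma measurable_gamma_density a : measurable_fun [set: R] (gamma_density a).
Proof.
apply: measurable_funM; first exact: measurable_cut_power.
apply: measurableT_comp => //; exact: measurable_funN.
Qed.

(** Kept in the extended reals, so that Tonelli can be used before finiteness is known. *)
Definition gammae a : \bar R := (\int[leb]_t (gamma_density a t)%:E)%E.

Lemma gammae_ge0 a : (0 <= gammae a)%E.
Proof. by apply: integral_ge0 => t _; rewrite lee_fin gamma_density_ge0. Qed.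

Lemma expr_le_expR (N : nat) x : 0 <= x -> x ^+ N <= N%:R ^+ N * expR x.
Proof.
move=> x0; case: N => [|N]; first by rewrite !expr0 mul1r -[leLHS]expR0 ler_expR.
have N0 : 0 < N.+1%:R :> R by rewrite ltr0n.
have -> : expR x = expR (x / N.+1%:R) ^+ N.+1.
  by rewrite -expRM_natl -mulr_natl mulrCA mulfV ?mulr1// gt_eqF.
rewrite -exprMn lerXn2r ?nnegrE// ?mulr_ge0 ?expR_ge0//.
have := expR_ge1Dx (x / N.+1%:R) => h.
by rewrite -ler_pdivrMl// [_^-1 * _]mulrC (le_trans _ h)// lerDr.
Qed.

Lemma sqr_powR_le_expR a : 0 < a -> exists2 C : R, 0 < C &
  forall t, 0 < t -> (1 + t `^ a) ^+ 2 <= C * expR t.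
Proof.
move=> a0.
have [N aN N0] : exists2 N : nat, a <= N%:R & (0 < N)%N.
  by exists (Num.truncn a).+1 => //; exact/ltW/truncnS_gt.
(* With N >= a, (1 + t^a)^2 <= 4 (1 + t)^(2 N), and [expr_le_expR] is applied at 1 + t. *)
exists (4 * ((N * 2)%:R ^+ (N * 2) * expR 1)).
  have N2 : 0 < (N * 2)%:R :> R by rewrite ltr0n muln_gt0 N0.
  by rewrite mulr_gt0// mulr_gt0 ?expR_gt0// exprn_gt0.
move=> t t0.
have ta : t `^ a <= (1 + t) ^+ N.
  rewrite -powR_mulrn; last lra.
  apply: (@le_trans _ _ ((1 + t) `^ a)).
    by apply: ge0_ler_powR; rewrite ?nnegrE; lra.
  by apply: ler_powR => //; lra.
have t1 : 1 <= (1 + t) ^+ N by rewrite exprn_ege1//; lra.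
have p0 := powR_ge0 t a.
have le1 : (1 + t `^ a) ^+ 2 <= (2 * (1 + t) ^+ N) ^+ 2.
  by rewrite lerXn2r ?nnegrE; lra.
apply: (le_trans le1).
have -> : (2 * (1 + t) ^+ N) ^+ 2 = 4 * (1 + t) ^+ (N * 2).
  by rewrite exprM; ring.
rewrite -!mulrA -expRD ler_pM2l//; apply: expr_le_expR; lra.
Qed.

(** The integrand may blow up at 0, so the fundamental theorem is used on [e, +oo[ and the half-line
    is exhausted with e = 1 / (n + 1). *)
Lemma lt0_integral_half_line (f : R -> R) (M : R) :
  (forall t, 0 < t -> 0 <= f t) -> measurable_fun [set: R] f ->
  (forall e, 0 < e -> (\int[leb]_(t in `[e, +oo[) (f t)%:E <= M%:E)%E) ->
  (\int[leb]_(t in `]0%R, +oo[) (f t)%:E <= M%:E)%E.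
Proof.
move=> f0 mf h; pose F (n : nat) := (`[n.+1%:R^-1, +oo[ : set R)%classic.
have U : \bigcup_n F n = (`]0, +oo[ : set R)%classic.
  apply/seteqP; split => [t [n _]|t]; rewrite /F/= !in_itv/= !andbT.
    by move=> nt; apply: lt_le_trans nt; rewrite invr_gt0.
  move=> t0; exists (Num.truncn t^-1) => //=; rewrite in_itv/= andbT.
  by rewrite invf_ple ?posrE//; exact/ltW/truncnS_gt.
rewrite -U.
have c : (\int[leb]_(x in F i) (f x)%:E)%E @[i --> \oo] -->
    (\int[leb]_(x in \bigcup_i F i) (f x)%:E)%E.
  apply: ge0_nondecreasing_set_cvg_integral.
  - apply/nondecreasing_seqP => n; apply/subsetPset => t.
    rewrite /F/= !in_itv/= !andbT; apply: le_trans.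
    by rewrite lef_pV2 ?posrE// ler_nat.
  - by move=> n; exact: measurable_itv.
  - by move=> n; apply/measurable_EFinP; exact: measurable_funTS.
  - move=> n t; rewrite /F/= in_itv/= andbT lee_fin => nt; apply: f0.
    by apply: lt_le_trans nt; rewrite invr_gt0.
apply: (cvge_le _ c); apply: nearW => n; apply: h.
by rewrite invr_gt0.
Qed.

(** One bounded primitive handles both ends: the derivative of -1 / (1 + t^a) behaves like t^(a-1)
    at 0, and at infinity the exponential beats its denominator, so a multiple of it dominates the
    density. *)
Lemma gammae_fin a : 0 < a -> (gammae a < +oo)%E.
Proof.
move=> a0; have [C C0 hC] := sqr_powR_le_expR a0.
pose G t := - (1 + t `^ a)^-1.
pose g t := a * t `^ (a - 1) / (1 + t `^ a) ^+ 2.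
have p1 t : 0 < 1 + t `^ a by rewrite ltr_pwDl// powR_ge0.
have dG t : 0 < t -> is_derive t 1 G (g t).
  move=> t0; have d1 := is_derive1_powR a t0.
  have d2 : is_derive t 1 (fun t => 1 + t `^ a) (a * t `^ (a - 1)).
    by apply: is_derive_eq; rewrite add0r mul1r.
  have d3 := @is_deriveV R (fun t => 1 + t `^ a) t _ _ (lt0r_neq0 (p1 t)) d2.
  apply: (is_derive_eq (is_deriveN d3)).
  by rewrite /g scaleNr opprK /GRing.scale/= mulrC.
have g0 t : 0 < t -> 0 <= g t.
  move=> t0; apply: divr_ge0; last exact: sqr_ge0.
  by apply: mulr_ge0; [exact: ltW | exact: powR_ge0].
have cg t : 0 < t -> {for t, continuous g}.
  move=> t0; have d1 := is_derive1_powR a t0.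
  have d2 := is_derive1_powR (a - 1) t0.
  have c1 : {for t, continuous (fun t => t `^ a)}.
    by apply: differentiable_continuous; apply/derivable1_diffP; exact: ex_derive.
  have c2 : {for t, continuous (fun t => t `^ (a - 1))}.
    by apply: differentiable_continuous; apply/derivable1_diffP; exact: ex_derive.
  apply: cvgM; first by apply: cvgM; [exact: cvg_cst | exact: c2].
  apply: cvgV; first by rewrite expf_neq0// gt_eqF.
  apply: (continuous_comp (f := fun t => 1 + t `^ a) (g := fun u => u ^+ 2)).
    by apply: cvgD; [exact: cvg_cst | exact: c1].
  exact: exprn_continuous.
have key e : 0 < e -> (\int[leb]_(t in `[e, +oo[) (g t)%:E <= 1%:E)%E.
  move=> e0.
  have cG t : 0 < t -> {for t, continuous G}.
    move=> t0; apply: differentiable_continuous; apply/derivable1_diffP.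
    by have [] := dG t t0.
  rewrite (@ge0_continuous_FTC2y _ g G e 0).
  - rewrite -EFinB lee_fin sub0r opprK invf_le1// lerDl; exact: powR_ge0.
  - by move=> t et; apply: g0; exact: lt_le_trans et.
  - apply: continuous_in_subspaceT => t; rewrite inE/= in_itv/= andbT => et.
    by apply: cg; exact: lt_le_trans et.
  - rewrite -oppr0; apply: cvgN.
    apply/gtr0_cvgV0; first exact: nearW.
    apply/cvgryPge => A; near=> t.
    have tA : `|A| `^ a^-1 <= t by near: t; exact: nbhs_pinfty_ge.
    have := @ge0_ler_powR _ a (ltW a0) (`|A| `^ a^-1) t.
    rewrite !nnegrE powR_ge0 (le_trans (powR_ge0 _ _) tA) -powRrM mulVf ?gt_eqF//.
    rewrite powRr1// => /(_ isT isT tA) h; have := ler_norm A; lra.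
  - by move=> t et; have [] := dG t (lt_trans e0 et).
  - by apply: cvg_at_right_filter; exact: cG.
  - move=> t; rewrite in_itv/= andbT => et.
    by rewrite derive1E; have [_ ->] := dG t (lt_trans e0 et).
have mg : measurable_fun [set: R] g.
  apply: measurable_funM.
    by apply: measurable_funM => //; exact: measurable_powR.
  rewrite (_ : (fun _ => _) = (fun t => (1 + t `^ a) `^ (- 2%:R))); last first.
    by apply/funext => t; rewrite powR_invn// ltW.
  have m1 : measurable_fun [set: R] (fun t : R => 1 + t `^ a).
    by apply: measurable_funD => //; exact: measurable_powR.
  exact: (measurableT_comp (measurable_powR (- 2%:R)) m1).
have I1 : (\int[leb]_(t in `]0%R, +oo[) (g t)%:E <= 1%:E)%E.
  exact: lt0_integral_half_line.
rewrite integral_half_line in I1.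
apply: (@le_lt_trans _ _ ((C / a)%:E * 1%:E)%E); last by rewrite -EFinM ltry.
have Ca : 0 <= C / a by rewrite divr_ge0 ?ltW.
apply: le_trans (lee_wpmul2l _ I1); last by rewrite lee_fin.
have pg0 t : (0 <= ((0 < t)%R%:R * g t)%:E)%E.
  by rewrite lee_fin; case: ltP => t0; rewrite ?mul1r ?mul0r ?g0.
rewrite -ge0_integralZl//; last first.
  apply/measurable_EFinP; apply: measurable_funM => //; exact: measurable_pos.
apply: ge0_le_integral => //.
- by move=> t _; rewrite lee_fin gamma_density_ge0.
- by apply/measurable_EFinP; exact: measurable_gamma_density.
- apply/measurable_EFinP; apply: measurable_funM => //.
  apply: measurable_funM => //; exact: measurable_pos.
move=> t _; rewrite -EFinM lee_fin /gamma_density /cut_power.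
case: ltP => t0; rewrite ?mul0r ?mulr0// !mul1r.
have := hC t t0; rewrite /g => h.
have -> : C / a * (a * t `^ (a - 1) / (1 + t `^ a) ^+ 2) =
    t `^ (a - 1) * (C / (1 + t `^ a) ^+ 2).
  by field; rewrite !gt_eqF.
apply: ler_wpM2l; first exact: powR_ge0.
rewrite expRN ler_pdivlMr ?exprn_gt0// mulrC ler_pdivrMr ?expR_gt0//.
Unshelve. all: by end_near. Qed.

(** A zero integral would make the density vanish almost everywhere, yet it is positive on ]0,
    1[. *)
Lemma gammae_gt0 a : (0 < gammae a)%E.
Proof.
rewrite lt_neqAle gammae_ge0 andbT eq_sym; apply/eqP => h.
have m : measurable_fun [set: R] (fun t => (gamma_density a t)%:E).
  by apply/measurable_EFinP; exact: measurable_gamma_density.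
have [N [mN N0 sub]] : ae_eq leb setT (fun t => (gamma_density a t)%:E) (cst 0%E).
  apply/(ae_eq_integral_abs leb measurableT m).
  rewrite -[RHS]h; apply: eq_integral => t _.
  by rewrite gee0_abs// lee_fin gamma_density_ge0.
have : (leb `]0%R, 1%R[%classic <= leb N)%E.
  apply: le_measure; rewrite ?inE//.
  move=> t /=; rewrite in_itv/= => /andP[t0 _]; apply: sub => /(_ I)/= => -[].
  rewrite /gamma_density /cut_power t0 mul1r => /eqP; apply/negP.
  by rewrite mulf_neq0// gt_eqF// ?expR_gt0// powR_gt0.
by rewrite lebesgue_measure_itv/= lte_fin ltr01 N0 -EFinB lee_fin subr0 ler10.
Qed.

Lemma euler_GammaE a : euler_Gamma a = fine (gammae a).
Proof.
rewrite /euler_Gamma /Rintegral integral_half_line; congr fine.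
by apply: eq_integral => t _; rewrite /gamma_density /cut_power mulrA.
Qed.

End GammaFunction.

(** * Convolution of Bessel kernels *)

Section BesselKernel.
Context (R : realType).
Local Notation leb := (@lebesgue_measure R).
Implicit Types (a b c r t x y z : R).

Lemma tonelli (f : R -> R -> \bar R) :
  measurable_fun [set: R * R] (fun p => f p.1 p.2) ->
  (forall x y, (0 <= f x y)%E) ->
  (\int[leb]_x \int[leb]_y f x y = \int[leb]_y \int[leb]_x f x y)%E.
Proof.
move=> mf f0.
exact: (fubini_tonelli (m1 := leb) (m2 := leb) (fun p => f p.1 p.2) mf
  (fun p => f0 _ _)).
Qed.

Lemma measurable_heat d (T : measurableType d) (f g : T -> R) :
  measurable_fun [set: T] f -> measurable_fun [set: T] g ->
  measurable_fun [set: T] (fun p => heat (f p) (g p)).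
Proof.
move=> mf mg.
have mfc c : measurable_fun [set: T] (fun p => c * f p) by exact: measurable_funM.
apply: measurable_funM.
  exact: (measurableT_comp (measurable_powR (- 2^-1)) (mfc (4 * pi))).
apply: (measurableT_comp (@measurable_expR R)).
apply: measurable_funN; apply: measurable_funM; first exact: measurable_funX.
exact: (measurableT_comp (measurable_powR (- 1)) (mfc 4)).
Qed.

Definition bessel_density a t x : R := gamma_density a t * heat t x.

Lemma bessel_density_ge0 a t x : 0 <= bessel_density a t x.
Proof. by rewrite mulr_ge0 ?gamma_density_ge0 ?heat_ge0. Qed.

Lemma measurable_bessel_density a d (T : measurableType d) (f g : T -> R) :
  measurable_fun [set: T] f -> measurable_fun [set: T] g ->
  measurable_fun [set: T] (fun p => bessel_density a (f p) (g p)).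
Proof.
move=> mf mg; apply: measurable_funM; last exact: measurable_heat.
exact: (measurableT_comp (measurable_gamma_density a) mf).
Qed.

Definition bessel_int a x : \bar R := (\int[leb]_t (bessel_density a t x)%:E)%E.

Lemma bessel_int_ge0 a x : (0 <= bessel_int a x)%E.
Proof. by apply: integral_ge0 => t _; rewrite lee_fin bessel_density_ge0. Qed.

Lemma measurable_bessel_int a (f : R -> R) : measurable_fun [set: R] f ->
  measurable_fun [set: R] (fun y => bessel_int a (f y)).
Proof.
move=> mf.
apply: (measurable_fun_fubini_tonelli_F (m2 := leb)
  (fun p : R * R => (bessel_density a p.2 (f p.1))%:E)).
- apply/measurable_EFinP; apply: measurable_bessel_density.
    exact: measurable_snd.
  exact: (measurableT_comp mf measurable_fst).
- by move=> p; rewrite lee_fin bessel_density_ge0.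
Qed.

Lemma bessel_kernelE s x :
  bessel_kernel s x = (fine (gammae (s / 2)))^-1 * fine (bessel_int (s / 2) x).
Proof.
rewrite /bessel_kernel euler_GammaE; congr (_ * _).
rewrite /Rintegral integral_half_line; congr fine.
apply: eq_integral => t _; congr EFin.
rewrite /bessel_density /gamma_density /cut_power.
case: ltP => t0; rewrite ?mul1r ?mul0r// heatE//.
rewrite powRN powR12_sqrt ?mulr_ge0 ?pi_ge0 ?(ltW t0)//.
Qed.

Lemma gamma_density0 a t : t <= 0 -> gamma_density a t = 0.
Proof. by move=> t0; rewrite /gamma_density /cut_power ltNge t0 !mul0r. Qed.

Lemma integral_bessel_int a x :
  (\int[leb]_y bessel_int a (x - y)%R = gammae a)%E.
Proof.
have mx : measurable_fun [set: R] (fun y : R => x - y) by exact: measurable_funB.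
rewrite /bessel_int [LHS](@tonelli
  (fun y t => (bessel_density a t (x - y))%:E))/=; last 2 first.
- apply/measurable_EFinP; apply: measurable_bessel_density.
    exact: measurable_snd.
  exact: (measurableT_comp mx measurable_fst).
- by move=> y t; rewrite lee_fin bessel_density_ge0.
apply: eq_integral => t _.
have [t0|t0] := ltP 0 t; last first.
  rewrite gamma_density0// -[RHS](integral0 leb setT); apply: eq_integral => y _.
  by rewrite /bessel_density gamma_density0// mul0r.
under eq_integral do rewrite EFinM.
rewrite ge0_integralZl//.
- by rewrite integral_heat// mule1.
- apply/measurable_EFinP; apply: measurable_heat => //.
- by move=> y _; rewrite lee_fin heat_ge0.
- by rewrite lee_fin gamma_density_ge0.
Qed.

Lemma cut_powerM a c t : 0 < c -> cut_power a (c * t) = c `^ (a - 1) * cut_power a t.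
Proof.
move=> c0; rewrite /cut_power pmulr_rgt0//.
by case: ltP => t0; rewrite ?mul0r ?mulr0// !mul1r powRM// ltW.
Qed.

(** Euler's beta integral in the variable v = t / r. *)
Definition beta_int a b : \bar R :=
  (\int[leb]_v (cut_power a v * (1 + v) `^ (- (a + b)))%:E)%E.

(** Substitute t = r v, exchange, then rescale r by 1 + v: the function of t + r decouples from v.
    Psi(u) = exp(-u) gives the relation between Gamma and Beta, Psi(u) = exp(-u) [heat u x] the
    convolution of Bessel kernels. Both carry the same beta factor, which cancels later without
    being evaluated. *)
Lemma gamma_conv a b (Psi : R -> R) : measurable_fun [set: R] Psi ->
  (forall t, 0 <= Psi t) ->
  (\int[leb]_r \int[leb]_t (cut_power b r * cut_power a t * Psi (t + r)%R)%:E =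
   beta_int a b * \int[leb]_t (cut_power (a + b) t * Psi t)%:E)%E.
Proof.
move=> mP P0.
have mc c := measurable_cut_power (R := R) c.
(* The Jacobian r of t = r v and the two powers of r combine to r^(a + b - 1). *)
have step1 r : (\int[leb]_t (cut_power b r * cut_power a t * Psi (t + r)%R)%:E =
    \int[leb]_v (cut_power a v * (cut_power (a + b) r * Psi (r * (1 + v))%R))%:E)%E.
  have [r0|r0] := ltP 0 r; last first.
    rewrite /cut_power ltNge r0/=; apply: eq_integral => t _.
    by rewrite !mul0r mulr0.
  rewrite (ge0_integral_scale r0); last 2 first.
  - apply/measurable_EFinP; apply: measurable_funM.
      by apply: measurable_funM => //.
    have m1 : measurable_fun [set: R] (fun t : R => t + r) by exact: measurable_funD.
    exact: (measurableT_comp mP m1).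
  - by move=> t; rewrite lee_fin !mulr_ge0 ?powR_ge0 ?P0.
  rewrite -ge0_integralZl//; last 3 first.
  - apply/measurable_EFinP; apply: measurable_funM.
      apply: measurable_funM => //.
      have m1 : measurable_fun [set: R] (fun t : R => r * t) by exact: measurable_funM.
      exact: (measurableT_comp (mc a) m1).
    have m1 : measurable_fun [set: R] (fun t : R => r * t + r).
      by apply: measurable_funD => //; exact: measurable_funM.
    exact: (measurableT_comp mP m1).
  - by move=> t _; rewrite lee_fin !mulr_ge0 ?powR_ge0 ?P0.
  - by rewrite lee_fin ltW.
  apply: eq_integral => v _; rewrite -EFinM; congr EFin.
  rewrite cut_powerM// mulrDr mulr1 [r + _]addrC /cut_power r0 !mul1r.
  have -> : r `^ (a + b - 1) = r * r `^ (a - 1) * r `^ (b - 1).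
    have rn0 : r != 0 by rewrite gt_eqF.
    rewrite -{2}(powRr1 (ltW r0)) -!powRD ?rn0 ?implybT//.
    by congr (_ `^ _); ring.
  by ring.
under eq_integral do rewrite step1.
rewrite [LHS](@tonelli (fun r v =>
  (cut_power a v * (cut_power (a + b) r * Psi (r * (1 + v))))%:E))/=; last 2 first.
- apply/measurable_EFinP; apply: measurable_funM.
    exact: (measurableT_comp (mc a) measurable_snd).
  apply: measurable_funM.
    exact: (measurableT_comp (mc (a + b)) measurable_fst).
  have m1 : measurable_fun [set: R * R] (fun p : R * R => p.1 * (1 + p.2)).
    apply: measurable_funM; first exact: measurable_fst.
    by apply: measurable_funD => //; exact: measurable_snd.
  exact: (measurableT_comp mP m1).
- by move=> r v; rewrite lee_fin !mulr_ge0 ?powR_ge0 ?P0.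
have I0 : (0 <= \int[leb]_t (cut_power (a + b) t * Psi t)%:E)%E.
  by apply: integral_ge0 => t _; rewrite lee_fin mulr_ge0 ?cut_power_ge0 ?P0.
rewrite /beta_int -ge0_integralZr//; last 2 first.
- apply/measurable_EFinP; apply: measurable_funM; first exact: mc.
  have m1 : measurable_fun [set: R] (fun v : R => 1 + v) by exact: measurable_funD.
  exact: (measurableT_comp (measurable_powR (- (a + b))) m1).
- by move=> v _; rewrite lee_fin mulr_ge0 ?cut_power_ge0 ?powR_ge0.
apply: eq_integral => v _.
have [v0|v0] := ltP 0 v; last first.
  rewrite /cut_power ltNge v0/= !mul0r mul0e -[RHS](integral0 leb setT).
  by apply: eq_integral => t _; rewrite !mul0r.
have c0 : 0 < 1 + v by lra.
have mS : measurable_fun [set: R] (fun t => (cut_power (a + b) t * Psi t)%:E).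
  by apply/measurable_EFinP; exact: measurable_funM.
rewrite (ge0_integral_scale c0 mS); last first.
  by move=> t; rewrite lee_fin mulr_ge0 ?cut_power_ge0 ?P0.
under eq_integral do rewrite EFinM.
rewrite ge0_integralZl//; last 3 first.
- apply/measurable_EFinP; apply: measurable_funM; first exact: mc.
  have m1 : measurable_fun [set: R] (fun t : R => t * (1 + v)) by exact: measurable_funM.
  exact: (measurableT_comp mP m1).
- by move=> t _; rewrite lee_fin mulr_ge0 ?cut_power_ge0 ?P0.
- by rewrite lee_fin cut_power_ge0.
rewrite [(cut_power a v * _)%:E]EFinM -muleA; congr (_ * _)%E.
have e t : ((cut_power (a + b) ((1 + v) * t) * Psi ((1 + v) * t))%:E =
    ((1 + v) `^ (a + b - 1))%:E * (cut_power (a + b) t * Psi (t * (1 + v))%R)%:E)%E.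
  by rewrite cut_powerM// -EFinM [t * _]mulrC; congr EFin; ring.
have -> : (\int[leb]_t (cut_power (a + b) ((1 + v) * t) * Psi ((1 + v) * t))%:E =
    ((1 + v) `^ (a + b - 1))%:E *
    \int[leb]_t (cut_power (a + b) t * Psi (t * (1 + v))%R)%:E)%E.
  rewrite -ge0_integralZl//.
  - by apply: eq_integral => t _; exact: e.
  - apply/measurable_EFinP; apply: measurable_funM; first exact: mc.
    have m1 : measurable_fun [set: R] (fun t : R => t * (1 + v)) by exact: measurable_funM.
    exact: (measurableT_comp mP m1).
  - by move=> t _; rewrite lee_fin mulr_ge0 ?cut_power_ge0 ?P0.
  - by rewrite lee_fin powR_ge0.
rewrite !muleA -!EFinM.
have -> : (1 + v) `^ (- (a + b)) * (1 + v) * (1 + v) `^ (a + b - 1) = 1.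
  have rn0 : 1 + v != 0 by rewrite gt_eqF.
  rewrite -{2}(powRr1 (ltW c0)) -!powRD ?rn0 ?implybT//.
  by rewrite (_ : - (a + b) + 1 + (a + b - 1) = 0) ?powRr0//; ring.
by rewrite mul1e.
Qed.

Lemma gammaeM a b : (gammae a * gammae b = beta_int b a * gammae (b + a))%E.
Proof.
have me : measurable_fun [set: R] (fun t : R => expR (- t)).
  apply: (measurableT_comp (@measurable_expR R)); exact: measurable_funN.
rewrite /gammae -(gamma_conv b a me (fun t => expR_ge0 _)).
rewrite -ge0_integralZr//.
- apply: eq_integral => r _; rewrite -ge0_integralZl//.
  + apply: eq_integral => t _; rewrite -EFinM; congr EFin.
    by rewrite /gamma_density opprD expRD; ring.
  + by apply/measurable_EFinP; exact: measurable_gamma_density.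
  + by move=> t _; rewrite lee_fin gamma_density_ge0.
  + by rewrite lee_fin gamma_density_ge0.
- by apply/measurable_EFinP; exact: measurable_gamma_density.
- by move=> t _; rewrite lee_fin gamma_density_ge0.
- by apply: integral_ge0 => t _; rewrite lee_fin gamma_density_ge0.
Qed.

(** For fixed times t and r the integral over y is the heat semigroup law; what remains is a double
    integral to which [gamma_conv] applies. *)
Lemma bessel_int_conv a b x z :
  (\int[leb]_y (bessel_int a (x - y)%R * bessel_int b (y - z)%R) =
   beta_int b a * bessel_int (b + a) (x - z)%R)%E.
Proof.
have mx : measurable_fun [set: R] (fun y : R => x - y) by exact: measurable_funB.
have mz : measurable_fun [set: R] (fun y : R => y - z) by exact: measurable_funB.
have mD1 c w : measurable_fun [set: R] (fun t => (bessel_density c t w)%:E).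
  apply/measurable_EFinP.
  exact: (measurable_bessel_density _ (@measurable_id _ _ _) (measurable_cst _)).
have mD2 c t (f : R -> R) : measurable_fun [set: R] f ->
    measurable_fun [set: R] (fun y => (bessel_density c t (f y))%:E).
  move=> mf; apply/measurable_EFinP.
  exact: (measurable_bessel_density _ (measurable_cst _) mf).
have D0 c t w : (0 <= (bessel_density c t w)%:E)%E.
  by rewrite lee_fin bessel_density_ge0.
transitivity (\int[leb]_y \int[leb]_t
    ((bessel_density a t (x - y))%:E * bessel_int b (y - z)%R))%E.
  apply: eq_integral => y _; rewrite ge0_integralZr//.
    exact: mD1.
  exact: bessel_int_ge0.
rewrite [LHS](@tonelli (fun y t =>
   ((bessel_density a t (x - y))%:E * bessel_int b (y - z)%R)%E))/=; last 2 first.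
- apply: emeasurable_funM.
    apply/measurable_EFinP; apply: measurable_bessel_density.
      exact: measurable_snd.
    exact: (measurableT_comp mx measurable_fst).
  exact: (measurableT_comp (measurable_bessel_int b mz) measurable_fst).
- by move=> y t; rewrite mule_ge0// bessel_int_ge0.
transitivity (\int[leb]_t \int[leb]_r
    (cut_power a t * cut_power b r * (expR (- (r + t)) * heat (r + t) (x - z)))%:E)%E; last first.
  rewrite (@gamma_conv b a (fun u => expR (- u) * heat u (x - z)))//.
  - congr (_ * _)%E; apply: eq_integral => t _; congr EFin.
    by rewrite /bessel_density /gamma_density mulrA.
  - apply: measurable_funM.
      apply: (measurableT_comp (@measurable_expR R)); exact: measurable_funN.
    exact: (measurable_heat (@measurable_id _ _ _) (measurable_cst _)).
  - by move=> u; rewrite mulr_ge0 ?expR_ge0 ?heat_ge0.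
apply: eq_integral => t _.
transitivity (\int[leb]_y \int[leb]_r
    ((bessel_density a t (x - y)) * bessel_density b r (y - z))%:E)%E.
  apply: eq_integral => y _; rewrite -ge0_integralZl//; exact: mD1.
rewrite [LHS](@tonelli (fun y r =>
   (bessel_density a t (x - y) * bessel_density b r (y - z))%:E))/=; last 2 first.
- apply/measurable_EFinP; apply: measurable_funM.
    apply: measurable_bessel_density => //.
    exact: (measurableT_comp mx measurable_fst).
  apply: measurable_bessel_density; first exact: measurable_snd.
  exact: (measurableT_comp mz measurable_fst).
- by move=> y r; rewrite lee_fin mulr_ge0 ?bessel_density_ge0.
apply: eq_integral => r _.
(* The heat semigroup law asks for positive times; at the others both sides carry zero density. *)
have [t0|t0] := ltP 0 t; last first.
  rewrite {2}/cut_power [in X in _ = X]/cut_power ltNge t0/= !mul0r.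
  rewrite -[RHS](integral0 leb setT); apply: eq_integral => y _.
  by rewrite /bessel_density (gamma_density0 _ t0) !mul0r.
have [r0|r0] := ltP 0 r; last first.
  rewrite [cut_power b r]/cut_power ltNge r0/= !mul0r mulr0 mul0r.
  rewrite -[RHS](integral0 leb setT); apply: eq_integral => y _.
  by rewrite /bessel_density (gamma_density0 _ r0) !mul0r mulr0.
rewrite [r + t]addrC; transitivity (\int[leb]_y
   ((gamma_density a t * gamma_density b r)%:E * (heat t (x - y) * heat r (y - z))%:E))%E.
  apply: eq_integral => y _; rewrite -EFinM; congr EFin.
  by rewrite /bessel_density; ring.
rewrite ge0_integralZl//.
- rewrite heat_conv// -EFinM; congr EFin.
  by rewrite /gamma_density opprD expRD; ring.
- apply/measurable_EFinP; apply: measurable_funM.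
    exact: (measurable_heat (measurable_cst _) mx).
  exact: (measurable_heat (measurable_cst _) mz).
- by move=> y _; rewrite lee_fin mulr_ge0 ?heat_ge0.
- by rewrite lee_fin mulr_ge0 ?gamma_density_ge0.
Qed.

End BesselKernel.

(** * The semigroup of Bessel potentials on bounded functions *)

Section BesselPotential.
Context (R : realType).
Local Notation leb := (@lebesgue_measure R).
Implicit Types (s r x y z M : R) (h k : R -> R).

Definition gammar s : R := fine (gammae (s / 2)).

Lemma gammar_gt0 s : 0 < s -> 0 < gammar s.
Proof.
move=> s0; apply: fine_gt0; rewrite gammae_gt0/=.
by apply: gammae_fin; rewrite divr_gt0.
Qed.

Lemma gammarE s : 0 < s -> (gammar s)%:E = gammae (s / 2).
Proof.
move=> s0; rewrite fineK// ge0_fin_numE ?gammae_ge0//.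
by apply: gammae_fin; rewrite divr_gt0.
Qed.

Lemma bessel_kernel_ge0 s x : 0 < s -> 0 <= bessel_kernel s x.
Proof.
move=> s0; rewrite bessel_kernelE mulr_ge0//.
  by rewrite invr_ge0 ltW// gammar_gt0.
by rewrite fine_ge0// bessel_int_ge0.
Qed.

Lemma measurable_bessel_int_comp a d (T : measurableType d) (f : T -> R) :
  measurable_fun [set: T] f ->
  measurable_fun [set: T] (fun p => bessel_int a (f p)).
Proof.
move=> mf.
exact: (measurableT_comp (measurable_bessel_int a (@measurable_id _ _ _)) mf).
Qed.

Lemma measurable_bessel_kernel s d (T : measurableType d) (f : T -> R) :
  measurable_fun [set: T] f ->
  measurable_fun [set: T] (fun p => bessel_kernel s (f p)).
Proof.
move=> mf; under eq_fun do rewrite bessel_kernelE.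
apply: measurable_funM => //.
exact: (measurableT_comp (fine_measurable measurableT) (measurable_bessel_int_comp (s / 2) mf)).
Qed.

Lemma measurable_subr x : measurable_fun [set: R] (fun y : R => x - y).
Proof. exact: measurable_funB. Qed.

(** [bessel_kernel] passes through [fine], which sends an infinite value, possible at the origin, to
    0. As [bessel_int] is integrable, this affects a null set only. *)
Lemma integral_bessel_kernel s x (u : R -> \bar R) : 0 < s ->
  measurable_fun [set: R] u -> (forall y, (0 <= u y)%E) ->
  (\int[leb]_y ((bessel_kernel s (x - y))%:E * u y) =
   ((gammar s)^-1)%:E * \int[leb]_y (bessel_int (s / 2) (x - y)%R * u y))%E.
Proof.
move=> s0 mu u0; have g0 := gammar_gt0 s0.
have mbx := measurable_bessel_int_comp (s / 2) (measurable_subr x).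
rewrite -ge0_integralZl//; last 3 first.
- by apply: emeasurable_funM.
- by move=> y _; rewrite mule_ge0// bessel_int_ge0.
- by rewrite lee_fin invr_ge0 ltW.
apply: ge0_ae_eq_integral => //.
- apply: emeasurable_funM => //; apply/measurable_EFinP.
  exact: measurable_bessel_kernel (measurable_subr x).
- by apply: emeasurable_funM => //; exact: emeasurable_funM.
- by move=> y _; rewrite mule_ge0// lee_fin bessel_kernel_ge0.
- move=> y _; rewrite mule_ge0 ?lee_fin ?invr_ge0 ?(ltW g0)//.
  by rewrite mule_ge0// bessel_int_ge0.
have ib : leb.-integrable setT (fun y => bessel_int (s / 2) (x - y)%R).
  apply/integrableP; split => //.
  under eq_integral do rewrite gee0_abs ?bessel_int_ge0//.
  by rewrite integral_bessel_int gammae_fin// divr_gt0.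
have := integrable_ae measurableT ib; apply: filterS => y /(_ I) fy _.
by rewrite bessel_kernelE -/(gammar s) EFinM fineK// muleA.
Qed.

Lemma integral_bessel_kernel1 s x : 0 < s ->
  (\int[leb]_y (bessel_kernel s (x - y))%:E = 1)%E.
Proof.
move=> s0; transitivity (\int[leb]_y ((bessel_kernel s (x - y))%:E * 1))%E.
  by apply: eq_integral => y _; rewrite mule1.
rewrite integral_bessel_kernel//.
under eq_integral do rewrite mule1.
rewrite integral_bessel_int -gammarE// -EFinM mulVf// gt_eqF//.
exact: gammar_gt0.
Qed.

Definition bpot s h x : R := \int[leb]_y (bessel_kernel s (x - y) * h y).

Lemma integrable_bessel_kernel_mul s x M h : 0 < s ->
  measurable_fun [set: R] h -> (forall y, `|h y| <= M) ->
  leb.-integrable setT (EFin \o (fun y => bessel_kernel s (x - y) * h y)).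
Proof.
move=> s0 mh hM.
have mk := measurable_bessel_kernel s (measurable_subr x).
apply/integrableP; split; first by apply/measurable_EFinP; exact: measurable_funM.
apply: (@le_lt_trans _ _ (\int[leb]_y (M%:E * (bessel_kernel s (x - y))%:E))%E).
  apply: ge0_le_integral => //.
  - apply: measurableT_comp => //; apply/measurable_EFinP.
    exact: measurable_funM.
  - by apply/measurable_EFinP; apply: measurable_funM.
  move=> y _; rewrite /= -EFinM lee_fin normrM mulrC.
  by rewrite (ger0_norm (bessel_kernel_ge0 _ s0)) ler_wpM2r// bessel_kernel_ge0.
have M0 : 0 <= M by exact: le_trans (normr_ge0 _) (hM 0).
rewrite ge0_integralZl//.
- by rewrite integral_bessel_kernel1// mule1 ltry.
- exact/measurable_EFinP.
- by move=> y _; rewrite lee_fin bessel_kernel_ge0.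
Qed.

Lemma bpot_linear s c M N h k x : 0 < s ->
  measurable_fun [set: R] h -> (forall y, `|h y| <= M) ->
  measurable_fun [set: R] k -> (forall y, `|k y| <= N) ->
  bpot s (fun y => c * h y + k y) x = c * bpot s h x + bpot s k x.
Proof.
move=> s0 mh hM mk kN.
have ih := integrable_bessel_kernel_mul x s0 mh hM.
have ik := integrable_bessel_kernel_mul x s0 mk kN.
have iZ : leb.-integrable setT
    (EFin \o (fun y => c * (bessel_kernel s (x - y) * h y))).
  by apply: eq_integrable (integrableZl measurableT c ih).
rewrite /bpot -RintegralZl// -RintegralD//.
by apply: eq_Rintegral => y _; ring.
Qed.

Lemma bpot_cst s c x : 0 < s -> bpot s (fun=> c) x = c.
Proof.
move=> s0; rewrite /bpot.
have i1 : leb.-integrable setT (EFin \o (fun y => bessel_kernel s (x - y))).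
  have := @integrable_bessel_kernel_mul s x 1 (fun=> 1) s0 (measurable_cst _).
  have h1 (y : R) : `|1 : R| <= 1 by rewrite normr1.
  by move=> /(_ h1); apply: eq_integrable => // y _ /=; rewrite mulr1.
by rewrite RintegralZr// /Rintegral integral_bessel_kernel1//= mul1r.
Qed.

(** The kernel is nonnegative with integral 1. Hence one bound M can be carried through all
    orders. *)
Lemma bpot_bound s M h x : 0 < s -> measurable_fun [set: R] h ->
  (forall y, `|h y| <= M) -> `|bpot s h x| <= M.
Proof.
move=> s0 mh hM.
have ih := integrable_bessel_kernel_mul x s0 mh hM.
have mM y : `|M| <= `|M| by [].
have iM := integrable_bessel_kernel_mul x s0 (measurable_cst M) mM.
have le1 (e : R) : `|e| <= 1 -> e * bpot s h x <= M.
  move=> e1; rewrite -[leRHS](bpot_cst M x s0) /bpot -RintegralZl//.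
  apply: le_Rintegral => //.
    apply: eq_integrable (integrableZl measurableT e ih) => // y _.
  move=> y _; rewrite mulrCA ler_wpM2l ?bessel_kernel_ge0//.
  rewrite (le_trans (ler_norm _))// normrM -[leRHS]mul1r ler_pM//.
rewrite ler_norml; have := le1 1; have := le1 (-1).
rewrite normrN normr1 mulN1r mul1r => /(_ (lexx _)) h1 /(_ (lexx _)) ->.
by rewrite andbT lerNl.
Qed.

Lemma ge0_bpotE s M h x : 0 < s -> measurable_fun [set: R] h ->
  (forall y, 0 <= h y <= M) ->
  ((bpot s h x)%:E = ((gammar s)^-1)%:E *
     \int[leb]_y (bessel_int (s / 2) (x - y)%R * (h y)%:E))%E.
Proof.
move=> s0 mh hM.
have h0 y : 0 <= h y by have /andP[] := hM y.
have hN y : `|h y| <= M by rewrite ger0_norm//; have /andP[] := hM y.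
rewrite -integral_bessel_kernel//; last exact/measurable_EFinP.
rewrite /bpot /Rintegral fineK//.
exact: integrable_fin_num (integrable_bessel_kernel_mul x s0 mh hN).
Qed.

Lemma measurable_bpot s M h : 0 < s -> measurable_fun [set: R] h ->
  (forall y, `|h y| <= M) -> measurable_fun [set: R] (bpot s h).
Proof.
move=> s0 mh hM.
(* Adding the constant M, which the potential preserves, makes the integrand nonnegative, so that
   measurability follows from Tonelli. *)
have mhM : measurable_fun [set: R] (fun y => h y + M) by exact: measurable_funD.
have hM2 y : 0 <= h y + M <= M + M.
  by have := hM y; rewrite ler_norml => /andP[]; lra.
have -> : bpot s h = (fun x => fine (((gammar s)^-1)%:E *
     \int[leb]_y (bessel_int (s / 2) (x - y)%R * (h y + M)%:E))%E - M).
  apply/funext => x; rewrite -(ge0_bpotE x s0 mhM hM2)/=.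
  have mM (y : R) : `|M| <= `|M| by [].
  have := bpot_linear 1 x s0 mh hM (measurable_cst M) mM.
  rewrite (bpot_cst M x s0) mul1r => e.
  rewrite (_ : (fun y => h y + M) = (fun y => 1 * h y + M)); last first.
    by apply/funext => y; rewrite mul1r.
  by rewrite e addrK.
apply: measurable_funB => //; apply: (measurableT_comp (fine_measurable measurableT)).
apply: emeasurable_funM => //.
apply: (measurable_fun_fubini_tonelli_F (m2 := leb)
  (fun p : R * R => (bessel_int (s / 2) (p.1 - p.2)%R * (h p.2 + M)%:E)%E)).
- apply: emeasurable_funM.
    by apply: measurable_bessel_int_comp; apply: measurable_funB.
  apply/measurable_EFinP.
  exact: (measurableT_comp mhM measurable_snd).
- move=> p; rewrite mule_ge0 ?bessel_int_ge0// lee_fin.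
  by have /andP[] := hM2 p.2.
Qed.

Lemma ge0_bpot_comp s r M h x : 0 < s -> 0 < r -> measurable_fun [set: R] h ->
  (forall y, 0 <= h y <= M) -> bpot s (bpot r h) x = bpot (s + r) h x.
Proof.
move=> s0 r0 mh hM; have sr0 : 0 < s + r by lra.
have h0 y : 0 <= h y by have /andP[] := hM y.
have hN y : `|h y| <= M by rewrite ger0_norm//; have /andP[] := hM y.
have mb := measurable_bpot r0 mh hN.
have bM y : 0 <= bpot r h y <= M.
  rewrite Rintegral_ge0/=; last first.
    by move=> z _; rewrite mulr_ge0// bessel_kernel_ge0.
  exact: le_trans (ler_norm _) (bpot_bound y r0 mh hN).
have e1 := ge0_bpotE x s0 mb bM; have e2 := ge0_bpotE x sr0 mh hM.
suff : ((bpot s (bpot r h) x)%:E = (bpot (s + r) h x)%:E)%E by case.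
apply: (etrans e1); apply: (etrans _ (esym e2)) => {e1 e2}.
transitivity (((gammar s)^-1)%:E * \int[leb]_y (bessel_int (s / 2) (x - y)%R *
     (((gammar r)^-1)%:E *
      \int[leb]_z (bessel_int (r / 2) (y - z)%R * (h z)%:E))))%E.
  congr (_ * _)%E; apply: eq_integral => y _; congr (_ * _)%E.
  exact: (ge0_bpotE y r0 mh hM).
have mhe : measurable_fun [set: R] (fun y => (h y)%:E) by exact/measurable_EFinP.
have he y : (0 <= (h y)%:E)%E by rewrite lee_fin.
have bi0 a w : (0 <= bessel_int a w)%E by exact: bessel_int_ge0.
transitivity (((gammar s)^-1)%:E * (((gammar r)^-1)%:E * \int[leb]_y \int[leb]_z
   (bessel_int (s / 2) (x - y)%R * bessel_int (r / 2) (y - z)%R * (h z)%:E)))%E.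
  congr (_ * _)%E; rewrite -ge0_integralZl//.
  - apply: eq_integral => y _; rewrite muleCA; congr (_ * _)%E.
    rewrite -ge0_integralZl//.
    + by apply: eq_integral => z _; rewrite muleA.
    + apply: emeasurable_funM => //.
      exact: measurable_bessel_int_comp (measurable_subr y).
    + by move=> z _; rewrite mule_ge0.
  - apply: (measurable_fun_fubini_tonelli_F (m2 := leb) (fun p : R * R =>
      (bessel_int (s / 2) (x - p.1)%R * bessel_int (r / 2) (p.1 - p.2)%R * (h p.2)%:E)%E)).
    + apply: emeasurable_funM; last exact: (measurableT_comp mhe measurable_snd).
      apply: emeasurable_funM; apply: measurable_bessel_int_comp; exact: measurable_funB.
    + by move=> p; rewrite !mule_ge0.
  - by move=> y _; apply: integral_ge0 => z _; rewrite !mule_ge0.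
  - by rewrite lee_fin invr_ge0 ltW// gammar_gt0.
rewrite (_ : (\int[leb]_y \int[leb]_z _ = \int[leb]_z \int[leb]_y
   (bessel_int (s / 2) (x - y)%R * bessel_int (r / 2) (y - z)%R * (h z)%:E))%E); last first.
  apply: (@tonelli R (fun y z => (bessel_int (s / 2) (x - y)%R *
    bessel_int (r / 2) (y - z)%R * (h z)%:E)%E)).
    apply: emeasurable_funM; last exact: (measurableT_comp mhe measurable_snd).
    apply: emeasurable_funM; apply: measurable_bessel_int_comp; exact: measurable_funB.
  by move=> y z; rewrite !mule_ge0.
have half_sum : r / 2 + s / 2 = (s + r) / 2 by rewrite -mulrDl addrC.
have e z : (\int[leb]_y (bessel_int (s / 2) (x - y)%R * bessel_int (r / 2) (y - z)%R * (h z)%:E) =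
   beta_int (r / 2) (s / 2) * (bessel_int ((s + r) / 2) (x - z)%R * (h z)%:E))%E.
  rewrite ge0_integralZr//.
  - by rewrite bessel_int_conv muleA half_sum.
  - by apply: emeasurable_funM; apply: measurable_bessel_int_comp; exact: measurable_funB.
  - by move=> y _; rewrite mule_ge0.
under eq_integral do rewrite e.
have beta0 : (0 <= beta_int (r / 2) (s / 2))%E.
  by apply: integral_ge0 => v _; rewrite lee_fin mulr_ge0 ?cut_power_ge0 ?powR_ge0.
(* Finite Gamma values force the beta factor to be finite, and its value Gamma(s/2) Gamma(r/2) /
   Gamma((s + r)/2) cancels the three normalisations. *)
have gM : ((gammar s)%:E * (gammar r)%:E =
    beta_int (r / 2) (s / 2) * (gammar (s + r))%:E)%E.
  by rewrite (gammarE s0) (gammarE r0) (gammarE sr0) gammaeM half_sum.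
have gs := gammar_gt0 s0; have gr := gammar_gt0 r0; have gsr := gammar_gt0 sr0.
have [b bE] : exists b : R, beta_int (r / 2) (s / 2) = b%:E.
  move: gM beta0; case: (beta_int _ _) => [b| |]// ; first by move=> _ _; exists b.
  by rewrite gt0_mulye ?lte_fin// -EFinM.
rewrite bE in gM beta0 *; rewrite ge0_integralZl//.
- rewrite !muleA; congr (_ * _)%E; rewrite -!EFinM; congr EFin.
  move: gM; rewrite -!EFinM => -[gM].
  have b0 : b = gammar s * gammar r / gammar (s + r) by rewrite gM mulfK// gt_eqF.
  rewrite b0; move: gs gr gsr; clear.
  by move: (gammar s) (gammar r) (gammar (s + r)) => u v w *; field; rewrite !gt_eqF.
- apply: emeasurable_funM => //; exact: measurable_bessel_int_comp (measurable_subr x).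
- by move=> z _; rewrite mule_ge0.
Qed.

(** Shifting h by M reduces to the nonnegative case; since constants are preserved, the shift drops
    out on both sides. *)
Lemma bpot_comp s r M h x : 0 < s -> 0 < r -> measurable_fun [set: R] h ->
  (forall y, `|h y| <= M) -> bpot s (bpot r h) x = bpot (s + r) h x.
Proof.
move=> s0 r0 mh hM; have sr0 : 0 < s + r by lra.
have mhM : measurable_fun [set: R] (fun y => 1 * h y + M).
  by apply: measurable_funD => //; exact: measurable_funM.
have hM2 y : 0 <= 1 * h y + M <= M + M.
  by have := hM y; rewrite ler_norml => /andP[]; lra.
have mM (y : R) : `|M| <= `|M| by [].
have := ge0_bpot_comp x s0 r0 mhM hM2.
rewrite (bpot_linear _ _ sr0 mh hM (measurable_cst M) mM) bpot_cst//.
have -> : bpot r (fun y => 1 * h y + M) = (fun y => 1 * bpot r h y + M).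
  apply/funext => y.
  by rewrite (bpot_linear _ _ r0 mh hM (measurable_cst M) mM) bpot_cst.
rewrite (bpot_linear _ _ s0 (measurable_bpot r0 mh hM)
  (fun y => bpot_bound y r0 mh hM) (measurable_cst M) mM) bpot_cst//.
by rewrite !mul1r => /addIr.
Qed.

End BesselPotential.

(** * The Gaussian distribution function *)

Section GaussianDistribution.
Context (R : realType).
Local Notation leb := (@lebesgue_measure R).
Implicit Types (x v : R).

(** The identity seen as a random variable, so that the limits of distribution functions at infinity
    apply to the normal law. *)
Let id_real : measurableTypeR R -> R := idfun.

#[local] HB.instance Definition _ :=
  @isMeasurableFun.Build _ _ _ _ id_real (@measurable_id _ _ setT).

(** Variance 1/2 makes the exponent exactly -v^2. The distribution function plays the part of the
    error function in the primitive for the kernel of order 2. *)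
Definition gauss_pdf v : R := (Num.sqrt pi)^-1 * expR (- v ^+ 2).

Definition gauss_sd : R := Num.sqrt 2^-1.

Lemma gauss_sd_neq0 : gauss_sd != 0.
Proof. by rewrite gt_eqF// sqrtr_gt0 invr_gt0. Qed.

Lemma gauss_pdfE v : gauss_pdf v = normal_pdf 0 gauss_sd v.
Proof.
rewrite normal_pdfE ?gauss_sd_neq0// /normal_peak /normal_fun subr0 sqr_sqrtr//.
congr (_^-1 * expR _); first by congr Num.sqrt; rewrite -mulr_natl; field.
by rewrite -mulr_natl mulfV// divr1.
Qed.

Definition gauss_cdf v : R := \int[leb]_(y in `]-oo, v]) gauss_pdf y.

Lemma gauss_cdfE v :
  (gauss_cdf v)%:E = cdf (id_real : {RV (normal_prob 0 gauss_sd) >-> R}) v.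
Proof.
rewrite /cdf /distribution /pushforward /= preimage_id /gauss_cdf /Rintegral.
rewrite fineK; last first.
  apply: integrable_fin_num => //.
  have -> : gauss_pdf = normal_pdf 0 gauss_sd.
    by apply/funext => u; exact: gauss_pdfE.
  by apply: integrableS (integrable_normal_pdf 0 gauss_sd).
by rewrite /normal_prob; apply: eq_integral => y _; rewrite gauss_pdfE.
Qed.

Lemma gauss_cdf_fine :
  gauss_cdf = fine \o cdf (id_real : {RV (normal_prob 0 gauss_sd) >-> R}).
Proof.
by apply/funext => v; rewrite -[LHS]/(fine (gauss_cdf v)%:E) gauss_cdfE.
Qed.

Lemma cvg_gauss_cdfy : gauss_cdf v @[v --> +oo%R] --> (1 : R).
Proof.
rewrite gauss_cdf_fine.
by have /fine_cvgP[_] := cvg_cdfy1 (id_real : {RV (normal_prob 0 gauss_sd) >-> R}).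
Qed.

Lemma cvg_gauss_cdfNy : gauss_cdf v @[v --> -oo%R] --> (0 : R).
Proof.
rewrite gauss_cdf_fine.
by have /fine_cvgP[_] := cvg_cdfNy0 (id_real : {RV (normal_prob 0 gauss_sd) >-> R}).
Qed.

Lemma is_derive_gauss_cdf v : is_derive v 1 gauss_cdf (gauss_pdf v).
Proof.
have gE : gauss_pdf = normal_pdf 0 gauss_sd.
  by apply/funext => u; exact: gauss_pdfE.
have ig : leb.-integrable `]-oo, v + 1] (EFin \o gauss_pdf).
  by rewrite gE; apply: integrableS (integrable_normal_pdf 0 gauss_sd).
have cg : {for v, continuous gauss_pdf}.
  by rewrite gE; exact: continuous_normal_pdf gauss_sd_neq0 v.
have v1 : v < v + 1 by rewrite ltrDl.
have [dF dE] := continuous_FTC1 v1 ig (ltNyr v) cg.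
by split => //; rewrite -derive1E.
Qed.

End GaussianDistribution.

(** * The integral defining the kernel of order 2 *)

Section SecondOrderKernel.
Context (R : realType).
Local Notation leb := (@lebesgue_measure R).
Implicit Types (t x y a : R).

(* Both squares (t^(1/2) +- a t^(-1/2))^2 equal t + a^2/t up to the constant
   +- 2 a, which the factors exp(+- 2 a) compensate. *)
Lemma bessel_second_order_primitive a t : 0 < t ->
  is_derive t 1
    (fun t : R => 2^-1 * (expR (2 * a) * gauss_cdf (t `^ 2^-1 + a * t `^ (- 2^-1)) +
            expR (- (2 * a)) * gauss_cdf (t `^ 2^-1 - a * t `^ (- 2^-1))))
    (expR (- t) * heat t (2 * a)).
Proof.
move=> t0.
(* In terms of p, with p^2 = 1 / t and t^(1/2) = t p, the final identity is rational and the two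
   terms in a cancel. *)
set p := t `^ (- 2^-1).
have p2 : p ^+ 2 = t^-1.
  rewrite -powR_mulrn ?powR_ge0// /p -powRrM.
  by rewrite (_ : - 2^-1 * 2%:R = -1) ?powR_inv1 ?(ltW t0)//; field.
have qE : t `^ 2^-1 = t * p.
  rewrite -{2}(powRr1 (ltW t0)) -powRD ?(gt_eqF t0) ?implybT//.
  by congr (_ `^ _); field.
have dq : is_derive t 1 (fun t : R => t `^ 2^-1) (2^-1 * p).
  have := is_derive1_powR 2^-1 t0.
  by rewrite (_ : 2^-1 - 1 = - 2^-1) //; field.
have dr : is_derive t 1 (fun t : R => t `^ (- 2^-1)) (- (2^-1 * p / t)).
  apply: (is_derive_eq (is_derive1_powR (- 2^-1) t0)).
  rewrite powRB ?(gt_eqF t0) ?implybT// powRr1 ?(ltW t0)// -/p; field.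
  by rewrite gt_eqF.
have dar : is_derive t 1 (fun t : R => a * t `^ (- 2^-1)) (- (a * (2^-1 * p / t))).
  by apply: (is_derive_eq (is_deriveZ a dr)); rewrite /GRing.scale/= mulrN.
have d1 : is_derive t 1 (fun t : R => t `^ 2^-1 + a * t `^ (- 2^-1))
    (2^-1 * p - a * (2^-1 * p / t)) by exact: is_deriveD.
have d2 : is_derive t 1 (fun t : R => t `^ 2^-1 - a * t `^ (- 2^-1))
    (2^-1 * p + a * (2^-1 * p / t)).
  by apply: (is_derive_eq (is_deriveB dq dar)); rewrite opprK.
have c1 := is_derive1_comp (is_derive_gauss_cdf _) d1.
have c2 := is_derive1_comp (is_derive_gauss_cdf _) d2.
have e1 := is_deriveZ (expR (2 * a)) c1.
have e2 := is_deriveZ (expR (- (2 * a))) c2.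
apply: (is_derive_eq (is_deriveZ 2^-1 (is_deriveD e1 e2))).
rewrite /GRing.scale/= -/p qE /gauss_pdf.
have E1 : expR (2 * a) * expR (- (t * p + a * p) ^+ 2) = expR (- t - a ^+ 2 / t).
  rewrite -expRD; congr expR.
  have -> : (t * p + a * p) ^+ 2 = (t + a) ^+ 2 * p ^+ 2 by ring.
  by rewrite p2; field; rewrite gt_eqF.
have E2 : expR (- (2 * a)) * expR (- (t * p - a * p) ^+ 2) = expR (- t - a ^+ 2 / t).
  rewrite -expRD; congr expR.
  have -> : (t * p - a * p) ^+ 2 = (t - a) ^+ 2 * p ^+ 2 by ring.
  by rewrite p2; field; rewrite gt_eqF.
have H : heat t (2 * a) = 2^-1 * (Num.sqrt pi)^-1 * p * expR (- (a ^+ 2 / t)).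
  rewrite heatE//; congr (_ * expR _); last by field; rewrite gt_eqF.
  rewrite sqrtrM ?mulr_ge0 ?pi_ge0// sqrtrM// -[X in Num.sqrt X * _](_ : 2 ^+ 2 = 4 :> R); last by ring.
  rewrite sqrtr_sqr ger0_norm// !invfM /p powRN powR12_sqrt ?(ltW t0)//.
transitivity (2^-1 * ((Num.sqrt pi)^-1 *
   (expR (2 * a) * expR (- (t * p + a * p) ^+ 2)) * (2^-1 * p - a * (2^-1 * p / t)) +
   (Num.sqrt pi)^-1 *
   (expR (- (2 * a)) * expR (- (t * p - a * p) ^+ 2)) * (2^-1 * p + a * (2^-1 * p / t)))).
  by ring.
rewrite E1 E2 H expRD; move: (Num.sqrt pi)^-1 => c.
by field; rewrite gt_eqF.
Qed.

Lemma gammae1 : gammae (1 : R) = 1%E.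
Proof.
rewrite /gammae.
transitivity (\int[leb]_(t in `[0%R, +oo[) (expR (- t) : R)%:E)%E.
  rewrite -integral_itv_obnd_cbnd; last first.
    by apply/measurable_EFinP; apply: measurable_funTS; apply: measurableT_comp.
  rewrite integral_half_line; apply: eq_integral => t _; congr EFin.
  rewrite /gamma_density /cut_power subrr powRr0 mulr1//.
have dE t : is_derive t 1 (fun t : R => - expR (- t)) (expR (- t)).
  have dN : is_derive t 1 (fun t : R => - t) (-1 : R) by exact: is_deriveN.
  apply: (is_derive_eq (is_deriveN (is_derive1_comp (is_derive_expR (- t)) dN))).
  by rewrite mulrN1 opprK.
rewrite (@ge0_continuous_FTC2y _ (fun t => expR (- t)) (fun t => - expR (- t)) 0 0).
- by rewrite oppr0 expR0 -EFinB sub0r opprK.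
- by move=> t _; exact: expR_ge0.
- apply: continuous_subspaceT => t; apply: continuous_comp.
    exact: continuousN.
  exact: continuous_expR.
- rewrite -oppr0; apply: cvgN; exact: cvgr_expR.
- by move=> t _; have [] := dE t.
- apply: cvg_at_right_filter; apply: cvgN; apply: continuous_comp.
    exact: continuousN.
  exact: continuous_expR.
- by move=> t _; rewrite derive1E; have [_ ->] := dE t.
Qed.

(** The primitive at +oo minus its limit at 0. At +oo both Gaussian arguments tend to +oo; at 0 the
    second tends to -oo, so exp(2 a) / 2 is subtracted and exp(-2 a) / 2 remains. *)
Lemma bessel_second_order_integral a : 0 < a ->
  (\int[leb]_(t in `[0%R, +oo[)
     (if t <= 0 then 0 else expR (- t) * heat t (2 * a))%:E =
   (2^-1 * expR (- (2 * a)))%:E)%E.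
Proof.
move=> a0.
pose F0 t := 2^-1 * (expR (2 * a) * gauss_cdf (t `^ 2^-1 + a * t `^ (- 2^-1)) +
            expR (- (2 * a)) * gauss_cdf (t `^ 2^-1 - a * t `^ (- 2^-1))).
(* Primitive and integrand are extended to t <= 0 by their limits at 0, since the fundamental
   theorem on [0, +oo[ asks for continuity at 0. *)
pose F t := if t <= 0 then 2^-1 * expR (2 * a) else F0 t.
pose f t := if t <= 0 then 0 else expR (- t) * heat t (2 * a).
have nF t : 0 < t -> \near t, F0 t = F t.
  move=> t0; near=> u; rewrite /F ifF//; apply/negbTE; rewrite -ltNge.
  by near: u; exact: lt_nbhsr.
have dF t : 0 < t -> is_derive t 1 F (f t).
  move=> t0; rewrite /f leNgt t0/=.
  exact: near_eq_is_derive (nF t t0) (bessel_second_order_primitive a t0).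
have f0 t : 0 <= f t.
  by rewrite /f; case: ifPn => // _; rewrite mulr_ge0 ?expR_ge0 ?heat_ge0.
(* The factor exp(-a^2 / t) <= t / a^2 outweighs t^(-1/2), whence the limit 0 of f at 0. *)
have fle t : 0 < t -> f t <= a ^- 2 * t `^ 2^-1.
  move=> t0; rewrite /f [t <= 0]leNgt t0/= heatE//.
  have s0 : 0 < Num.sqrt t by rewrite sqrtr_gt0.
  have e1 : expR (- t) <= 1 by rewrite -[leRHS]expR0 ler_expR; lra.
  have e2 : expR (- ((2 * a) ^+ 2 / (4 * t))) <= t / a ^+ 2.
    rewrite expRN; have -> : (2 * a) ^+ 2 / (4 * t) = a ^+ 2 / t.
      by field; rewrite gt_eqF.
    rewrite -[leRHS]invrK lef_pV2 ?posrE ?expR_gt0 ?invr_gt0 ?divr_gt0 ?exprn_gt0//.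
    by rewrite invf_div (le_trans _ (expR_ge1Dx _))// lerDr.
  have e3 : (Num.sqrt (4 * pi * t))^-1 <= (Num.sqrt t)^-1.
    rewrite lef_pV2 ?posrE ?sqrtr_gt0 ?mulr_gt0 ?pi_gt0// ler_sqrt ?mulr_ge0 ?pi_ge0 ?(ltW t0)//.
    by have := pi_ge2 R; nra.
  rewrite powR12_sqrt; last lra.
  have st : Num.sqrt t * Num.sqrt t = t by rewrite -expr2 sqr_sqrtr// ltW.
  apply: (@le_trans _ _ (1 * ((Num.sqrt t)^-1 * (t / a ^+ 2)))).
    apply: ler_pM => //; rewrite ?expR_ge0 ?mulr_ge0 ?invr_ge0 ?sqrtr_ge0 ?expR_ge0//.
    by apply: ler_pM => //; rewrite ?expR_ge0 ?invr_ge0 ?sqrtr_ge0.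
  rewrite le_eqVlt; apply/orP; left; apply/eqP.
  by rewrite -{2}st; field; rewrite !gt_eqF.
have sqrt0 : t `^ 2^-1 @[t --> 0^'+] --> (0 : R) by apply: powR_cvg0; rewrite invr_gt0.
have cf : {within `[0, +oo[, continuous f}.
  apply/continuous_within_itvcyP; split.
    move=> t; rewrite in_itv/= andbT => t0.
    have e : \near t, expR (- t) * heat t (2 * a) = f t.
      near=> u; rewrite /f ifF//; apply/negbTE; rewrite -ltNge.
      by near: u; exact: lt_nbhsr.
    have ct : {for t, continuous (fun t => expR (- t) * heat t (2 * a))}.
      have cp (c r : R) : 0 < c -> {for t, continuous (fun t => (c * t) `^ r)}.
        move=> c0; apply: (continuous_comp (f := fun t => c * t) (g := fun u => u `^ r)).
          by apply: cvgM; [exact: cvg_cst | exact: cvg_id].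
        have ct0 : 0 < c * t by rewrite mulr_gt0.
        apply: differentiable_continuous; apply/derivable1_diffP.
        by have [] := is_derive1_powR r ct0.
      apply: cvgM.
        by apply: continuous_comp; [exact: continuousN | exact: continuous_expR].
      apply: cvgM; first by apply: cp; rewrite mulr_gt0 ?pi_gt0.
      apply: continuous_comp; last exact: continuous_expR.
      by apply: cvgN; apply: cvgM; [exact: cvg_cst | exact: cp].
    rewrite /continuous_at /f leNgt t0/=.
    exact: cvg_trans (near_eq_cvg e) ct.
  rewrite {2}/f lexx.
  apply: (squeeze_cvgr (f := fun=> 0) (h := fun t => a ^- 2 * t `^ 2^-1)).
  - near=> t; rewrite f0 fle//; near: t; exact: nbhs_right_gt.
  - exact: cvg_cst.
  - rewrite -[X in _ --> X](mulr0 (a ^- 2)); apply: cvgM => //; exact: cvg_cst.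
have qy : (t : R) `^ 2^-1 @[t --> +oo%R] --> +oo%R.
  apply/cvgryPge => A; near=> t.
  have tA : A ^+ 2 <= t by near: t; apply: nbhs_pinfty_ge; exact: num_real.
  have t0 : 0 <= t by exact: le_trans (sqr_ge0 _) tA.
  rewrite powR12_sqrt// (le_trans (ler_norm _))// -sqrtr_sqr ler_sqrt//.
have ry : (t : R) `^ (- 2^-1) @[t --> +oo%R] --> (0 : R).
  have : ((t : R) `^ 2^-1)^-1 @[t --> +oo%R] --> (0 : R).
    apply/gtr0_cvgV0 => //; near=> t; apply: powR_gt0.
    by near: t; apply: nbhs_pinfty_gt; exact: num_real.
  by apply: cvg_trans; apply: near_eq_cvg; apply: nearW => t; rewrite powRN.
have r0 : (t : R) `^ (- 2^-1) @[t --> 0^'+] --> +oo%R.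
  have : ((t : R) `^ (- 2^-1))^-1 @[t --> 0^'+] --> (0 : R).
    by under eq_fun do rewrite powRN invrK.
  move/gtr0_cvgV0; apply; near=> t; apply: powR_gt0.
  by near: t; exact: nbhs_right_gt.
have ary : a * t `^ (- 2^-1) @[t --> +oo%R] --> (0 : R).
  by rewrite -[X in _ --> X](mulr0 a); apply: cvgM => //; exact: cvg_cst.
have ar0 : a * t `^ (- 2^-1) @[t --> 0^'+] --> +oo%R.
  by apply: gt0_cvgMry => //; exact: cvg_cst.
have p1 : (t : R) `^ 2^-1 + a * t `^ (- 2^-1) @[t --> +oo%R] --> +oo%R.
  apply: ger_cvgy qy; near=> t; rewrite lerDl mulr_ge0 ?powR_ge0 ?(ltW a0)//.
have p2 : (t : R) `^ 2^-1 - a * t `^ (- 2^-1) @[t --> +oo%R] --> +oo%R.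
  apply/cvgryPge => A; near=> t.
  have h1 : a * t `^ (- 2^-1) <= 1.
    by near: t; apply: (cvgr_le _ ary); exact: ltr01.
  have h2 : A + 1 <= t `^ 2^-1 by near: t; apply: (cvgry_ge qy).
  by lra.
have p3 : (t : R) `^ 2^-1 + a * t `^ (- 2^-1) @[t --> 0^'+] --> +oo%R.
  by apply: ger_cvgy ar0; near=> t; rewrite lerDr powR_ge0.
have p4 : (t : R) `^ 2^-1 - a * t `^ (- 2^-1) @[t --> 0^'+] --> -oo%R.
  apply/cvgrNyPle => A; near=> t.
  have h1 : t `^ 2^-1 <= 1.
    by near: t; apply: (cvgr_le _ sqrt0); exact: ltr01.
  have h2 : 1 - A <= a * t `^ (- 2^-1) by near: t; apply: (cvgry_ge ar0).
  by lra.
have limF (fil : set_system R) (l1 l2 : R) (pf : ProperFilter fil) :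
    gauss_cdf (t `^ 2^-1 + a * t `^ (- 2^-1)) @[t --> fil] --> l1 ->
    gauss_cdf (t `^ 2^-1 - a * t `^ (- 2^-1)) @[t --> fil] --> l2 ->
    F0 t @[t --> fil] --> 2^-1 * (expR (2 * a) * l1 + expR (- (2 * a)) * l2).
  move=> h1 h2; apply: cvgM; first exact: cvg_cst.
  by apply: cvgD; apply: cvgM => //; exact: cvg_cst.
have Fy : F t @[t --> +oo%R] --> 2^-1 * (expR (2 * a) + expR (- (2 * a))).
  have h := limF _ _ _ proper_pinfty_nbhs (cvg_comp _ _ p1 (@cvg_gauss_cdfy R))
    (cvg_comp _ _ p2 (@cvg_gauss_cdfy R)).
  rewrite !mulr1 in h; apply: (cvg_trans (near_eq_cvg _) h); near=> t.
  rewrite /F ifF//; apply/negbTE; rewrite -ltNge.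
  by near: t; apply: nbhs_pinfty_gt; exact: num_real.
have F00 : F t @[t --> 0^'+] --> F 0.
  have h := limF _ _ _ (at_right_proper_filter 0) (cvg_comp _ _ p3 (@cvg_gauss_cdfy R))
    (cvg_comp _ _ p4 (@cvg_gauss_cdfNy R)).
  rewrite mulr1 mulr0 addr0 in h; rewrite {2}/F lexx.
  apply: (cvg_trans (near_eq_cvg _) h); near=> t.
  rewrite /F ifF//; apply/negbTE; rewrite -ltNge.
  by near: t; exact: nbhs_right_gt.
rewrite (@ge0_continuous_FTC2y _ f F 0 _ _ cf Fy _ F00).
- rewrite /F lexx -EFinB; congr EFin; ring.
- by move=> t _; exact: f0.
- by move=> t t0; have [] := dF t t0.
- by move=> t; rewrite in_itv/= andbT => t0; rewrite derive1E; have [_ ->] := dF t t0.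
Unshelve. all: by end_near. Qed.

End SecondOrderKernel.

(** * The potential of order 2 inverts 1 - d^2/dx^2 *)

Section ResolventIdentity.
Context (R : realType).
Local Notation leb := (@lebesgue_measure R).
Implicit Types (x y : R).

(** The preceding integral with 2 a = |x|, which has to be positive; the normalising factor is
    Gamma(1) = 1. *)
Lemma bessel_kernel2 x : x != 0 -> bessel_kernel 2 x = 2^-1 * expR (- `|x|).
Proof.
move=> x0; rewrite bessel_kernelE divff// gammae1/= invr1 mul1r.
have a0 : 0 < `|x| / 2 by rewrite divr_gt0// normr_gt0.
transitivity (fine (2^-1 * expR (- (2 * (`|x| / 2))))%:E); last first.
  by rewrite /= [2 * _]mulrC divfK.
rewrite -(bessel_second_order_integral a0) -integral_itv_obnd_cbnd; last first.
  apply/measurable_EFinP; apply: measurable_funTS; apply: measurable_fun_ifT => //.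
    by apply: measurable_fun_ler.
  apply: measurable_funM; last exact: measurable_heat.
  by apply: measurableT_comp.
rewrite integral_half_line /bessel_int; congr fine.
apply: eq_integral => t _; congr EFin; rewrite leNgt.
rewrite /bessel_density /gamma_density /cut_power subrr powRr0 mulr1.
case: ltP => t0/=; last by rewrite !mul0r.
rewrite !mul1r; congr (_ * _).
have -> : 2 * (`|x| / 2) = `|x| by rewrite mulrC divfK.
by rewrite /heat -normrX ger0_norm// sqr_ge0.
Qed.

Lemma Rintegral_derive (a b : R) (F f : R -> R) : a < b ->
  (forall y, is_derive y 1 F (f y)) -> continuous f ->
  \int[leb]_(y in `[a, b]) f y = F b - F a.
Proof.
move=> ab dF cf.
have cF : continuous F.
  move=> y; apply: differentiable_continuous; apply/derivable1_diffP.
  by have [] := dF y.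
rewrite /Rintegral (@continuous_FTC2 _ f F a b ab)//.
- exact: continuous_subspaceT.
- split; first by move=> y _; have [] := dF y.
    by apply: cvg_at_right_filter; exact: cF.
  by apply: cvg_at_left_filter; exact: cF.
- by move=> y _; rewrite derive1E; have [_ ->] := dF y.
Qed.

(** On each side of x the kernel is one exponential and the integrand has a primitive: exp(y) (g -
    g2) is the derivative of exp(y) (g - g1), and exp(-y) (g - g2) that of -exp(-y) (g + g1). At x
    the halves of g - g1 and g + g1 add up to g. *)
Lemma bpot2_resolvent (g g1 g2 : R -> R) (al be M : R) x :
  (forall y, is_derive y 1 g (g1 y)) -> (forall y, is_derive y 1 g1 (g2 y)) ->
  continuous g2 ->
  (forall y, ~ (al <= y <= be) -> g y = 0 /\ g1 y = 0 /\ g2 y = 0) ->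
  (forall y, `|g y - g2 y| <= M) ->
  bpot 2 (fun y => g y - g2 y) x = g x.
Proof.
move=> dg dg1 cg2 supp bM.
have cont (h h' : R -> R) : (forall y, is_derive y 1 h (h' y)) -> continuous h.
  move=> dh y; apply: differentiable_continuous; apply/derivable1_diffP.
  by have [] := dh y.
have cg := cont _ _ dg; have cg1 := cont _ _ dg1.
have cu : continuous (fun y => g y - g2 y) by move=> y; apply: cvgB; [exact: cg | exact: cg2].
have mu_ : measurable_fun [set: R] (fun y => g y - g2 y) by exact: continuous_measurable_fun.
have s0 : 0 < 2 :> R by [].
have iphi := integrable_bessel_kernel_mul x s0 mu_ bM.
pose phi y := bessel_kernel 2 (x - y) * (g y - g2 y).
(* L and U lie on either side of x and outside the support, so the boundary terms there vanish. *)
pose L := Order.min al x - 1; pose U := Order.max be x + 1.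
have Lx : L < x.
  rewrite /L; have h : Order.min al x <= x.
    by rewrite ge_min lexx orbT.
  by lra.
have xU : x < U.
  rewrite /U; have h : x <= Order.max be x.
    by rewrite le_max lexx orbT.
  by lra.
have Lal : L < al.
  rewrite /L; have h : Order.min al x <= al.
    by rewrite ge_min lexx.
  by lra.
have beU : be < U.
  rewrite /U; have h : be <= Order.max be x.
    by rewrite le_max lexx.
  by lra.
have [gL [g1L _]] : g L = 0 /\ g1 L = 0 /\ g2 L = 0 by apply: supp; lra.
have [gU [g1U _]] : g U = 0 /\ g1 U = 0 /\ g2 U = 0 by apply: supp; lra.
have iS (D : set R) : measurable D -> leb.-integrable D (EFin \o phi).
  by move=> mD; apply: integrableS iphi.
have -> : bpot 2 (fun y => g y - g2 y) x = \int[leb]_(y in `[L, U]) phi y.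
  rewrite [RHS]Rintegral_mkcond; apply: eq_Rintegral => y _.
  rewrite patchE mem_setE in_itv/=; case: ifPn => //.
  move=> yLU; have [-> [_ ->]] : g y = 0 /\ g1 y = 0 /\ g2 y = 0.
    by apply: supp => ?; move/negP: yLU; apply; apply/andP; split; lra.
  by rewrite subr0 mulr0.
have := @Rintegral_itvB _ phi (BLeft L) (BRight U) x.
have iLU : leb.-integrable `[L, U] (EFin \o phi) by exact: iS.
move=> /(_ iLU); rewrite !bnd_simp => /(_ (ltW Lx) (ltW xU))/eqP.
rewrite subr_eq => /eqP ->.
have de y : is_derive y 1 (@expR R) (expR y) by exact: is_derive_expR.
have deN y : is_derive y 1 (fun y => expR (- y)) (- expR (- y)).
  have dN : is_derive y 1 (fun t : R => - t) (-1 : R) by exact: is_deriveN.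
  apply: (is_derive_eq (is_derive1_comp (is_derive_expR (- y)) dN)).
  by rewrite mulrN1.
have -> : \int[leb]_(y in `[L, x]) phi y = 2^-1 * (g x - g1 x).
  rewrite -Rintegral_itv_bndo_bndc; last by apply: iS; exact: measurable_itv.
  pose f y := 2^-1 * expR (- x) * (expR y * (g y - g2 y)).
  have cf : continuous f.
    move=> y; apply: cvgM; first exact: cvg_cst.
    by apply: cvgM; [exact: continuous_expR | exact: cu].
  transitivity (\int[leb]_(y in `[L, x[) f y).
    apply: eq_Rintegral => y; rewrite mem_setE in_itv/= => /andP[_ yx].
    rewrite /phi bessel_kernel2; last by rewrite subr_eq0 gt_eqF.
    rewrite ger0_norm; last by rewrite subr_ge0 ltW.
    by rewrite opprB addrC expRD /f; ring.
  rewrite Rintegral_itv_bndo_bndc; last first.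
    apply: (@integrableS _ _ _ leb `[L, x]%classic) => //.
      by move=> y/=; rewrite !in_itv/= => /andP[-> /ltW].
    apply: continuous_compact_integrable; first exact: segment_compact.
    exact: continuous_subspaceT.
  have dF y : is_derive y 1
      (fun y => 2^-1 * expR (- x) * (expR y * (g y - g1 y))) (f y).
    apply: (is_derive_eq (is_deriveZ (2^-1 * expR (- x))
      (is_deriveM (de y) (is_deriveB (dg y) (dg1 y))))).
    by rewrite /f /GRing.scale/= -[(g - g1) y]/(g y - g1 y); ring.
  rewrite (Rintegral_derive Lx dF cf).
  have e : expR (- x) * expR x = 1 by rewrite -expRD addNr expR0.
  rewrite gL g1L subrr !mulr0 subr0.
  transitivity (2^-1 * (expR (- x) * expR x) * (g x - g1 x)); first by ring.
  by rewrite e mulr1.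
have -> : \int[leb]_(y in `]x, U]) phi y = 2^-1 * (g x + g1 x).
  pose f y := 2^-1 * expR x * (expR (- y) * (g y - g2 y)).
  have cf : continuous f.
    move=> y; apply: cvgM; first exact: cvg_cst.
    apply: cvgM; last exact: cu.
    by apply: continuous_comp; [exact: continuousN | exact: continuous_expR].
  transitivity (\int[leb]_(y in `]x, U]) f y).
    apply: eq_Rintegral => y; rewrite mem_setE in_itv/= => /andP[xy _].
    rewrite /phi bessel_kernel2; last by rewrite subr_eq0 lt_eqF.
    rewrite ltr0_norm; last by rewrite subr_lt0.
    by rewrite opprK expRD /f; ring.
  rewrite Rintegral_itv_obnd_cbnd; last first.
    apply: (@integrableS _ _ _ leb `[x, U]%classic) => //.
      by move=> y/=; rewrite !in_itv/= => /andP[/ltW -> ->].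
    apply: continuous_compact_integrable; first exact: segment_compact.
    exact: continuous_subspaceT.
  have dF y : is_derive y 1
      (fun y => - (2^-1 * expR x) * (expR (- y) * (g y + g1 y))) (f y).
    apply: (is_derive_eq (is_deriveZ (- (2^-1 * expR x))
      (is_deriveM (deN y) (is_deriveD (dg y) (dg1 y))))).
    by rewrite /f /GRing.scale/= -[(g + g1) y]/(g y + g1 y); ring.
  rewrite (Rintegral_derive xU dF cf).
  have e : expR x * expR (- x) = 1 by rewrite -expRD subrr expR0.
  rewrite gU g1U addr0 !mulr0 sub0r.
  transitivity (2^-1 * (expR x * expR (- x)) * (g x + g1 x)); first by ring.
  by rewrite e mulr1.
by field.
Qed.

End ResolventIdentity.

(** * The Hoermander norm of exponentials *)

Section IteratedBesselPotential.
Context (R : realType).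
Implicit Types (x y M : R) (h f g : R -> R).

(** Order 0 is the identity by decree, to start the induction on k; the kernel formula does not
    produce it. *)
Definition bpotn (k : nat) h : R -> R :=
  if k is 0 then h else bpot (2 * k%:R) h.

Definition sobolev_bounded k f M : Prop := exists h,
  [/\ measurable_fun [set: R] h, (forall y, `|h y| <= M) & f = bpotn k h].

Lemma two_mul_gt0 (k : nat) : 0 < 2 * k.+1%:R :> R.
Proof. by rewrite mulr_gt0// ltr0n. Qed.

Lemma sobolev_bounded_bound k f M : sobolev_bounded k f M ->
  measurable_fun [set: R] f /\ forall y, `|f y| <= M.
Proof.
move=> [h [mh hM ->]]; case: k => [|k]//=; have k0 := two_mul_gt0 k.
split; first exact: measurable_bpot mh hM.
by move=> y; exact: bpot_bound.
Qed.

Lemma sobolev_bounded_le k f M N : M <= N ->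
  sobolev_bounded k f M -> sobolev_bounded k f N.
Proof. by move=> MN [h [mh hM e]]; exists h; split => // y; exact: le_trans MN. Qed.

Lemma sobolev_bounded_linear k c f g M N :
  sobolev_bounded k f M -> sobolev_bounded k g N ->
  sobolev_bounded k (fun x => c * f x + g x) (`|c| * M + N).
Proof.
move=> [h [mh hM ->]] [h' [mh' hN ->]]; exists (fun x => c * h x + h' x); split.
- by apply: measurable_funD => //; exact: measurable_funM.
- move=> y; rewrite (le_trans (ler_normD _ _))// lerD// normrM.
  by rewrite ler_wpM2l.
- case: k => [//|k]; apply/funext => x /=.
  by rewrite (bpot_linear c x (two_mul_gt0 k) mh hM mh' hN).
Qed.

Lemma sobolev_boundedS k f M : sobolev_bounded k f M ->
  sobolev_bounded k.+1 (bpot 2 f) M.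
Proof.
move=> [h [mh hM ->]]; exists h; split => //; apply/funext => x.
case: k => [|k]; first by rewrite /bpotn mulr1.
have two_gt0 : 0 < 2 :> R by [].
transitivity (bpot (2 + 2 * k.+1%:R) h x).
  exact: (bpot_comp x two_gt0 (two_mul_gt0 k) mh hM).
by rewrite /bpotn -[in RHS]natr1 mulrDr mulr1 addrC.
Qed.

(** Write 2 k = s + (2 k - s): the inner potential of order 2 k - s keeps the bound M. *)
Lemma sobolev_bounded_bpot k f M s : sobolev_bounded k f M -> 0 < s < 2 * k%:R ->
  exists h, [/\ measurable_fun [set: R] h, (forall y, `|h y| <= M) & f = bpot s h].
Proof.
case: k => [|k] + /andP[s0 sk]; first by rewrite mulr0 in sk; lra.
move=> [h [mh hM ->]]; have r0 : 0 < 2 * k.+1%:R - s by rewrite subr_gt0.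
exists (bpot (2 * k.+1%:R - s) h); split.
- exact: measurable_bpot mh hM.
- by move=> y; exact: bpot_bound.
- apply/funext => x; transitivity (bpot (s + (2 * k.+1%:R - s)) h x).
    by rewrite addrC subrK.
  by symmetry; exact: (bpot_comp x s0 r0 mh hM).
Qed.

End IteratedBesselPotential.

(** * Cut-off damped oscillations as Bessel potentials *)

Section DampedOscillation.
Context (R : realType).
Implicit Types (x y u v phi : R) (theta f g : R -> R).

(** The phase closes the family under differentiation, which shifts it by pi / 2, and treats cosine
    and sine at once. *)
Definition damped u v phi x : R := expR (- (u * x)) * cos (v * x + phi).

Lemma is_derive_damped u v phi x : is_derive x 1 (damped u v phi)
  (- u * damped u v phi x + v * damped u v (phi + pi / 2) x).
Proof.
have dl c d : is_derive x 1 (fun x => c * x + d) c.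
  have := is_deriveD (is_deriveZ c (is_derive_id x 1)) (is_derive_cst d x 1).
  by move=> h; apply: (is_derive_eq h); rewrite addr0 /GRing.scale/= mulr1.
have de : is_derive x 1 (fun x => expR (- (u * x))) (- u * expR (- (u * x))).
  have dm : is_derive x 1 (fun x => - (u * x)) (- u).
    by apply: (near_eq_is_derive _ (dl (- u) 0)); near=> y; rewrite addr0 mulNr.
  apply: (is_derive_eq (@is_derive1_comp _ (@expR R) (fun x => - (u * x)) x _ _
    (is_derive_expR _) dm)).
  by rewrite mulrC.
have dc := @is_derive1_comp _ (@cos R) (fun x => v * x + phi) x _ _
  (is_derive_cos _) (dl v phi).
apply: (is_derive_eq (is_deriveM de dc)).
by rewrite /damped /GRing.scale/= addrA cosDpihalf; ring.
Unshelve. all: by end_near. Qed.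

Lemma damped_pi u v phi x : damped u v (phi + pi / 2 + pi / 2) x = - damped u v phi x.
Proof. by rewrite /damped !addrA !cosDpihalf sinD cos_pihalf sin_pihalf mulr0 add0r mulr1 mulrN. Qed.

Definition smooth_on a b theta : Prop :=
  (forall n x, derivable (derive1n n theta) x 1) /\
  (forall x, ~ (a <= x <= b) -> theta x = 0).

Lemma smooth_on_is_derive a b theta x : smooth_on a b theta ->
  is_derive x 1 theta (derive1 theta x).
Proof. by move=> [d _]; split; [exact: (d 0%N) | rewrite derive1E]. Qed.

Lemma smooth_on_continuous a b theta : smooth_on a b theta -> continuous theta.
Proof.
move=> [d _] x; apply: differentiable_continuous; apply/derivable1_diffP.
exact: (d 0%N).
Qed.

Lemma smooth_on_derive a b theta : smooth_on a b theta ->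
  smooth_on a b (derive1 theta).
Proof.
move=> [d supp]; split; first by move=> n x; rewrite -derive1Sn.
move=> x nx.
have o : \near x, theta x = 0.
  have [xa|ax] := ltP x a.
    by near=> y; apply: supp => /andP[+ _]; rewrite leNgt => /negP; apply; near: y; exact: lt_nbhsl.
  have bx : b < x by rewrite ltNge; apply/negP => xb; apply: nx; rewrite ax.
  by near=> y; apply: supp => /andP[_]; rewrite leNgt => /negP; apply; near: y; exact: lt_nbhsr.
have e : \near x, (cst 0 : R -> R) x = theta x by near=> y; rewrite /= (near o y).
by rewrite derive1E -(near_eq_derive _ e) derive_cst.
Unshelve. all: by end_near. Qed.

Lemma smooth_on_bounded a b theta : smooth_on a b theta ->
  exists2 C : R, 0 <= C & forall x, `|theta x| <= C.
Proof.
move=> st; have [ab|ba] := leP a b; last first.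
  by exists 0 => // x; rewrite (proj2 st) ?normr0//; lra.
have cn : continuous (fun x => `|theta x|).
  move=> x; apply: (continuous_comp (g := fun y : R => `|y|)).
    exact: smooth_on_continuous st x.
  exact: norm_continuous.
have [c _ hc] := @EVT_max R _ a b ab (continuous_subspaceT cn).
exists `|theta c| => // x; have [xab|nx] := boolP (a <= x <= b).
  by apply: hc; rewrite in_itv.
by rewrite (proj2 st) ?normr0//; exact/negP.
Qed.

Lemma damped_le a b theta u v phi x C : smooth_on a b theta ->
  0 < u -> (forall x, `|theta x| <= C) ->
  `|theta x * damped u v phi x| <= C * expR (- (a * u)).
Proof.
move=> st u0 hC; have C0 : 0 <= C by exact: le_trans (hC 0).
have [/andP[ax xb]|nx] := boolP (a <= x <= b); last first.
  by rewrite (proj2 st) ?mul0r ?normr0 ?mulr_ge0 ?expR_ge0//; exact/negP.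
rewrite normrM ler_pM// normrM ger0_norm ?expR_ge0//.
rewrite -[leRHS]mulr1 ler_pM ?expR_ge0//; last exact: cos_max.
by rewrite ler_expR lerN2 mulrC ler_wpM2l// ltW.
Qed.

Definition damped_derive u v phi x : R :=
  - u * damped u v phi x + v * damped u v (phi + pi / 2) x.

(** The cutoff is generalised in the induction because a step uses the bounds for theta, theta' and
    theta''; the phase is quantified because differentiation shifts it. C is uniform in u, v and
    phi. *)
Lemma sobolev_bounded_damped k a b theta : smooth_on a b theta ->
  exists2 C : R, 0 <= C & forall u v phi, 0 < u ->
    sobolev_bounded k (fun x => theta x * damped u v phi x)
      (C * (1 + `|u| + `|v|) ^+ (2 * k) * expR (- (a * u))).
Proof.
elim: k theta => [|k IH] theta st.
  have [C C0 hC] := smooth_on_bounded st; exists C => // u v phi u0.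
  exists (fun x => theta x * damped u v phi x); split => //.
    apply: continuous_measurable_fun => x; apply: cvgM.
      exact: smooth_on_continuous st x.
    apply: differentiable_continuous; apply/derivable1_diffP.
    by have [] := is_derive_damped u v phi x.
  by move=> y; rewrite muln0 expr0 mulr1; exact: damped_le st u0 hC.
have st1 := smooth_on_derive st; have st2 := smooth_on_derive st1.
set theta1 := derive1 theta in st1 st2; set theta2 := derive1 theta1 in st2.
have [C0 C0_ge0 h0] := IH _ st; have [C1 C1_ge0 h1] := IH _ st1.
have [C2 C2_ge0 h2] := IH _ st2.
(* Counts the coefficients of g - g2 in units of P^2, P = 1 + |u| + |v|: theta carries v^2 - u^2, 2
   u v and 1 (2 + 2 + 1), theta' carries 2 u and 2 v (2 + 2), theta'' carries 1. *)
exists (5 * C0 + 4 * C1 + C2) => [|u v phi u0].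
  by rewrite !addr_ge0 ?mulr_ge0.
set P := 1 + `|u| + `|v|; set Q := P ^+ (2 * k) * expR (- (a * u)).
have P1 : 1 <= P by rewrite /P -addrA lerDl addr_ge0.
have uP : `|u| <= P by rewrite /P; have := normr_ge0 v; lra.
have vP : `|v| <= P by rewrite /P; have := normr_ge0 u; lra.
have Q0 : 0 <= Q by rewrite mulr_ge0 ?expR_ge0// exprn_ge0// (le_trans ler01).
have P2 : 1 <= P ^+ 2 by rewrite -[leLHS](expr1n _ 2) ler_sqr ?nnegrE ?ler01 ?(le_trans ler01).
have PP2 : P <= P ^+ 2 by rewrite expr2 ler_peMl// (le_trans ler01).
have P20 : 0 <= P ^+ 2 by exact: le_trans P2.
pose E := damped u v phi; pose E' := damped u v (phi + pi / 2).
pose dE := damped_derive u v phi; pose dE' := damped_derive u v (phi + pi / 2).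
pose g x := theta x * E x.
pose g1 x := theta x * dE x + theta1 x * E x.
pose g2 x := theta x * (- u * dE x + v * dE' x) + theta1 x * dE x
             + (theta1 x * dE x + theta2 x * E x).
have dEx x : is_derive x 1 E (dE x) by exact: is_derive_damped.
have dE'x x : is_derive x 1 E' (dE' x) by exact: is_derive_damped.
have ddEx x : is_derive x 1 dE (- u * dE x + v * dE' x).
  exact: (is_deriveD (is_deriveZ (- u) (dEx x)) (is_deriveZ v (dE'x x))).
have dt := fun x => smooth_on_is_derive x st.
have dt1 := fun x => smooth_on_is_derive x st1.
have dg x : is_derive x 1 g (g1 x).
  apply: (is_derive_eq (is_deriveM (dt x) (dEx x))).
  by rewrite /GRing.scale/= /g1 [E x * _]mulrC.
have dg1 x : is_derive x 1 g1 (g2 x).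
  apply: (is_derive_eq (is_deriveD (is_deriveM (dt x) (ddEx x))
    (is_deriveM (dt1 x) (dEx x)))).
  by rewrite /GRing.scale/= /g2 [E x * _]mulrC [dE x * _]mulrC.
have cont (h h' : R -> R) : (forall x, is_derive x 1 h (h' x)) -> continuous h.
  move=> dh x; apply: differentiable_continuous; apply/derivable1_diffP.
  by have [] := dh x.
have cE := cont _ _ dEx; have cE' := cont _ _ dE'x.
have cdE := cont _ _ ddEx.
have cdE' : continuous dE'.
  have d'' x : is_derive x 1 dE' (- u * dE' x + v * (- dE x)).
    have e : dE' = (fun x => - u * E' x + v * (- E x)).
      by apply/funext => y; rewrite /dE' /damped_derive damped_pi.
    rewrite [X in is_derive _ _ X _]e.
    exact: (is_deriveD (is_deriveZ (- u) (dE'x x)) (is_deriveZ v (is_deriveN (dEx x)))).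
  exact: cont d''.
have ct := smooth_on_continuous st; have ct1 := smooth_on_continuous st1.
have ct2 := smooth_on_continuous st2.
have cg2 : continuous g2.
  have cM (p q : R -> R) : continuous p -> continuous q -> continuous (fun x => p x * q x).
    by move=> cp cq x; apply: cvgM; [exact: cp | exact: cq].
  have cD (p q : R -> R) : continuous p -> continuous q -> continuous (fun x => p x + q x).
    by move=> cp cq x; apply: cvgD; [exact: cp | exact: cq].
  have cc (c : R) : continuous (fun _ : R => c) by move=> x; exact: cvg_cst.
  have c1 := cM _ _ ct (cD _ _ (cM _ _ (cc (- u)) cdE) (cM _ _ (cc v) cdE')).
  exact: (cD _ _ (cD _ _ c1 (cM _ _ ct1 cdE)) (cD _ _ (cM _ _ ct1 cdE) (cM _ _ ct2 cE))).
have supp x : ~ (a <= x <= b) -> g x = 0 /\ g1 x = 0 /\ g2 x = 0.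
  move=> nx; rewrite /g /g1 /g2 (proj2 st x nx) (proj2 st1 x nx) (proj2 st2 x nx).
  by rewrite !mul0r !addr0.
(* Two phase shifts change the sign, so E'' is a combination of E and E'. *)
have gE x : g x - g2 x =
    (v ^+ 2 - u ^+ 2) * (theta x * E x) + ((2 * u * v) * (theta x * E' x)
    + ((2 * u) * (theta1 x * E x) + ((- (2 * v)) * (theta1 x * E' x)
    + (-1 * (theta2 x * E x) + theta x * E x)))).
  by rewrite /g /g2 /dE /dE' /damped_derive damped_pi -/E -/E'; ring.
have hE := h0 u v phi u0; have hE' := h0 u v (phi + pi / 2) u0.
have h1E := h1 u v phi u0; have h1E' := h1 u v (phi + pi / 2) u0.
have h2E := h2 u v phi u0.
have := sobolev_bounded_linear (v ^+ 2 - u ^+ 2) hE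
  (sobolev_bounded_linear (2 * u * v) hE'
  (sobolev_bounded_linear (2 * u) h1E
  (sobolev_bounded_linear (- (2 * v)) h1E'
  (sobolev_bounded_linear (-1) h2E hE)))).
rewrite (_ : (fun x => _) = (fun x => g x - g2 x)); last first.
  by apply/funext => x; rewrite gE.
move=> hg; have [_ bM] := sobolev_bounded_bound hg.
have -> : (fun x => theta x * damped u v phi x) = bpot 2 (fun x => g x - g2 x).
  by apply/funext => x; rewrite (bpot2_resolvent x dg dg1 cg2 supp bM).
apply: sobolev_bounded_le (sobolev_boundedS hg).
have cQ c : c * P ^+ (2 * k) * expR (- (a * u)) = c * Q by rewrite -mulrA.
rewrite -/P !cQ mulnS exprD.
have -> : (5 * C0 + 4 * C1 + C2) * (P ^+ 2 * P ^+ (2 * k)) * expR (- (a * u)) =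
    2 * P ^+ 2 * (C0 * Q) + (2 * P ^+ 2 * (C0 * Q) + (2 * P ^+ 2 * (C1 * Q) +
    (2 * P ^+ 2 * (C1 * Q) + (P ^+ 2 * (C2 * Q) + P ^+ 2 * (C0 * Q))))).
  by rewrite /Q; ring.
have cP (c : R) : `|c| <= P -> `|2 * c| <= 2 * P ^+ 2.
  by move=> h; rewrite normrM ger0_norm// ler_pM2l// (le_trans h).
have sqP (c : R) : `|c| <= P -> c ^+ 2 <= P ^+ 2.
  by move=> h; rewrite -(real_normK (num_real c)) ler_sqr ?nnegrE ?(le_trans ler01 P1).
have q0 c : 0 <= c -> 0 <= c * Q by move=> c0; rewrite mulr_ge0.
apply: lerD; last apply: lerD; last apply: lerD; last apply: lerD; last apply: lerD.
- apply: ler_wpM2r; first exact: q0.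
  have := sqP _ uP; have := sqP _ vP; have := sqr_ge0 u; have := sqr_ge0 v.
  by move=> *; rewrite ler_norml; apply/andP; split; lra.
- apply: ler_wpM2r; first exact: q0.
  by rewrite -mulrA normrM ger0_norm// ler_pM2l// normrM expr2 ler_pM.
- by apply: ler_wpM2r; [exact: q0 | exact: cP].
- by apply: ler_wpM2r; [exact: q0 | rewrite normrN; exact: cP].
- by apply: ler_wpM2r; [exact: q0 | rewrite normrN normr1].
- by rewrite ler_peMl// q0.
Qed.

End DampedOscillation.

(** * The polynomial bound in |Im z| / Re z *)

Section HormanderNormOfExponentials.
Context (R : realType).
Local Notation leb := (@lebesgue_measure R).
Implicit Types (z : R[i]) (eta : R -> R[i]).

Lemma cmod_le_normD z : cmod z <= `|Re z| + `|Im z|.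
Proof.
rewrite -(@ler_pXn2r _ 2%N)// ?nnegrE ?cmod_ge0 ?addr_ge0//.
rewrite sqr_cmod -(real_normK (num_real (Re z))) -(real_normK (num_real (Im z))) sqrrD.
by rewrite -addrA lerD2l lerDr mulrn_wge0// mulr_ge0.
Qed.

Lemma cLnormy_le (h : R -> R[i]) (M : R) : 0 <= M -> (forall x, cmod (h x) <= M) ->
  (cLnorm leb +oo%E h <= M%:E)%E.
Proof.
move=> M0 hM; rewrite /cLnorm unlock; case: ifP => _; last by rewrite lee_fin.
apply/ess_supP; apply: nearW => x /=.
by rewrite lee_fin ger0_norm ?cmod_ge0.
Qed.

(** The kernel is real, so the bounded functions found for the two parts combine into a complex one;
    |z| <= |Re z| + |Im z| accounts for M + M. *)
Lemma sobolev_norm_le (s M : R) (k : nat) (f : R -> R[i]) : 0 < s < 2 * k%:R ->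
  0 <= M -> sobolev_bounded k (fun x => Re (f x)) M -> sobolev_bounded k (fun x => Im (f x)) M ->
  (sobolev_norm s f <= (M + M)%:E)%E.
Proof.
move=> sk M0 /sobolev_bounded_bpot/(_ sk)[h [mh hM hE]].
move=> /sobolev_bounded_bpot/(_ sk)[h' [mh' hM' hE']].
have hb x : cmod (Complex (h x) (h' x)) <= M + M.
  have /= hc := cmod_le_normD (Complex (h x) (h' x)).
  by have := hM x; have := hM' x; lra.
have le := cLnormy_le (addr_ge0 M0 M0) hb.
apply: (le_trans _ le); apply: ereal_inf_lbound.
exists (fun x => Complex (h x) (h' x)) => //; split.
  split; first by split; [exact: mh | exact: mh'].
  exact: le_lt_trans le (ltry _).
rewrite /aeeq; apply: aeW => x; rewrite /bessel_potential /cintegral.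
under eq_Rintegral do rewrite Re_rM/=.
under [X in Complex _ X]eq_Rintegral do rewrite Im_rM/=.
apply/eqP; rewrite eq_complex /=; apply/andP; split; apply/eqP.
  exact: (congr1 (fun g => g x) hE).
exact: (congr1 (fun g => g x) hE').
Qed.

Lemma smooth_cutoff_on eta : smooth_cutoff eta -> exists a b,
  [/\ 0 < a, smooth_on a b (fun x => Re (eta x)) & smooth_on a b (fun x => Im (eta x))].
Proof.
move=> [d [a [b [a0 supp]]] _]; exists a, b; split => //.
  split; first by move=> n x; have [] := d n x.
  by move=> x nx; have [/= ->//|/supp] := eqVneq (eta x) 0.
split; first by move=> n x; have [] := d n x.
by move=> x nx; have [/= ->//|/supp] := eqVneq (eta x) 0.
Qed.

Lemma Re_expfun z x : Re (expfun z x) = damped (Re z) (- Im z) 0 x.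
Proof.
rewrite /expfun /cexp /damped/= addr0; case: z => u v /=.
by rewrite !mul0r subr0 addr0 mulNr [x * u]mulrC [x * v]mulrC.
Qed.

Lemma Im_expfun z x : Im (expfun z x) = damped (Re z) (- Im z) (- (pi / 2)) x.
Proof.
rewrite /expfun /cexp /damped/= cosBpihalf; case: z => u v /=.
by rewrite !mul0r subr0 addr0 mulNr [x * u]mulrC [x * v]mulrC.
Qed.

Lemma damped_scale (u v phi t x : R) :
  damped u v phi (t * x) = damped (t * u) (t * v) phi x.
Proof. by rewrite /damped mulrCA mulrA [v * _]mulrCA mulrA. Qed.

Lemma poly_expR_bound (a : R) (N : nat) : 0 < a ->
  exists2 D : R, 0 <= D & forall u, 0 < u -> (1 + u) ^+ N * expR (- (a * u)) <= D.
Proof.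
move=> a0; exists (a^-1 ^+ N * (N%:R ^+ N * expR a)) => [|u u0].
  by rewrite mulr_ge0 ?exprn_ge0 ?invr_ge0 ?(ltW a0)// mulr_ge0 ?exprn_ge0 ?expR_ge0.
have au : 0 <= a * (1 + u) by rewrite mulr_ge0 ?addr_ge0 ?(ltW a0) ?(ltW u0).
have h := expr_le_expR N au.
have -> : (1 + u) ^+ N = a^-1 ^+ N * (a * (1 + u)) ^+ N.
  by rewrite -exprMn mulrA mulVf ?mul1r// gt_eqF.
rewrite -mulrA ler_pM2l ?exprn_gt0 ?invr_gt0//.
apply: (@le_trans _ _ (N%:R ^+ N * expR (a * (1 + u)) * expR (- (a * u)))).
  by rewrite ler_wpM2r ?expR_ge0.
rewrite -mulrA -expRD.
by have -> : a * (1 + u) + - (a * u) = a by ring.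
Qed.

Lemma hormander_norm_expfun eta (s : R) : smooth_cutoff eta -> 0 < s ->
  exists2 C : R, 0 <= C & exists N : nat, forall z, 0 < Re z ->
    (hormander_norm eta s (expfun z) <= (C * (1 + `|Im z| / Re z) ^+ N)%:E)%E.
Proof.
move=> /smooth_cutoff_on [a [b [a0 sr si]]] s0.
pose k := (Num.truncn s).+1.
have sk : 0 < s < 2 * k%:R.
  have : s < k%:R by exact: truncnS_gt.
  by rewrite s0 /= => h; have : 0 <= k%:R :> R by []; lra.
have [Cr Cr0 hr] := sobolev_bounded_damped k sr.
have [Ci Ci0 hi] := sobolev_bounded_damped k si.
have [D D0 hD] := poly_expR_bound (2 * k) a0.
exists ((Cr + Ci) * D + (Cr + Ci) * D); first by rewrite addr_ge0// mulr_ge0// addr_ge0.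
exists (2 * k)%N => z z0; apply: ge_ereal_sup => _ [t /= t0] <-.
set u := t * Re z; set v := t * - Im z.
set r := `|Im z| / Re z.
have u0 : 0 < u by rewrite mulr_gt0.
have r0 : 0 <= r by rewrite divr_ge0 ?(ltW z0).
set Q := (1 + `|u| + `|v|) ^+ (2 * k) * expR (- (a * u)).
(* As |v| = u r, 1 + u + |v| <= (1 + u) (1 + r). The ratio r does not depend on t, and D bounds the
   remaining factor for all u. *)
have hQ : Q <= D * (1 + r) ^+ (2 * k).
  apply: (@le_trans _ _ ((1 + r) ^+ (2 * k) * ((1 + u) ^+ (2 * k) * expR (- (a * u))))).
    rewrite mulrA ler_wpM2r ?expR_ge0// -exprMn lerXn2r ?nnegrE ?addr_ge0 ?mulr_ge0 ?addr_ge0 ?(ltW u0)//.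
    have -> : `|v| = u * r.
      by rewrite /v /u /r normrM normrN (gtr0_norm t0); field; rewrite gt_eqF.
    rewrite (gtr0_norm u0); lra.
  by rewrite mulrC ler_wpM2r ?exprn_ge0 ?addr_ge0// hD.
set M := (Cr + Ci) * (D * (1 + r) ^+ (2 * k)).
have M0 : 0 <= M by rewrite mulr_ge0 ?addr_ge0 ?mulr_ge0 ?exprn_ge0 ?addr_ge0.
have CQ : Cr * Q + Ci * Q <= M by rewrite -mulrDl ler_wpM2l ?addr_ge0.
have cQ c : c * (1 + `|u| + `|v|) ^+ (2 * k) * expR (- (a * u)) = c * Q.
  by rewrite -mulrA.
have -> : ((Cr + Ci) * D + (Cr + Ci) * D) * (1 + r) ^+ (2 * k) = M + M.
  by rewrite /M; ring.
have Ree x : Re (expfun z (t * x)) = damped u v 0 x by rewrite Re_expfun damped_scale.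
have Ime x : Im (expfun z (t * x)) = damped u v (- (pi / 2)) x.
  by rewrite Im_expfun damped_scale.
apply: (sobolev_norm_le sk) => //.
(* The real part of eta times the exponential is the difference of two damped terms, with cutoffs Re
   eta and Im eta; the imaginary part below is a sum. *)
- have := sobolev_bounded_linear (-1) (hi u v (- (pi / 2)) u0) (hr u v 0 u0).
  rewrite normrN normr1 mul1r !cQ addrC => h.
  have := sobolev_bounded_le CQ h.
  by congr sobolev_bounded; apply/funext => x /=; rewrite Re_mulc Ree Ime/=; ring.
- have := sobolev_bounded_linear 1 (hi u v 0 u0) (hr u v (- (pi / 2)) u0).
  rewrite normr1 mul1r !cQ addrC => h.
  have := sobolev_bounded_le CQ h.
  by congr sobolev_bounded; apply/funext => x /=; rewrite Im_mulc Ree Ime/=; ring.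
Qed.

End HormanderNormOfExponentials.

(** * The exponentials as admissible multipliers *)

Section Exponentials.
Context (R : realType).
Local Notation leb := (@lebesgue_measure R).
Implicit Types (z : R[i]) (eta : R -> R[i]).

Lemma continuous_damped (u v phi : R) : continuous (damped u v phi).
Proof.
move=> x; apply: differentiable_continuous; apply/derivable1_diffP.
by have [] := is_derive_damped u v phi x.
Qed.

Lemma continuous_Re_expfun z : continuous (fun x => Re (expfun z x)).
Proof. by under eq_fun do rewrite Re_expfun; exact: continuous_damped. Qed.

Lemma continuous_Im_expfun z : continuous (fun x => Im (expfun z x)).
Proof. by under eq_fun do rewrite Im_expfun; exact: continuous_damped. Qed.

Lemma cmeasurable_expfun z : cmeasurable (X := measurableTypeR R) setT (expfun z).
Proof.
split; apply: continuous_measurable_fun.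
  exact: continuous_Re_expfun.
exact: continuous_Im_expfun.
Qed.

Lemma cmod_expfun z l : cmod (expfun z l) = expR (- (Re z * l)).
Proof.
apply/eqP; rewrite -(@eqrXn2 _ 2%N) ?cmod_ge0 ?expR_ge0//; apply/eqP.
rewrite sqr_cmod Re_expfun Im_expfun /damped addr0 cosBpihalf !exprMn.
by rewrite -mulrDr cos2Dsin2 mulr1.
Qed.

Lemma continuous_locally_integrable (f : R -> R) : continuous f ->
  locally_integrable (`]0, +oo[%classic : set R) f.
Proof.
move=> cf; split.
- by apply: measurable_funTS; exact: continuous_measurable_fun.
- exact: interval_open.
- move=> K _ cK; have cn : continuous (fun x => `|f x|).
    move=> x; apply: (continuous_comp (g := fun y : R => `|y|)); first exact: cf.
    exact: norm_continuous.
  have := continuous_compact_integrable cK (continuous_subspaceT cn).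
  move=> /integrableP[_]; apply: le_lt_trans; rewrite le_eqVlt; apply/orP; left.
  by apply/eqP; apply: eq_integral => x _ /=; rewrite normr_id.
Qed.

Lemma hormander_class_expfun eta (s : R) z : smooth_cutoff eta -> 0 < s -> 0 < Re z ->
  hormander_class eta s (expfun z).
Proof.
move=> ce s0 z0; split.
- by apply: continuous_locally_integrable; exact: continuous_Re_expfun.
- by apply: continuous_locally_integrable; exact: continuous_Im_expfun.
have [C _ [N h]] := hormander_norm_expfun ce s0.
exact: le_lt_trans (h z z0) (ltry _).
Qed.

Lemma cos_natpi (k : nat) : cos (k%:R * pi) = (-1) ^+ k :> R.
Proof.
elim: k => [|k ih]; first by rewrite mul0r cos0 expr0.
by rewrite -natr1 mulrDl mul1r cosDpi ih exprS mulN1r.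
Qed.

Lemma sin_natpi (k : nat) : sin (k%:R * pi) = 0 :> R.
Proof.
elim: k => [|k ih]; first by rewrite mul0r sin0.
by rewrite -natr1 mulrDl mul1r sinDpi ih oppr0.
Qed.

(* Along the imaginary direction [pi] the exponential is the alternating sign. *)
Lemma expfun_alternating (D : nat) (delta : R) (k : nat) : (0 < D)%N ->
  expfun (Complex (D%:R * delta) (D%:R * pi)) (k%:R / D%:R) =
  ((- expR (- delta)) ^+ k)%:C%C.
Proof.
move=> D0; have Dn0 : D%:R != 0 :> R by rewrite pnatr_eq0 -lt0n.
have e (c : R) : D%:R * c * (k%:R / D%:R) = k%:R * c by field.
apply/eqP; rewrite eq_complex Re_expfun Im_expfun /damped /=.
rewrite addr0 cosBpihalf !mulNr !e cosN sinN cos_natpi sin_natpi oppr0 mulr0 eqxx andbT.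
by rewrite -mulrN expRM_natl mulrC -exprMn mulN1r.
Qed.

End Exponentials.

Section Growth.
Context (R : realType).

(** For n = m (p + 1) with m > B, 2^n = (2^m)^(p+1) >= m^(p+1) > B m^p, and B absorbs |A| (p +
    1)^p. *)
Lemma exp2_not_poly (A : R) (p : nat) :
  exists2 n : nat, (0 < n)%N & A * n%:R ^+ p < 2 ^+ n.
Proof.
pose B := `|A| * p.+1%:R ^+ p.
pose m := (Num.truncn B).+1.
have Bm : B < m%:R by exact: truncnS_gt.
exists (m * p.+1)%N; first by rewrite muln_gt0.
apply: (@le_lt_trans _ _ (B * m%:R ^+ p)).
  rewrite /B natrM exprMn -mulrA [p.+1%:R ^+ p * _]mulrC.
  by rewrite ler_wpM2r ?ler_norm// mulr_ge0 ?exprn_ge0.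
apply: (@lt_le_trans _ _ (m%:R ^+ p.+1)).
  by rewrite exprS ltr_pM2r// exprn_gt0// ltr0n.
rewrite exprM lerXn2r ?nnegrE ?exprn_ge0// -natrX ler_nat.
by apply: ltnW; exact: ltn_expl.
Qed.

End Growth.

(** * The counterexample *)

Section Counterexample.
Context (R : realType).
Local Notation mu := (cube_probability R).
Implicit Types (eta : R -> R[i]).

Lemma extends_boundedly_le d (X : measurableType d) (nu : {measure set X -> \bar R})
    (N : (X -> R[i]) -> \bar R) (K K' : \bar R) S :
  (forall f, 0 <= N f)%E -> (K <= K')%E ->
  extends_boundedly nu N K S -> extends_boundedly nu N K' S.
Proof.
move=> N0 KK' [S' [[b1 b2 b3 b4] eS]]; exists S'; split => //; split => // f Nf.
by apply: (le_trans (b4 f Nf)); exact: lee_wpmul2r.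
Qed.

(** The damping ((1 + rho) / 2)^(2 D) costs no more than the small weight (1 - delta)^D of the
    starting vertex, which therefore cancels from both sides and leaves (1 + delta)^D. *)
Lemma tilt_growth (K : R) n : (0 < n)%N ->
  (((1 + expR (- tilt R n)) / 2) ^+ 2 * (1 + tilt R n)) ^+ cube_dim n <=
    K ^+ 2 * (1 - tilt R n) ^+ cube_dim n -> 2 ^+ n <= K ^+ 2.
Proof.
move=> n0; have := tilt_ge0 R n; have := tilt_le2 R n.
have dn : (n.*2)%:R * tilt R n = 1.
  by rewrite /tilt mulfV// pnatr_eq0 -lt0n double_gt0.
move: dn; set t := tilt R n => dn t2 t0 h.
have et := expR_ge1Dx (- t).
have p0 : 0 < (1 - t) ^+ cube_dim n by rewrite exprn_gt0//; lra.
rewrite -(ler_pM2r p0); apply: le_trans h.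
apply: (@le_trans _ _ ((1 + t) ^+ cube_dim n * (1 - t) ^+ cube_dim n)).
  rewrite ler_pM2r//.
  have -> : cube_dim n = (n.*2 * n)%N by rewrite /cube_dim doubleMl.
  rewrite exprM lerXn2r ?nnegrE ?exprn_ge0//; first lra.
  (* As 2 n delta = 1, Bernoulli gives (1 + delta)^(2 n) >= 2; the n-th power remains, since D = 2 n
     n. *)
  have /(bernoulli n.*2) : 0 <= 1 + t by lra.
  by rewrite dn; lra.
rewrite mulrC -exprMn lerXn2r ?nnegrE ?mulr_ge0 ?sqr_ge0//; try lra.
rewrite ler_wpM2r//; first lra.
have : 1 - t / 2 <= (1 + expR (- t)) / 2 by lra.
move: (expR (- t)) => e he; nra.
Qed.

Lemma no_exponential_estimate eta (s C : R) : smooth_cutoff eta -> 0 < s -> 0 < C ->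
  ~ (forall z : R[i], 0 < Re z ->
      hormander_estimate mu eta (neg_generator mu (@cube_semigroup R))
        (@tilt_weight R) s C (expfun z)).
Proof.
move=> ce s0 C0 H; have [C' C'0 [N hN]] := hormander_norm_expfun ce s0.
(* A n^N will bound the right-hand side of the estimate at z: there |Im z| / Re z = 2 n pi and 1 + 2
   n pi <= (1 + 2 pi) n, while C' + 1 absorbs |m(0)| = 1. *)
pose A := C * (C' + 1) * (1 + 2 * pi) ^+ N.
(* The n obtained has A^2 n^(2 N) < 2^n, the opposite of what the antipodal bound yields for K = A
   n^N. *)
have [n n0] := exp2_not_poly (A ^+ 2) (2 * N); apply/negP; rewrite -leNgt.
have D0 : (0 < cube_dim n)%N by rewrite double_gt0 muln_gt0 n0.
have t0 : 0 < tilt R n by rewrite invr_gt0 ltr0n double_gt0.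
pose z := Complex ((cube_dim n)%:R * tilt R n) ((cube_dim n)%:R * pi) : R[i].
have z0 : 0 < Re z by rewrite mulr_gt0// ltr0n.
have z1 : `|Im z| / Re z = n.*2%:R * pi.
  rewrite /= ger0_norm ?mulr_ge0 ?pi_ge0//.
  by rewrite invfM mulrACA mulfV ?pnatr_eq0 -?lt0n// mul1r /tilt invrK mulrC.
have cm l : 0 <= l -> cmod (expfun z l) <= 1.
  move=> l0; rewrite cmod_expfun -[leRHS]expR0 ler_expR oppr_le0.
  by rewrite mulr_ge0 ?(ltW z0).
have fc := @cube_functional_calculus R 1 (expfun z) (cmeasurable_expfun z)
  (fun x => cm _ (rate_ge0 R x)).
have := H z z0 _ fc.
have cz0 : cmod (expfun z 0) = 1 by rewrite cmod_expfun mulr0 oppr0 expR0.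
rewrite cz0 => ext.
pose K := A * n%:R ^+ N.
have q1 : 1 <= (1 + n.*2%:R * pi) ^+ N :> R.
  by rewrite exprn_ege1// lerDl mulr_ge0 ?pi_ge0.
have qn : (1 + n.*2%:R * pi) ^+ N <= (1 + 2 * pi) ^+ N * n%:R ^+ N :> R.
  rewrite -exprMn lerXn2r ?nnegrE ?mulr_ge0 ?addr_ge0 ?mulr_ge0 ?pi_ge0//.
  have : 1 <= n%:R :> R by rewrite ler1n.
  rewrite -mul2n natrM; have := pi_ge0 R; nra.
have KE : (C%:E * (hormander_norm eta s (expfun z) + 1%:E) <= K%:E)%E.
  apply: (@le_trans _ _ (C%:E * (C' * (1 + `|Im z| / Re z) ^+ N + 1)%:E)%E).
    apply: lee_wpmul2l; first by rewrite lee_fin ltW.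
    by rewrite EFinD; apply: leeD2r; exact: hN.
  rewrite -EFinM lee_fin z1 /K /A -!mulrA ler_pM2l//.
  apply: (@le_trans _ _ ((C' + 1) * (1 + n.*2%:R * pi) ^+ N)); first lra.
  by rewrite ler_wpM2l// addr_ge0.
have K0 : 0 <= K.
  by rewrite !mulr_ge0 ?exprn_ge0 ?addr_ge0 ?mulr_ge0 ?pi_ge0 ?(ltW C0).
have ext' := extends_boundedly_le (fun f => poweR_ge0 _ _) KE ext.
have low := antipodal_lower_bound (expR_ge0 (- tilt R n)) K0
  (fun k => expfun_alternating (tilt R n) k D0) ext'.
apply: le_trans (tilt_growth n0 low) _.
by rewrite /K exprMn -exprM mulnC.
Qed.

End Counterexample.

Theorem theorem6p1 (R : realType) (eta : R -> R[i]) (eta_cutoff : smooth_cutoff eta) :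
  exists (d : measure_display) (X : measurableType d) (mu : probability X R)
    (T : R -> (X -> R[i]) -> X -> R[i]) (w : X -> R),
  [/\ markovian mu T,
      weight w,
      (Q2 mu T w < +oo)%E,
      forall s : R, 0 < s ->
        ~ hormander_calculus mu eta (neg_generator mu T) w s &
      forall s C : R, 0 < s -> 0 < C ->
        ~ (forall z : R[i], 0 < complex.Re z ->
             hormander_estimate mu eta (neg_generator mu T) w s C (expfun z))].
Proof.
exists _, cubes, (cube_probability R), (@cube_semigroup R), (@tilt_weight R).
split.
- exact: cube_semigroup_markovian.
- exact: tilt_weight_weight.
- exact: tilt_weight_Q2.
(* The exponentials belong to the Hoermander class and are continuous, so the calculus would include
   the estimate already refuted. *)
- move=> s s0 [C C0 h]; apply: (no_exponential_estimate eta_cutoff s0 C0) => z z0.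
  apply: h; first exact: hormander_class_expfun.
    by move=> x _; exact: continuous_Re_expfun.
  by move=> x _; exact: continuous_Im_expfun.
- by move=> s C s0 C0; exact: no_exponential_estimate.
Qed.
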